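(* Let $(\rho_i)_{i\ge 1}$ be a sequence of real numbers and let $(a_{ij})_{i,j\ge 1}$ be real random variables such that $\{a_{ii}: i\ge 1\}\cup\{(a_{ij},a_{ji}):1\le i<j\}$ is a collection of independent random variables (respectively random vectors), $\mathbf{E}[a_{ij}]=0$ and $\mathbf{E}[a_{ij}^2]=1$ for all $i,j$, the moments of every order are bounded uniformly in $i,j$ (that is, $\sup_{i,j}\mathbf{E}|a_{ij}|^q<\infty$ for every $q\in\mathbb{N}$), and $\mathbf{E}[a_{ij}a_{ji}]=\rho_{|i-j|}$ for all $i\ne j$. Let $A_n=(a_{ij})_{1\le i,j\le n}$. Suppose further that for every $k\ge 1$, all $\epsilon_1,\ldots,\epsilon_{2k}\in\{1,*\}$ and all $\pi\in NC_2(2k)$, the limit $$\lim_{n\to\infty}\frac{1}{n^{k+1}}\sum_{(i_1,\ldots,i_{2k})\in\{1,\ldots,n\}^{2k}}\ \prod_{(r,s)\in\pi}\rho_{|i_r-i_s|}^{\delta_{\epsilon_r\epsilon_s}}\,\delta_{i_ri_{s+1}}\,\delta_{i_si_{r+1}}$$ exists and is finite. Then $\bar A_n:=A_n/\sqrt n$ converges in $*$-distribution as $n\to\infty$. Moreover, if $\rho_i=\rho$ for all $i\geq 1$, then for every $k\ge 1$, all $\epsilon_1,\ldots,\epsilon_{2k}\in\{1,*\}$ and all $\pi\in NC_2(2k)$, the limit $$\lim_{n\to\infty}\frac{1}{n^{k+1}}\sum_{(i_1,\ldots,i_{2k})\in\{1,\ldots,n\}^{2k}}\ \prod_{(r,s)\in\pi}\rho_{|i_r-i_s|}^{\delta_{\epsilon_r\epsilon_s}}\,\delta_{i_ri_{s+1}}\,\delta_{i_si_{r+1}}$$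 exists and is finite, and the $*$-distribution limit of $\bar A_n$ is an elliptic element with parameter $\rho$.
   Context: A non-commutative probability space (NCP) $(\mathcal{A},\varphi)$ is a unital complex $*$-algebra $\mathcal A$ with a state $\varphi$. For $n\times n$ random matrices whose entries have all moments finite, $\varphi_n(x)=\frac1n\mathbf{E}\,\mathrm{Tr}(x)$. A sequence of random matrices $A_n$ converges in $*$-distribution to $a\in(\mathcal{A},\varphi)$ if for every $k$ and every $\epsilon_1,\ldots,\epsilon_k\in\{1,*\}$, $\lim_n\varphi_n(A_n^{\epsilon_1}\cdots A_n^{\epsilon_k})=\varphi(a^{\epsilon_1}\cdots a^{\epsilon_k})$; it converges in $*$-distribution if such an $a$ in some NCP exists. $NC_2(2k)$ is the set of non-crossing pair partitions of $\{1,\ldots,2k\}$. $\delta$ is the Kronecker delta (so $\delta_{\epsilon_r\epsilon_s}=1$ if $\epsilon_r=\epsilon_s$ and $0$ otherwise), indices are cyclic ($i_{2k+1}=i_1$), $x^0=1$ for every real $x$, and $\rho_0:=1$. A (standard) semi-circular element is a self-adjoint element $s$ with $\varphi(s^p)=\frac{1}{2\pi}\int_{-2}^2t^p\sqrt{4-t^2}\,dt$ for all $p\in\mathbb{N}$. For $\rho\in[-1,1]$, an elliptic element with parameter $\rho$ is $e=\sqrt{\frac{1+\rho}{2}}\,s_1+i\sqrt{\frac{1-\rho}{2}}\,s_2$ with $s_1,s_2$ free semi-circular elements. *)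

(* Defs.v *)
From HB Require Import structures.
From mathcomp Require Import all_boot all_order all_algebra complex.
From mathcomp Require Import all_classical all_reals all_analysis.

Set Implicit Arguments.
Unset Strict Implicit.
Unset Printing Implicit Defensive.

Import Order.TTheory GRing.Theory Num.Theory.
Import numFieldNormedType.Exports.

Local Open Scope classical_set_scope.
Local Open Scope ring_scope.
Local Open Scope complex_scope.

(* Unital complex *-algebras with a state.  In R[i] the relation 0 <= z means
   that z is real and nonnegative. *)
Record ncps (R : realType) := NCPS {
  ncps_alg :> algType R[i];
  star : ncps_alg -> ncps_alg;
  starK : involutive star;
  starD : forall x y, star (x + y) = star x + star y;
  starM : forall x y, star (x * y) = star y * star x;
  starZ : forall (c : R[i]) x, star (c *: x) = c^* *: star x;
  state : {scalar ncps_alg};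
  state1 : state 1 = 1;
  state_ge0 : forall x, 0 <= state (star x * x)
}.
Arguments star {R n}.
Arguments state {R n}.

(* An exponent in {1, *} is a boolean, [true] standing for *; a word in the
   exponents is a sequence of booleans. *)
Definition star_word (R : realType) (A : ncps R) (w : seq bool) (x : A) : A :=
  \prod_(e <- w) (if e then star x else x).

Section random_matrices.
Context (R : realType) (d : measure_display) (T : measurableType d).
Variable P : probability T R.

Definition expectationC (X : T -> R[i]) : R[i] :=
  fine 'E_P[fun t => complex.Re (X t)] +i* fine 'E_P[fun t => complex.Im (X t)].

Definition adjmx n (M : 'M[R[i]]_n) : 'M[R[i]]_n := map_mx Num.conj M^T.

Definition mx_word n (w : seq bool) (M : 'M[R[i]]_n) : 'M[R[i]]_n :=
  \prod_(e <- w) (if e then adjmx M else M).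

Definition mx_state n (X : T -> 'M[R[i]]_n) : R[i] :=
  n%:R^-1 * expectationC (fun t => \tr (X t)).

Definition cvg_stardist_to (X : forall n, T -> 'M[R[i]]_n)
    (A : ncps R) (x : A) : Prop :=
  forall w : seq bool,
    (fun n => mx_state (fun t => mx_word w (X n t)) : R[i]^o) @ \oo
      --> (state (star_word w x) : R[i]^o).

Definition cvg_stardist (X : forall n, T -> 'M[R[i]]_n) : Prop :=
  exists (A : ncps R) (x : A), cvg_stardist_to X x.

(* Indices start at 0 instead of 1. *)
Definition scaled_mx (a : nat -> nat -> T -> R) (n : nat) (t : T) :
    'M[R[i]]_n :=
  \matrix_(i < n, j < n) (a i j t / Num.sqrt n%:R)%:C.

Definition mutually_independent (I : choiceType) (D : set I)
    (F : I -> set (set T)) : Prop :=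
  forall (s : seq I) (E : I -> set T), uniq s ->
    (forall i, i \in s -> D i /\ F i (E i)) ->
    P (\bigcap_(i in [set` s]) E i) = (\prod_(i <- s) P (E i))%E.

(* The sigma-algebra generated by a_ii (if i = j), by the random vector
   (a_ij, a_ji) (if i <> j). *)
Definition entry_sigma (a : nat -> nat -> T -> R) (ij : nat * nat) :
    set (set T) :=
  if ij.1 == ij.2 then
    preimage_set_system setT (a ij.1 ij.1) (measurable : set (set R))
  else
    preimage_set_system setT (fun t => (a ij.1 ij.2 t, a ij.2 ij.1 t))
      (measurable : set (set (R * R)%type)).

End random_matrices.

Definition noncrossing n (sigma : {set {set 'I_n}}) : Prop :=
  forall B C : {set 'I_n}, B \in sigma -> C \in sigma ->
  forall p q r s : 'I_n, p \in B -> q \in C -> r \in B -> s \in C ->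
    (p < q)%N -> (q < r)%N -> (r < s)%N -> B = C.

Definition NC2 n (sigma : {set {set 'I_n}}) : Prop :=
  [/\ finset.partition sigma [set: 'I_n]%SET, forall B, B \in sigma -> #|B| = 2%N
    & noncrossing sigma].

(* [ordS] is the cyclic successor; a block (r, s) is listed with r < s. *)
Definition pairing_sum (R : realType) (rho : nat -> R) k
    (eps : 'I_k.*2 -> bool) (sigma : {set {set 'I_k.*2}}) (n : nat) : R :=
  (n%:R ^+ k.+1)^-1 *
  \sum_(i : {ffun 'I_k.*2 -> 'I_n})
    \prod_(r < k.*2) \prod_(s < k.*2 | (r < s)%N && ([set r; s]%SET \in sigma))
      (rho `|(i r)%:Z - (i s)%:Z|%N ^+ (eps r == eps s)
       * (i r == i (ordS s))%:R * (i s == i (ordS r))%:R).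

Definition pairing_limits_exist (R : realType) (rho : nat -> R) : Prop :=
  forall k, (0 < k)%N -> forall (eps : 'I_k.*2 -> bool)
    (sigma : {set {set 'I_k.*2}}), NC2 sigma ->
  exists l : R, pairing_sum rho eps sigma @ \oo --> l.

Section elliptic_elements.
Context (R : realType) (A : ncps R).

Record unital_star_subalgebra (S : set A) : Prop := {
  subalgebra1 : S 1;
  subalgebraD : forall x y, S x -> S y -> S (x + y);
  subalgebraM : forall x y, S x -> S y -> S (x * y);
  subalgebraZ : forall (c : R[i]) x, S x -> S (c *: x);
  subalgebra_star : forall x, S x -> S (star x)
}.

Definition generated_subalgebra (x : A) : set A :=
  smallest unital_star_subalgebra [set x].

Definition free_subalgebras (I : eqType) (S : I -> set A) : Prop :=
  forall l : seq (I * A), l != [::] ->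
    (forall u, u \in l -> S u.1 u.2 /\ state u.2 = 0) ->
    sorted (fun u v => u.1 != v.1) l ->
    state (\prod_(u <- l) u.2) = 0.

Definition free_elements (I : eqType) (x : I -> A) : Prop :=
  free_subalgebras (fun i => generated_subalgebra (x i)).

Definition semicircular (s : A) : Prop :=
  star s = s /\
  forall p : nat, state (s ^+ p) =
    ((2 * pi)^-1 * \int[lebesgue_measure]_(t in `[(-2 : R), 2])
                     (t ^+ p * Num.sqrt (4 - t ^+ 2)))%:C.

Definition elliptic (r : R) (e : A) : Prop :=
  -1 <= r <= 1 /\
  exists s1 s2 : A,
    [/\ semicircular s1, semicircular s2,
        free_elements (fun b : bool => if b then s2 else s1)
      & e = (Num.sqrt ((1 + r) / 2))%:C *: s1
            + ('i * (Num.sqrt ((1 - r) / 2))%:C) *: s2].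

End elliptic_elements.

(* Main.v *)
Require Import Defs.
From HB Require Import structures.
From mathcomp Require Import all_boot all_order all_algebra complex.
From mathcomp Require Import all_classical all_reals all_analysis.
From mathcomp Require Import measurable_realfun.
From mathcomp Require multinomials.monalg.
Import (canonicals, coercions) multinomials.monalg.
From mathcomp Require Import zify ring lra.

Set Implicit Arguments.
Unset Strict Implicit.
Unset Printing Implicit Defensive.

Import Order.TTheory GRing.Theory Num.Theory.
Import numFieldNormedType.Exports.

Local Open Scope classical_set_scope.
Local Open Scope ring_scope.

(** The proof is the moment method, completed by a Fock space model of the limit.

    The normalised trace of a word of length m in A_n and its transpose is a sum,
    over closed walks i of length m on the vertices 1..n, of expectations of
    products of entries.  Two entries are dependent only if they sit on the same
    unordered edge, so an edge used once kills the expectation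
    ([path_moment_undoubled]).  When every edge is used at least twice, the walk
    visits at most m/2 + 1 vertices ([nb_vertices_doubled]): each new vertex is
    discovered along an edge of its own.  Walks with fewer vertices are too few to
    matter after normalisation ([card_few_vertices]).  In the extremal case m = 2k
    the walk runs along a tree, twice along each edge and in opposite directions;
    cutting the tree at an edge shows that the pairing of the steps by edges is
    non-crossing ([tree_backtrack], [tree_noncrossing]), that it is the only
    pairing compatible with the walk ([compatible_tree]), and that the expectation
    is its weight ([path_moment_tree]).  Hence the trace moment of a word of length
    2k differs from the sum over NC_2(2k) of the pairing sums by O(1/n)
    ([word_moment_even]), and odd moments vanish in the limit
    ([word_moment_odd]).

    If the pairing sums converge, so do all moments.  Their limit is a functional
    on the free star-algebra, positive as a limit of positive functionals, and
    this algebra with this state is the required space ([cvg_stardist_limits]).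

    If the correlation is constant, a pairing in NC_2(2k) is compatible with
    exactly n^(k+1) walks ([card_compatible]), so its sum tends to the product of
    its covariances, r for equal exponents and 1 for different ones
    ([cvg_pairing_sum]).  On the other side, semicircular elements are realised
    through the vacuum moments of the field operators of the full Fock space over
    C^2.  Expanding field operators into creation and annihilation parts gives the
    Wick formula, a sum over NC_2 of products of covariances ([wick]); the vectors
    defining the elliptic element have precisely the covariances r and 1
    ([elliptic_vec_cov]).  Freeness holds because a centred polynomial in one field
    operator adds at least one tensor factor of its own colour
    ([generators_free]), and the law of one field operator is the semicircle law
    since both moment sequences obey the recursion of the Catalan numbers
    ([semicircle_moment_ballot]). *)

(** * Random variables with moments of every order *)

Section Moments.
Context (R : realType) (d : measure_display) (T : measurableType d).
Variable P : probability T R.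
Implicit Types (X Y Z : T -> R).

Definition Ex X : R := \int[P]_t X t.

(** Unlike integrability alone, this property is stable under products. *)
Definition has_moments X := measurable_fun setT X /\
  forall q : nat, P.-integrable setT (EFin \o (fun t => `|X t| ^+ q)).

Lemma integrable_dominated X Y : measurable_fun setT X ->
  P.-integrable setT (EFin \o Y) -> (forall t, `|X t| <= Y t) ->
  P.-integrable setT (EFin \o X).
Proof.
move=> mX iY XY; apply: (le_integrable _ _ _ iY) => //.
  exact/measurable_EFinP.
by move=> t _ /=; rewrite lee_fin (le_trans (XY t)) ?ler_norm.
Qed.

Lemma has_moments_integrable X : has_moments X -> P.-integrable setT (EFin \o X).
Proof. by case=> mX /(_ 1%N) /(integrable_dominated mX); apply=> t; rewrite expr1. Qed.

Lemma has_moments_cst (c : R) : has_moments (fun=> c).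
Proof.
by split=> [|q]; [exact: measurable_cst|exact: finite_measure_integrable_cst].
Qed.

Lemma has_moments_le X Y : measurable_fun setT X -> has_moments Y ->
  (forall t, `|X t| <= `|Y t|) -> has_moments X.
Proof.
move=> mX [mY iY] XY; split=> // q; apply: (integrable_dominated _ (iY q)).
  exact/measurable_funX/measurableT_comp.
by move=> t; rewrite normrX normr_id lerXn2r // nnegrE.
Qed.

Lemma has_moments_indic (A : set T) : measurable A -> has_moments \1_A.
Proof.
move=> mA; apply: (has_moments_le _ (has_moments_cst 1)).
  exact: measurable_indic.
by move=> t; rewrite indicE normr1 normr_nat; case: (_ \in _); rewrite ?ler01.
Qed.

Lemma has_momentsM X Y : has_moments X -> has_moments Y ->
  has_moments (fun t => X t * Y t).
Proof.
move=> [mX iX] [mY iY]; split=> [|q]; first exact: measurable_funM.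
apply: (@integrable_dominated _ (fun t => `|X t| ^+ (2 * q) + `|Y t| ^+ (2 * q))).
- exact/measurable_funX/measurableT_comp/measurable_funM.
- exact: (integrableD measurableT (iX _) (iY _)).
- move=> t; rewrite ger0_norm ?exprn_ge0 // normrM exprMn !exprM.
  have := sqr_ge0 (`|X t| ^+ q - `|Y t| ^+ q).
  have : 0 <= `|X t| ^+ q * `|Y t| ^+ q by rewrite mulr_ge0 ?exprn_ge0.
  by rewrite ![(_ ^+ 2) ^+ q]exprAC; nra.
Qed.

Lemma has_moments_prod (I : Type) (s : seq I) (p : pred I) (X : I -> T -> R) :
  (forall e, has_moments (X e)) ->
  has_moments (fun t => \prod_(e <- s | p e) X e t).
Proof.
move=> hX; elim: s => [|e s IH].
  under boolp.eq_fun do rewrite big_nil; exact: has_moments_cst.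
under boolp.eq_fun do rewrite big_cons.
by case: (p e) => //; exact: has_momentsM.
Qed.

Lemma Ex_dominated_cvg (f : nat -> T -> R) X Y :
  (forall n, measurable_fun setT (f n)) -> P.-integrable setT (EFin \o Y) ->
  (forall n t, `|f n t| <= Y t) -> (forall t, f ^~ t @ \oo --> X t) ->
  (fun n => Ex (f n)) @ \oo --> Ex X.
Proof.
move=> mf iY fY fX.
have mX : measurable_fun setT X.
  by apply: (measurable_fun_cvg mf) => t _; exact: fX.
have [iX _ H] : [/\ P.-integrable setT (EFin \o X),
    [sequence \int[P]_x `|(f n x)%:E - (X x)%:E| ]_n @ \oo --> 0%E &
    [sequence \int[P]_x (f n x)%:E]_n @ \oo --> \int[P]_x (X x)%:E]%E.
  apply: (@dominated_convergence _ _ _ P _ measurableT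
    (fun n => EFin \o f n) (EFin \o X) (EFin \o Y)) => //.
  - by move=> n; apply/measurable_EFinP.
  - exact/measurable_EFinP.
  - by apply: aeW => t _; apply: cvg_EFin; [exact: nearW|exact: fX].
  - by apply: aeW => t n _; rewrite lee_fin.
apply: fine_cvg; rewrite fineK //; exact: integrable_fin_num.
Qed.

Import HBNNSimple.

(** The positive and negative parts of the identity are approximated from below;
    this gives the domination by [|x|], hence by [|X|] after composition with any
    random variable X, that dominated convergence requires. *)
Lemma finite_range_approximation : exists g : nat -> R -> R,
  [/\ forall n, measurable_fun setT (g n), forall n, finite_set (range (g n)),
    forall x : R, g ^~ x @ \oo --> x & forall n x, `|g n x| <= `|x|].
Proof.
have mp : measurable_fun setT (fun x : R => (Num.max x 0)%:E).
  by apply/measurable_EFinP/measurable_maxr => //; exact: measurable_cst.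
have mn : measurable_fun setT (fun x : R => (Num.max (- x) 0)%:E).
  by apply/measurable_EFinP/measurable_maxr => //; exact: measurable_cst.
pose gp n := nnsfun_approx measurableT mp n.
pose gn n := nnsfun_approx measurableT mn n.
have p0 (x : R) : [set: R] x -> (0 <= (Num.max x 0)%:E)%E.
  by move=> _; rewrite lee_fin le_max lexx orbT.
have n0 (x : R) : [set: R] x -> (0 <= (Num.max (- x) 0)%:E)%E.
  by move=> _; rewrite lee_fin le_max lexx orbT.
have cp x := fine_cvg (cvg_nnsfun_approx measurableT mp p0 (x := x) I).
have cn x := fine_cvg (cvg_nnsfun_approx measurableT mn n0 (x := x) I).
have lp n x : 0 <= gp n x <= Num.max x 0.
  rewrite fun_ge0 /= -lee_fin /gp nnsfun_approxE; exact: le_approx.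
have ln n x : 0 <= gn n x <= Num.max (- x) 0.
  rewrite fun_ge0 /= -lee_fin /gn nnsfun_approxE; exact: le_approx.
exists (fun n x => gp n x - gn n x); split.
- by move=> n; apply: measurable_funB.
- move=> n; apply: (finite_image11 (fun x y => x - y)); exact: fimfunP.
- move=> x; have e : Num.max x 0 - Num.max (- x) 0 = x.
    by rewrite !maxEle; do !case: ifP; lra.
  by rewrite -[X in _ --> X]e; apply: cvgB; [exact: cp|exact: cn].
- have H (p m y : R) : 0 <= p <= Num.max y 0 -> 0 <= m <= Num.max (- y) 0 ->
      `|p - m| <= `|y|.
    by case: (leP y 0) => ?; case: (leP (- y) 0) => ? /andP[? ?] /andP[? ?];
      case: ger0P => ?; case: ger0P => ?; lra.
  by move=> n x; apply: H.
Qed.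

Lemma has_momentsZ c X : has_moments X -> has_moments (fun t => c * X t).
Proof. exact/has_momentsM/has_moments_cst. Qed.

Lemma ExZ c X : has_moments X -> Ex (fun t => c * X t) = c * Ex X.
Proof. by move=> hX; apply: RintegralZl => //; exact: has_moments_integrable. Qed.

Lemma Ex_cst c : Ex (fun=> c) = c.
Proof. by rewrite /Ex Rintegral_cst //= probability_setT mulr1. Qed.

Lemma ExD X Y : has_moments X -> has_moments Y ->
  Ex (fun t => X t + Y t) = Ex X + Ex Y.
Proof. by move=> hX hY; apply: RintegralD => //; exact: has_moments_integrable. Qed.

Lemma has_momentsD X Y : has_moments X -> has_moments Y ->
  has_moments (fun t => X t + Y t).
Proof.
move=> hX hY; have mD := measurable_funD hX.1 hY.1.
have hm : has_moments (fun t => Num.max `|X t| `|Y t|).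
  split=> [|q]; first by apply: measurable_maxr; apply: measurableT_comp; [|exact: hX.1| |exact: hY.1].
  apply: (@integrable_dominated _ (fun t => `|X t| ^+ q + `|Y t| ^+ q)).
  - apply/measurable_funX/measurableT_comp => //.
    by apply: measurable_maxr; apply: measurableT_comp; [|exact: hX.1| |exact: hY.1].
  - exact: (integrableD measurableT (hX.2 _) (hY.2 _)).
  - move=> t; rewrite ger0_norm ?exprn_ge0 // ger0_norm ?le_max ?normr_ge0 //.
    by rewrite maxEle; case: ifP => _; rewrite ?lerDl ?lerDr exprn_ge0.
apply: (has_moments_le mD (has_momentsZ 2 hm)) => t.
rewrite (le_trans (ler_normD _ _)) // [leRHS]ger0_norm; last first.
  by rewrite mulr_ge0 // le_max normr_ge0.
by rewrite maxEle; case: ifP => ?; lra.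
Qed.

Lemma has_moments_sum (I : Type) (s : seq I) (p : pred I) (X : I -> T -> R) :
  (forall e, has_moments (X e)) ->
  has_moments (fun t => \sum_(e <- s | p e) X e t).
Proof.
move=> hX; elim: s => [|e s IH].
  under boolp.eq_fun do rewrite big_nil; exact: has_moments_cst.
under boolp.eq_fun do rewrite big_cons.
by case: (p e) => //; exact: has_momentsD.
Qed.

Lemma Ex_sum (I : Type) (s : seq I) (p : pred I) (X : I -> T -> R) :
  (forall e, has_moments (X e)) ->
  Ex (fun t => \sum_(e <- s | p e) X e t) = \sum_(e <- s | p e) Ex (X e).
Proof.
move=> hX; elim: s => [|e s IH].
  by under boolp.eq_fun do rewrite big_nil; rewrite big_nil Ex_cst.
under boolp.eq_fun do rewrite big_cons.
by rewrite big_cons; case: (p e) => //; rewrite ExD ?IH //; exact: has_moments_sum.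
Qed.

Lemma le_Ex X Y : has_moments X -> has_moments Y -> (forall t, X t <= Y t) ->
  Ex X <= Ex Y.
Proof. by move=> hX hY XY; apply: le_Rintegral => //; exact: has_moments_integrable. Qed.

Lemma le_norm_Ex X : has_moments X -> `|Ex X| <= Ex (fun t => `|X t|).
Proof. by move=> hX; apply: le_normr_Rintegral => //; exact: has_moments_integrable. Qed.

(** The hypothesis is the product rule for the indicators of the events of the
    sigma-algebra of X.  It extends by linearity to functions of X with finite
    range, and then to X by dominated convergence. *)
Lemma Ex_independentM Y X : has_moments Y -> has_moments X ->
  (forall B, measurable B -> Ex (fun t => Y t * \1_(X @^-1` B) t) =
     Ex Y * Ex \1_(X @^-1` B)) ->
  Ex (fun t => Y t * X t) = Ex Y * Ex X.
Proof.
move=> hY hX ind; have [g [mg fg cg dg]] := finite_range_approximation.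
have mX B : measurable B -> measurable (X @^-1` B).
  by move=> mB; rewrite -[_ @^-1` _]setTI; apply: hX.1.
have {fg} [s [us sg]] : exists s : nat -> seq R,
    (forall n, uniq (s n)) /\ forall n x, g n x \in s n.
  have H n : exists r : seq R, uniq r /\ forall x, g n x \in r.
    have /finite_seqP[r rE] := fg n; exists (undup r); split=> [|x].
      exact: undup_uniq.
    have : range (g n) (g n x) by exists x.
    by rewrite rE mem_undup.
  by exists (fun n => projT1 (cid (H n))); split=> n; case: (projT2 (cid (H n))).
have gE n t : g n (X t) = \sum_(c <- s n)
    c * \1_(X @^-1` (g n @^-1` [set c])) t.
  rewrite (bigD1_seq (g n (X t))) //= indicE mem_set // mulr1.
  rewrite big1 ?addr0 // => c /eqP nc; rewrite indicE memNset ?mulr0 //=.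
  exact/nesym.
have mgB n c : measurable (g n @^-1` [set c]).
  by rewrite -[_ @^-1` _]setTI; apply: mg.
have mgc n c : measurable (X @^-1` (g n @^-1` [set c])) by exact: mX.
have hi n c := has_moments_indic (mgc n c).
have hgX n : has_moments (fun t => g n (X t)).
  by apply: (has_moments_le _ hX) => //; apply: measurableT_comp hX.1.
have gn n : Ex (fun t => Y t * g n (X t)) = Ex Y * Ex (fun t => g n (X t)).
  under [X in Ex X]boolp.eq_fun do rewrite gE mulr_sumr.
  rewrite Ex_sum; last by move=> c; apply: has_momentsM => //; exact: has_momentsZ.
  under [X in _ * Ex X]boolp.eq_fun do rewrite gE.
  rewrite Ex_sum; last by move=> c; exact: has_momentsZ.
  rewrite mulr_sumr; apply: eq_bigr => c _.
  under boolp.eq_fun do rewrite mulrCA.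
  by rewrite (ExZ c (has_momentsM hY (hi n c))) (ExZ c (hi n c)) ind // mulrCA.
have c1 : (fun n => Ex (fun t => Y t * g n (X t))) @ \oo --> Ex (fun t => Y t * X t).
  apply: (@Ex_dominated_cvg _ _ (fun t => `|Y t * X t|)).
  - by move=> n; apply: (has_momentsM hY (hgX n)).1.
  - exact: integrable_norm (has_moments_integrable (has_momentsM hY hX)).
  - by move=> n t; rewrite !normrM ler_wpM2l.
  - by move=> t; apply: cvgM; [exact: cvg_cst|exact: cg].
have c2 : (fun n => Ex (fun t => g n (X t))) @ \oo --> Ex X.
  apply: (@Ex_dominated_cvg _ _ (fun t => `|X t|)) => //.
  - by move=> n; exact: (hgX n).1.
  - exact: integrable_norm (has_moments_integrable hX).
have c3 : (fun n => Ex Y * Ex (fun t => g n (X t))) @ \oo --> Ex Y * Ex X.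
  by apply: cvgM; [exact: cvg_cst|exact: c2].
rewrite (boolp.funext gn) in c1.
exact: (cvg_unique _ c1 c3).
Qed.

End Moments.

(** * Product rule for independent variables *)
Section IndependentProduct.
Context (R : realType) (d : measure_display) (T : measurableType d).
Variable P : probability T R.

Lemma Ex_indic (A : set T) : measurable A -> Ex P \1_A = fine (P A).
Proof. by move=> mA; rewrite /Ex /Rintegral integral_indic // setIT. Qed.

(** Induction on [s1]: by [Ex_independentM] the variable at the head of [s1] may
    be replaced with the indicator of an arbitrary event of its sigma-algebra, that
    is, moved to [s2].  When [s1] is empty only independence of events is left. *)
Lemma Ex_prod_independent (I : choiceType) (D : set I) (F : I -> set (set T))
    (X : I -> T -> R) (s1 s2 : seq I) (E : I -> set T) :
  mutually_independent P D F -> (forall e, has_moments P (X e)) ->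
  (forall e B, D e -> measurable B -> F e (X e @^-1` B)) ->
  (forall e A, F e A -> measurable A) ->
  uniq (s1 ++ s2) -> (forall e, e \in s1 ++ s2 -> D e) ->
  (forall e, e \in s2 -> F e (E e)) ->
  Ex P (fun t => (\prod_(e <- s1) X e t) * \prod_(e <- s2) \1_(E e) t) =
  (\prod_(e <- s1) Ex P (X e)) * \prod_(e <- s2) fine (P (E e)).
Proof.
move=> ind hX XF mF; elim: s1 s2 E => [|e s1 IH] s2 E; last first.
  rewrite cat_cons /= => /andP[nes u] De FE.
  have Des e' : e' \in s1 ++ s2 -> D e' by move=> h; apply: De; rewrite inE h orbT.
  have De' : D e by apply: De; rewrite inE eqxx.
  under boolp.eq_fun do rewrite big_cons -mulrA mulrC.
  have hI e' : e' \in s2 -> has_moments P \1_(E e').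
    by move=> h; apply: has_moments_indic; apply/mF/FE.
  have hP : has_moments P (fun t => \prod_(e <- s2) \1_(E e) t : R).
    rewrite (_ : (fun t => _) = fun t => \prod_(e <- s2)
       (if e \in s2 then \1_(E e) t else 1)); last first.
      by apply/funext => t; apply: eq_big_seq => e' ->.
    apply: has_moments_prod => e'; have [/hI//|_] := boolP (e' \in s2).
    exact: has_moments_cst.
  rewrite Ex_independentM //; last 2 first.
  - by apply: has_momentsM => //; exact: has_moments_prod.
  - move=> B mB; pose E' e' := if e' == e then X e @^-1` B else E e'.
    have eE e' : e' \in s2 -> E' e' = E e'.
      rewrite /E'; case: eqP => // -> h; move: nes; rewrite mem_cat h orbT //.
    have := IH (e :: s2) E'.
    have -> : uniq (s1 ++ e :: s2) by rewrite -cat1s uniq_catCA /= nes.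
    move=> /(_ isT); have h1 : forall e', e' \in s1 ++ e :: s2 -> D e'.
      by move=> e' h; apply: De; rewrite inE mem_cat; move: h; rewrite mem_cat inE orbCA.
    have h2 : forall e', e' \in e :: s2 -> F e' (E' e').
      move=> e'; rewrite inE /E'; case: eqP => [-> _|_ /= /FE//]; exact: XF.
    move=> /(_ h1 h2); rewrite big_cons {2}/E' eqxx.
    have -> : \prod_(e' <- s2) fine (P (E' e')) = \prod_(e' <- s2) fine (P (E e')).
      by apply: eq_big_seq => e' /eE ->.
    have -> : (fun t => (\prod_(e' <- s1) X e' t) *
          \prod_(e' <- e :: s2) \1_(E' e') t) =
        (fun t => (\prod_(e' <- s1) X e' t) *
          (\prod_(e' <- s2) \1_(E e') t) * \1_(X e @^-1` B) t).
      apply/funext => t; rewrite big_cons {1}/E' eqxx mulrCA mulrC.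
      by congr (_ * _ * _); apply: eq_big_seq => e' /eE ->.
    move=> ->; rewrite IH // Ex_indic; last exact/mF/XF.
    by rewrite -!mulrA; congr (_ * _); rewrite mulrC.
  rewrite IH //.
  by rewrite big_cons mulrC mulrA.
move=> u De FE; under boolp.eq_fun do rewrite big_nil mul1r.
rewrite big_nil mul1r.
have -> : (fun t => \prod_(e <- s2) \1_(E e) t : R) =
    \1_(\bigcap_(e in [set` s2]) E e).
  apply/funext => t; rewrite indicE.
  have [h|h] := pselect ((\bigcap_(e in [set` s2]) E e) t).
    rewrite (mem_set h) big_seq big1 // => e es; by rewrite indicE mem_set //; apply: h.
  rewrite (memNset h); have [e es ne] : exists2 e, e \in s2 & ~ E e t.
    apply: contrapT => h'; apply: h => e /= es; apply: contrapT => ne.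
    by apply: h'; exists e.
  by rewrite (big_rem e) //= indicE memNset // mul0r.
rewrite Ex_indic; last first.
  by apply: fin_bigcap_measurable => // e es; apply: (mF e); apply: FE.
rewrite ind //; last by move=> e es; split; [exact: De|exact: FE].
elim: s2 {u De} FE => [|e s IH] FE; first by rewrite !big_nil.
have FE' e' : e' \in s -> F e' (E e') by move=> h; apply: FE; rewrite inE h orbT.
rewrite !big_cons fineM ?IH //.
  by apply: fin_num_measure; apply/mF/FE; rewrite inE eqxx.
have : (\prod_(j <- s) P (E j) \is a fin_num)%E.
  elim: s FE' {IH FE} => [|e' s IH] FE; first by rewrite big_nil.
  rewrite big_cons fin_numM ?IH //.
    by apply: fin_num_measure; apply/mF/FE; rewrite inE eqxx.
  by move=> e'' h; apply: FE; rewrite inE h orbT.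
by [].
Qed.

End IndependentProduct.

(** * Closed walks *)

Section Walks.
Variables (m n : nat).
Implicit Types (i : {ffun 'I_m -> 'I_n}) (j k l r s : 'I_m).

(** Edges are unordered, so the smaller endpoint is put first: a_uv and a_vu lie
    on the same edge, which is the grouping used by the independence assumption. *)
Definition edge i k : 'I_n * 'I_n :=
  if (i k <= i (ordS k))%N then (i k, i (ordS k)) else (i (ordS k), i k).

Lemma edge_eqP i k l : edge i k = edge i l <->
  i k = i l /\ i (ordS k) = i (ordS l) \/ i k = i (ordS l) /\ i (ordS k) = i l.
Proof.
rewrite /edge; split.
  by do 2!case: ifP => ?; case=> -> ->; tauto.
case=> -[-> ->] //; case: ifP => h1; case: ifP => h2 //; last lia.
by have /val_inj -> : val (i (ordS l)) = val (i l) by rewrite /=; lia.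
Qed.

(** The last step of a closed walk returns to the starting point, hence is never
    a discovery; the cyclic successor therefore causes no wrap-around here. *)
Definition discovers i k :=
  [forall j : 'I_m, (j <= k)%N ==> (i j != i (ordS k))].

Definition nb_vertices i := #|[set i k | k in 'I_m]%SET|.

Lemma ordS_val k : (k.+1 < m)%N -> ordS k = k.+1 :> nat.
Proof. by move=> h; rewrite /= modn_small. Qed.

Lemma discoversP i k : discovers i k ->
  (k.+1 < m)%N /\ forall j, (j <= k)%N -> i j <> i (ordS k).
Proof.
move=> /forallP dk; have {}dk j : (j <= k)%N -> i j <> i (ordS k).
  by move=> jk; have /implyP/(_ jk)/eqP := dk j.
split=> //; rewrite ltnNge; apply/negP => mk.
have ek : (k.+1 = m)%N by have := ltn_ord k; lia.
by apply: (dk (ordS k)) => //=; rewrite ek modnn.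
Qed.

(** At the later of two steps along the same edge, both endpoints have already
    been visited. *)
Lemma discovers_edge_inj i k l :
  discovers i k -> discovers i l -> edge i k = edge i l -> k = l.
Proof.
wlog kl : k l / (k <= l)%N.
  by move=> h dk dl e; case/orP: (leq_total k l) => le;
    [apply: h|apply/esym/h].
move=> dk dl /edge_eqP e; apply/val_inj/eqP; rewrite /= eqn_leq kl leqNgt.
apply/negP => lt; have [k1 _] := discoversP dk; have [l1 nl] := discoversP dl.
have h : (ordS k <= l)%N by rewrite ordS_val.
by case: e => -[e1 e2]; [apply: (nl _ h)|apply: (nl _ kl)].
Qed.

(** Every vertex other than the starting point is discovered at its first
    visit. *)
Lemma nb_vertices_discovers i : (nb_vertices i <= #|discovers i|.+1)%N.
Proof.
case: (posnP m) => [m0|m0].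
  by apply: (leq_trans (leq_imset_card _ _)); rewrite [X in (X <= _)%N]card_ord {1}m0.
pose z : 'I_m := Ordinal m0.
have sub : [set i k | k in 'I_m]%SET \subset
    (i z |: [set i (ordS k) | k in discovers i])%SET.
  apply/fintype.subsetP => v /imsetP[k _ ->{v}].
  have [t /eqP et tmin] := @arg_minnP _ k (fun t => i t == i k)
    (fun t : 'I_m => val t) (eqxx _).
  rewrite -et !inE; have [t0|t0] := posnP t.
    by rewrite (_ : t = z) ?eqxx //; apply/val_inj.
  apply/orP; right; apply/imsetP.
  have tm := ltn_ord t; have t1m : (t.-1 < m)%N by lia.
  have eS : ordS (Ordinal t1m) = t.
    by apply/val_inj => /=; rewrite modn_small; lia.
  exists (Ordinal t1m); rewrite ?eS //.
  apply/forallP => j; apply/implyP => /= jt; rewrite eS; apply/eqP => ej.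
  have tj : (t <= j)%N by apply: tmin; rewrite ej et.
  by move: (leq_trans tj jt); rewrite leqNgt prednK // leqnn.
apply: leq_trans (subset_leq_card sub) _.
by rewrite cardsU1 -add1n leq_add ?leq_imset_card // leq_b1.
Qed.

Definition doubled i := [forall k, exists j, (j != k) && (edge i j == edge i k)].

Definition partner i k := odflt k [pick j | (j != k) && (edge i j == edge i k)].

Lemma partnerP i k : doubled i ->
  partner i k <> k /\ edge i (partner i k) = edge i k.
Proof.
move=> /forallP/(_ k)/existsP[j hj]; rewrite /partner.
by case: pickP => [l /andP[/eqP ? /eqP ?]//|/(_ j)]; rewrite hj.
Qed.

Lemma partner_inj i : doubled i -> {in discovers i &, injective (partner i)}.
Proof.
move=> di k l dk dl e; apply: (discovers_edge_inj dk dl).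
by rewrite -(partnerP k di).2 e (partnerP l di).2.
Qed.

Lemma partner_disc i : doubled i ->
  ([set partner i k | k in discovers i] \subset ~: [set k | discovers i k])%SET.
Proof.
move=> di; apply/fintype.subsetP => _ /imsetP[k dk ->]; rewrite !inE.
apply/negP => dp; have [ne ee] := partnerP k di.
exact/ne/(discovers_edge_inj dp dk).
Qed.

Lemma card_discoversC i :
  (#|discovers i| + #|~: [set k | discovers i k]%SET| = m)%N.
Proof. by have := cardsC [set k | discovers i k]%SET; rewrite cardsE card_ord. Qed.

(** The partner of a discovery is a step along the same edge that is not a
    discovery, so partners embed the discoveries into the remaining steps. *)
Lemma card_discovers i : doubled i -> ((#|discovers i|).*2 <= m)%N.
Proof.
move=> di; have := subset_leq_card (partner_disc di).
rewrite card_in_imset; last exact: partner_inj.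
have e := card_discoversC i.
by move=> h; rewrite -addnn -[X in (_ <= X)%N]e leq_add2l.
Qed.

Lemma nb_vertices_doubled i : doubled i -> ((nb_vertices i).*2 <= m.+2)%N.
Proof.
by move=> /card_discovers; have := nb_vertices_discovers i; lia.
Qed.

(** The edges of discovery form a spanning tree, and cutting it at the edge of the
    step [r] leaves two components: [f] distinguishes them.  It is constructed one
    vertex at a time, in the order of discovery. *)
Lemma edge_coloring i r : discovers i r ->
  exists f : 'I_n -> bool, forall k, discovers i k ->
    f (i (ordS k)) = f (i k) (+) (k == r).
Proof.
move=> dr; suff H T : exists f : 'I_n -> bool, forall k, (k < T)%N ->
    discovers i k -> f (i (ordS k)) = f (i k) (+) (k == r).
  by have [f hf] := H m; exists f => k; apply: hf.
elim: T => [|T [f hf]]; first by exists (fun=> false).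
have [mT|Tm] := leqP m T.
  by exists f => k kT; apply: hf; have := ltn_ord k; lia.
pose t := Ordinal Tm; have [dt|ndt] := boolP (discovers i t); last first.
  exists f => k; rewrite ltnS leq_eqVlt => /predU1P[ek dk|]; last exact: hf.
  by move: ndt; rewrite (_ : t = k) ?dk //; apply/val_inj.
have [_ nt] := discoversP dt.
exists (fun x => if x == i (ordS t) then f (i t) (+) (t == r) else f x) => k.
rewrite ltnS leq_eqVlt => /predU1P[ek dk|kT dk].
  have -> : k = t by exact/val_inj.
  by rewrite eqxx; have /eqP/negPf-> := nt t (leqnn _).
have /eqP/negPf-> := nt k (ltnW kT).
have h : (ordS k <= t)%N by rewrite ordS_val //=; have := ltn_ord t; rewrite /=; lia.
by have /eqP/negPf-> := nt _ h; apply: hf.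
Qed.

Section Tree.
Variable i : {ffun 'I_m -> 'I_n}.
Hypotheses (di : doubled i) (tree : (nb_vertices i).*2 = m.+2).

Lemma tree_card_discovers : (#|discovers i|).*2 = m.
Proof.
by have := card_discovers di; have := nb_vertices_discovers i; lia.
Qed.

(** In the extremal case, discoveries are half of the steps and the embedding
    behind [card_discovers] is a bijection. *)
Lemma tree_discovered j : ~~ discovers i j ->
  exists2 k, discovers i k & j = partner i k.
Proof.
move=> ndj; suff : j \in [set partner i k | k in discovers i]%SET.
  by case/imsetP => k dk ->; exists k.
have /eqP -> : ([set partner i k | k in discovers i] ==
    ~: [set k | discovers i k])%SET; last by rewrite !inE.
rewrite eqEcard partner_disc //= card_in_imset; last exact: partner_inj.
have := card_discoversC i.
by rewrite -[X in _ = X]tree_card_discovers -addnn => /addnI ->.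
Qed.

Lemma tree_discovered_edge j : exists2 k, discovers i k & edge i j = edge i k.
Proof.
have [dj|/tree_discovered[k dk ->]] := boolP (discovers i j); first by exists j.
by exists k => //; rewrite (partnerP k di).2.
Qed.

Lemma tree_edge_twice j k l : edge i j = edge i k -> edge i l = edge i k ->
  j <> k -> l <> k -> j = l.
Proof.
move=> ej el jk lk.
have [dk|/tree_discovered[d dd ek]] := boolP (discovers i k).
  have H j' : edge i j' = edge i k -> j' <> k -> j' = partner i k.
    move=> e ne; have [dj|/tree_discovered[d dd ejd]] := boolP (discovers i j').
      by case: ne; apply: (discovers_edge_inj dj dk).
    rewrite ejd; congr partner; apply: (discovers_edge_inj dd dk).
    by rewrite -e ejd (partnerP d di).2.
  by rewrite (H _ ej jk) (H _ el lk).
have ekd : edge i k = edge i d by rewrite ek (partnerP d di).2.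
have H j' : edge i j' = edge i k -> j' <> k -> j' = d.
  move=> e ne; have [dj|/tree_discovered[d' dd' ej']] := boolP (discovers i j').
    by apply: (discovers_edge_inj dj dd); rewrite -ekd.
  case: ne; rewrite ej' ek; congr partner; apply: (discovers_edge_inj dd' dd).
  by rewrite -ekd -e ej' (partnerP d' di).2.
by rewrite (H _ ej jk) (H _ el lk).
Qed.

(** Since its edge is used only at [r] and [s], the colour of the current vertex
    is switched exactly by these two steps. *)
Lemma tree_coloring r s : r <> s -> edge i r = edge i s ->
  exists2 f : 'I_n -> bool, f (i r) <> f (i (ordS r)) &
    exists c, forall t, f (i t) = c (+) (r < t)%N (+) (s < t)%N.
Proof.
move=> rs ers; have [d dd erd] := tree_discovered_edge r.
have [f hf] := edge_coloring dd.
have flip k : f (i (ordS k)) = f (i k) (+) ((k == r) || (k == s)).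
  have -> : (k == r) || (k == s) = (edge i k == edge i r).
    apply/orP/eqP => [[]/eqP->//|ek]; have [->|/eqP kr] := eqVneq k r; first by left.
    by right; apply/eqP; apply: (tree_edge_twice ek _ kr) => //; exact/nesym.
  have [d' dd' ekd] := tree_discovered_edge k.
  have -> : (edge i k == edge i r) = (d' == d).
    rewrite ekd erd; by apply/eqP/eqP => [|->//]; apply: (discovers_edge_inj dd' dd).
  have := hf _ dd'; move/edge_eqP: ekd => [] [-> ->] // ->.
  by rewrite addbK.
exists f.
  by rewrite flip eqxx; case: (f _).
have step t : (r <= t)%N (+) (s <= t)%N =
    (r < t)%N (+) (s < t)%N (+) ((t == r :> nat) || (t == s :> nat)).
  have : r <> s :> nat by move=> /val_inj.
  by case: (ltngtP r t); case: (ltngtP s t) => // -> ->.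
have m0 : (0 < m)%N by have := ltn_ord r; lia.
exists (f (i (Ordinal m0))) => -[t tm].
elim: t tm => [|t IH] tm.
  by rewrite /= !ltn0 !addbF; congr (f (i _)); apply/val_inj.
have tm' : (t < m)%N by lia.
have -> : Ordinal tm = ordS (Ordinal tm').
  by apply/val_inj => /=; rewrite modn_small.
rewrite flip IH /= !modn_small // !ltnS -!val_eqE /=.
by rewrite -!addbA; congr addb; rewrite step addbA.
Qed.

(** Between its two passages through an edge the walk stays on one side of it, so
    the second passage is a return. *)
Lemma tree_backtrack r s : (r < s)%N -> edge i r = edge i s ->
  [/\ i r = i (ordS s), i s = i (ordS r) & i r <> i (ordS r)].
Proof.
move=> rs e; have ne : r <> s by move=> ers; rewrite ers ltnn in rs.
have [f fr [c fE]] := tree_coloring ne e.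
have Sr : ordS r = r.+1 :> nat by rewrite ordS_val //; have := ltn_ord s; lia.
have fS : f (i s) = f (i (ordS r)).
  by rewrite !fE Sr rs ltnn ltnSn ltnS leqNgt rs.
have isr : i s <> i r by move=> h; rewrite -fS h in fr.
split; last by move=> h; rewrite -h in fr.
  by case/edge_eqP: e => -[] // h; case: isr.
by case/edge_eqP: e => -[] // h; case: isr.
Qed.

(** If the edges differed, the edge of [q] would be on one side of the edge of
    [p] at time [q] and on the other side at time [s]. *)
Lemma tree_noncrossing (p q r s : 'I_m) : (p < q)%N -> (q < r)%N -> (r < s)%N ->
  edge i p = edge i r -> edge i q = edge i s -> edge i p = edge i q.
Proof.
move=> pq qr rs epr eqs; have pr : (p < r)%N := ltn_trans pq qr.
have ne : p <> r by move=> h; rewrite h ltnn in pr.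
have [f fp [c fE]] := tree_coloring ne epr.
have [_ iE _] := tree_backtrack (ltn_trans qr rs) eqs.
have Sq : ordS q = q.+1 :> nat by rewrite ordS_val //; have := ltn_ord r; lia.
have := fE s; rewrite iE fE Sq.
have -> : (p < q.+1)%N by lia.
have -> : (r < q.+1)%N = false by lia.
have -> : (p < s)%N by lia.
by rewrite rs; case: c {fE}.
Qed.

End Tree.
End Walks.

(** * Non-crossing pair partitions *)
Section PairPartitions.
Variable m : nat.
Implicit Types (sigma tau : {set {set 'I_m}}) (j k l r s : 'I_m).

Lemma NC2_neq sigma r s : NC2 sigma -> [set r; s]%SET \in sigma -> r <> s.
Proof. by case=> _ c2 _ /c2 c rs; move: c; rewrite rs finset.setUid cards1. Qed.

Lemma NC2_block sigma (B : {set 'I_m}) k : NC2 sigma -> B \in sigma -> k \in B ->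
  exists2 l, l <> k & B = [set k; l]%SET.
Proof.
case=> _ c2 _ BS kB; have /eqP/cards2P[x [y [xy BE]]] := c2 _ BS.
move: kB; rewrite BE !inE => /orP[]/eqP->.
  by exists y => //; apply/eqP; rewrite eq_sym.
by exists x; [exact/eqP|rewrite finset.setUC].
Qed.

Lemma NC2_partner sigma k : NC2 sigma ->
  exists2 l, l <> k & [set k; l]%SET \in sigma.
Proof.
move=> nc; have [/and3P[/eqP cov _ _] _ _] := nc.
have : k \in finset.cover sigma by rewrite cov inE.
case/bigcupP => B BS kB; have [l lk BE] := NC2_block nc BS kB.
by exists l; rewrite -?BE.
Qed.

Lemma NC2_unique sigma k j l : NC2 sigma ->
  [set k; j]%SET \in sigma -> [set k; l]%SET \in sigma -> j = l.
Proof.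
move=> nc kj kl; have [/and3P[_ /finset.trivIsetP tr _] _ _] := nc.
have [e|/(tr _ _ kj kl)] := eqVneq [set k; j]%SET [set k; l]%SET.
  have : j \in [set k; l]%SET by rewrite -e !inE eqxx orbT.
  rewrite !inE => /orP[]/eqP // jk.
  by case: (NC2_neq nc kj).
by move/disjoint_setI0/setP/(_ k); rewrite !inE eqxx.
Qed.

Lemma NC2_sub_eq sigma tau : NC2 sigma -> NC2 tau ->
  (forall r s, [set r; s]%SET \in sigma -> [set r; s]%SET \in tau) ->
  sigma = tau.
Proof.
move=> ns nt sub; apply/setP => B.
have ne rho' (C : {set 'I_m}) : NC2 rho' -> C \in rho' -> exists k, k \in C.
  move=> [/and3P[_ _ h] _ _] CS; apply/set0Pn.
  by apply: contraNneq h => <-.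
apply/idP/idP => BS.
  have [k kB] := ne _ _ ns BS; have [l _ BE] := NC2_block ns BS kB.
  by rewrite BE; apply: sub; rewrite -BE.
have [k kB] := ne _ _ nt BS; have [l lk BE] := NC2_block nt BS kB.
have [l' _ kl'] := NC2_partner k ns; rewrite BE in BS *.
by rewrite (NC2_unique nt BS (sub _ _ kl')).
Qed.

Lemma NC2_noncrossing sigma (p q r s : 'I_m) : NC2 sigma ->
  [set p; r]%SET \in sigma -> [set q; s]%SET \in sigma ->
  (p < q)%N -> (q < r)%N -> (r < s)%N -> False.
Proof.
move=> nc pr qs pq qr rs; have [_ _ nx] := nc.
have e : [set p; r]%SET = [set q; s]%SET.
  by apply: (nx _ _ pr qs p q r s) => //; rewrite !inE eqxx ?orbT.
have : q \in [set p; r]%SET by rewrite e !inE eqxx.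
by rewrite !inE => /orP[]/eqP h; rewrite h ltnn in pq qr.
Qed.

Definition involution_blocks (p : 'I_m -> 'I_m) : {set {set 'I_m}} :=
  [set [set k; p k] | k in 'I_m]%SET.

Lemma involution_blocksE (p : 'I_m -> 'I_m) r s : involutive p ->
  (forall k, p k <> k) ->
  ([set r; s]%SET \in involution_blocks p) = (s == p r).
Proof.
move=> pK pne; apply/imsetP/eqP => [[k _ e]|->]; last by exists r.
have : r \in [set k; p k]%SET by rewrite -e !inE eqxx.
have hs : s \in [set k; p k]%SET by rewrite -e !inE eqxx orbT.
have hk : k \in [set r; s]%SET by rewrite e !inE eqxx.
have hpk : p k \in [set r; s]%SET by rewrite e !inE eqxx orbT.
rewrite !inE => /orP[]/eqP rE; subst r; rewrite !inE in hpk hk.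
  by case/orP: hpk => /eqP // h; case: (pne _ h).
case/orP: hk => /eqP; last by rewrite pK.
by move=> /esym h; case: (pne _ h).
Qed.

Lemma NC2_involution (p : 'I_m -> 'I_m) : involutive p ->
  (forall k, p k <> k) ->
  (forall q r : 'I_m, (q < r)%N -> (r < p q)%N -> (p q < p r)%N -> False) ->
  NC2 (involution_blocks p).
Proof.
move=> pK pne nx; have H x y : x \in [set y; p y]%SET -> [set y; p y]%SET = [set x; p x]%SET.
  by rewrite !inE => /orP[]/eqP-> //; rewrite pK finset.setUC.
split.
- apply/and3P; split.
  + rewrite finset.eqEsubset finset.subsetT /=; apply/fintype.subsetP => k _.
    apply/bigcupP; exists [set k; p k]%SET; last by rewrite !inE eqxx.
    exact: imset_f.
  + apply/finset.trivIsetP => _ _ /imsetP[k _ ->] /imsetP[l _ ->].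
    by apply: contraR => /pred0Pn[x /= /andP[/H-> /H->]].
  + by apply/imsetP => -[k _ /setP/(_ k)]; rewrite !inE eqxx.
- by move=> _ /imsetP[k _ ->]; rewrite cards2; have /eqP := pne k; rewrite eq_sym => ->.
- move=> _ _ /imsetP[k _ ->] /imsetP[l _ ->] a b c e; rewrite !inE.
  move=> ka lb kc le ab bc ce.
  have H2 x y z : x \in [set y; p y]%SET -> z \in [set y; p y]%SET ->
      (x < z)%N -> z = p x.
    move=> /H ->; rewrite !inE => /orP[]/eqP -> //; rewrite ltnn //.
  have pa : c = p a by apply: (H2 _ k) (ltn_trans ab bc); rewrite !inE.
  have pb : e = p b by apply: (H2 _ l) (ltn_trans bc ce); rewrite !inE.
  by subst c e; case: (nx a b).
Qed.

End PairPartitions.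

(** * Walks compatible with a pairing *)
Section Compatible.
Variables (m n : nat).
Implicit Types (sigma tau : {set {set 'I_m}}) (i : {ffun 'I_m -> 'I_n}).
Implicit Types (j k l r s : 'I_m).

Definition compatible sigma i :=
  [forall r : 'I_m, forall s : 'I_m, ((r < s)%N && ([set r; s]%SET \in sigma)) ==>
    ((i r == i (ordS s)) && (i s == i (ordS r)))].

Lemma compatibleP sigma i : reflect
  (forall r s, (r < s)%N -> [set r; s]%SET \in sigma ->
    i r = i (ordS s) /\ i s = i (ordS r)) (compatible sigma i).
Proof.
apply: (iffP idP) => [/forallP H r s rs h|H].
  by have /forallP/(_ s) := H r; rewrite rs h => /andP[/eqP-> /eqP->].
apply/forallP => r; apply/forallP => s; apply/implyP => /andP[rs h].
by have [-> ->] := H r s rs h; rewrite !eqxx.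
Qed.

Lemma compatible_edge sigma i r s : compatible sigma i ->
  [set r; s]%SET \in sigma -> edge i r = edge i s.
Proof.
move=> /compatibleP H h; case: (ltngtP r s) => [rs|sr|/val_inj->//].
  by have [? ?] := H r s rs h; apply/edge_eqP; right.
rewrite finset.setUC in h.
by have [? ?] := H s r sr h; apply/esym/edge_eqP; right.
Qed.

Lemma compatible_doubled sigma i : NC2 sigma -> compatible sigma i -> doubled i.
Proof.
move=> nc ci; apply/forallP => k; have [l lk h] := NC2_partner k nc.
apply/existsP; exists l; rewrite (compatible_edge ci h) eqxx andbT.
exact/eqP.
Qed.

Definition edge_pairing i := involution_blocks (partner i).

Section TreePairing.
Variable i : {ffun 'I_m -> 'I_n}.
Hypotheses (di : doubled i) (tree : (nb_vertices i).*2 = m.+2).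

Lemma tree_partnerK : involutive (partner i).
Proof.
move=> k; have [n1 e1] := partnerP k di; have [n2 e2] := partnerP (partner i k) di.
by apply: (tree_edge_twice di tree e2 _ n2) => //; exact/nesym.
Qed.

Lemma tree_partner_unique k l : k <> l -> edge i k = edge i l -> l = partner i k.
Proof.
move=> kl e; have [n1 e1] := partnerP k di.
by apply: (@tree_edge_twice _ _ _ di tree _ k) => //; exact/nesym.
Qed.

Lemma edge_pairingE r s : r <> s ->
  ([set r; s]%SET \in edge_pairing i) = (edge i r == edge i s).
Proof.
move=> rs; rewrite involution_blocksE; last 2 first.
- exact: tree_partnerK.
- by move=> k; case: (partnerP k di).
apply/eqP/eqP => [->|]; first by rewrite (partnerP r di).2.
exact: tree_partner_unique.
Qed.

Lemma edge_pairing_NC2 : NC2 (edge_pairing i).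
Proof.
apply: NC2_involution => [|k|q r qr rq qr'].
- exact: tree_partnerK.
- by case: (partnerP k di).
have [nq eq] := partnerP q di; have [nr er] := partnerP r di.
have e := tree_noncrossing di tree qr rq qr' (esym eq) (esym er).
have ne : q <> r by move=> h; rewrite h ltnn in qr.
by rewrite (tree_partner_unique ne e) ltnn in rq.
Qed.

Lemma edge_pairing_compatible : compatible (edge_pairing i) i.
Proof.
apply/compatibleP => r s rs; rewrite edge_pairingE; last first.
  by move=> h; rewrite h ltnn in rs.
by move=> /eqP/(tree_backtrack di tree rs)[-> ->].
Qed.

(** Compatible pairs of steps run along the same edge, and a tree walk uses each
    edge exactly twice: the blocks are forced. *)
Lemma compatible_tree sigma : NC2 sigma -> compatible sigma i ->
  sigma = edge_pairing i.
Proof.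
move=> nc ci; apply: (NC2_sub_eq nc edge_pairing_NC2) => r s h.
by rewrite edge_pairingE; [rewrite (compatible_edge ci h)|exact: NC2_neq nc h].
Qed.

End TreePairing.
End Compatible.

(** * Expectations along a walk *)

Section Counting.
Variables (m n : nat).
Implicit Types (i : {ffun 'I_m -> 'I_n}).

(** Such a walk factors through a set of [v] labels. *)
Lemma card_few_vertices v : (0 < m)%N ->
  (#|[set i : {ffun 'I_m -> 'I_n} | nb_vertices i <= v]%SET| <= v ^ m * n ^ v)%N.
Proof.
move=> m0; pose f (gh : {ffun 'I_v -> 'I_n} * {ffun 'I_m -> 'I_v}) :=
  [ffun k => gh.1 (gh.2 k)] : {ffun 'I_m -> 'I_n}.
have -> : (v ^ m * n ^ v = #|[set: {ffun 'I_v -> 'I_n} * {ffun 'I_m -> 'I_v}]%SET|)%N.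
  by rewrite cardsT card_prod !card_ffun !card_ord mulnC.
apply: leq_trans (leq_imset_card f _); apply: subset_leq_card.
apply/fintype.subsetP => i; rewrite inE => iv; apply/imsetP.
pose V := enum [set i k | k in 'I_m]%SET.
have sV : (size V <= v)%N by rewrite -cardE.
have iV k : i k \in V by rewrite mem_enum; apply: imset_f.
have lt k : (index (i k) V < v)%N by rewrite (leq_trans _ sV) // index_mem.
exists ([ffun j : 'I_v => nth (i (Ordinal m0)) V j], [ffun k => Ordinal (lt k)]).
  by rewrite inE.
by apply/ffunP => k; rewrite !ffunE /= nth_index.
Qed.

End Counting.

Section Weights.
Variables (R : realType) (rho : nat -> R) (m n : nat) (eps : 'I_m -> bool).
Implicit Types (sigma : {set {set 'I_m}}) (i : {ffun 'I_m -> 'I_n}).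

Definition pair_cov i (r s : 'I_m) : R :=
  rho `|(i r)%:Z - (i s)%:Z|%N ^+ (eps r == eps s).

Definition pairing_weight sigma i : R :=
  \prod_(r < m) \prod_(s < m | (r < s)%N && ([set r; s]%SET \in sigma))
    (pair_cov i r s * (i r == i (ordS s))%:R * (i s == i (ordS r))%:R).

Lemma pairing_weight_compatible sigma i : compatible sigma i ->
  pairing_weight sigma i =
  \prod_(r < m) \prod_(s < m | (r < s)%N && ([set r; s]%SET \in sigma)) pair_cov i r s.
Proof.
move=> /compatibleP ci; apply: eq_bigr => r _; apply: eq_bigr => s /andP[rs h].
by have [-> ->] := ci r s rs h; rewrite !eqxx !mulr1.
Qed.

Lemma pairing_weight_incompatible sigma i : ~~ compatible sigma i ->
  pairing_weight sigma i = 0.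
Proof.
move=> /forallPn[/= r /forallPn[/= s]]; rewrite negb_imply => /andP[rs nc].
rewrite /pairing_weight (bigD1 r) //= (bigD1 s) //= -!mulrA.
by move: nc; case: eqP => _ /=; case: eqP => _ //= _; rewrite ?(mul0r, mulr0).
Qed.

Lemma norm_pairing_weight sigma i : (forall j, `|rho j| <= 1) ->
  `|pairing_weight sigma i| <= 1.
Proof.
move=> hr; rewrite normr_prod prodr_ile1 // => r _.
rewrite normr_ge0 normr_prod prodr_ile1 // => s _; rewrite normr_ge0 /= !normrM.
rewrite mulr_ile1 ?mulr_ge0 //; last by case: eqP; rewrite ?normr1 ?normr0.
rewrite mulr_ile1 //; last by case: eqP; rewrite ?normr1 ?normr0.
by rewrite normrX exprn_ile1.
Qed.

End Weights.

(** The product is at most the [m]-th power of its largest factor; this replaces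
    Hoelder's inequality in bounding mixed moments of the entries. *)
Lemma prod_le_sum_exp (R : realType) (m : nat) (x : 'I_m -> R) : (0 < m)%N ->
  (forall k, 0 <= x k) -> \prod_k x k <= \sum_k x k ^+ m.
Proof.
move=> m0 x0; have [k _ kmax] := @arg_maxP _ _ _ (Ordinal m0) predT x isT.
rewrite [leRHS](bigD1 k) //= -[leLHS]addr0 lerD ?sumr_ge0 // => [|j _]; last exact: exprn_ge0.
apply: le_trans (_ : \prod_(j < m) x k <= _).
  by apply: ler_prod => j _; rewrite x0; apply: kmax.
by rewrite prodr_const card_ord.
Qed.

Section RandomEntries.
Context (R : realType) (d : measure_display) (T : measurableType d).
Variables (P : probability T R) (rho : nat -> R) (a : nat -> nat -> {RV P >-> R}).
Hypothesis rho0 : rho 0%N = 1.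
Hypothesis indep : mutually_independent P
  [set ij : nat * nat | (ij.1 <= ij.2)%N] (entry_sigma a).
Hypothesis mean0 : forall i j, ('E_P[a i j] = 0)%E.
Hypothesis var1 : forall i j, ('E_P[(fun t => a i j t ^+ 2)%R] = 1)%E.
Hypothesis moments : forall q : nat, exists M : R, forall i j,
  ('E_P[(fun t => `|a i j t| ^+ q)%R] <= M%:E)%E.
Hypothesis covar : forall i j, i != j ->
  ('E_P[(fun t => a i j t * a j i t)%R] = (rho `|i%:Z - j%:Z|%N)%:E)%E.

Lemma entry_has_moments i j : has_moments P (a i j).
Proof.
split=> [|q]; first exact: measurable_funPT.
have mq : measurable_fun setT (EFin \o (fun t => `|a i j t| ^+ q)).
  by apply/measurable_EFinP/measurable_funX/measurableT_comp => //; exact: measurable_funPT.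
apply/integrableP; split=> //.
have [M hM] := moments q; apply: le_lt_trans (ltry M).
apply: le_trans (hM i j); rewrite unlock le_eqVlt; apply/orP; left; apply/eqP.
by apply: eq_integral => t _ /=; rewrite ger0_norm ?exprn_ge0.
Qed.

Lemma Ex_expectation (X : T -> R) : Ex P X = fine 'E_P[X].
Proof. by rewrite unlock. Qed.

Lemma Ex_entry i j : Ex P (a i j) = 0.
Proof. by rewrite Ex_expectation mean0. Qed.

Lemma Ex_entry_sqr i j : Ex P (fun t => a i j t * a i j t) = 1.
Proof. by rewrite Ex_expectation var1. Qed.

Lemma Ex_entry_transpose i j : i != j ->
  Ex P (fun t => a i j t * a j i t) = rho `|i%:Z - j%:Z|%N.
Proof. by move=> ij; rewrite Ex_expectation covar. Qed.

Lemma entry_moment_bound q : exists M : R, forall i j,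
  Ex P (fun t => `|a i j t| ^+ q) <= M.
Proof.
have [M hM] := moments q; exists M => i j; rewrite -lee_fin Ex_expectation.
apply: le_trans (hM i j); rewrite fineK // unlock.
exact: integrable_fin_num ((entry_has_moments i j).2 q).
Qed.

(** This is the Cauchy-Schwarz inequality for a_0k and a_k0, deduced from the
    positivity of the variances of their sum and difference. *)
Lemma norm_rho_le1 k : `|rho k| <= 1.
Proof.
have [->|k0] := posnP k; first by rewrite rho0 normr1.
have ne : 0%N != k by rewrite eq_sym -lt0n.
have <- : Ex P (fun t => a 0 k t * a k 0 t) = rho k.
  by rewrite Ex_entry_transpose // sub0r abszN.
have h i j := entry_has_moments i j.
have hX := has_momentsM (h 0%N k) (h k 0%N).
have hS := has_momentsD (has_momentsM (h 0%N k) (h 0%N k)) (has_momentsM (h k 0%N) (h k 0%N)).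
have e2 : Ex P (fun t => a 0 k t * a 0 k t + a k 0 t * a k 0 t) = 2.
  by rewrite ExD ?Ex_entry_sqr //; exact: has_momentsM.
have lr c : c * c = 1 -> c * (2 * Ex P (fun t => a 0%N k t * a k 0%N t)) <= 2.
  move=> c1; rewrite -ExZ // -ExZ //; last exact: has_momentsZ.
  rewrite -e2; apply: le_Ex => // [|t]; first by do 2!apply: has_momentsZ.
  have := sqr_ge0 (a 0%N k t - c * a k 0%N t); nra.
rewrite ler_norml; have := lr 1; have := lr (-1).
rewrite mulrNN !mulr1 => /(_ erefl) h1 /(_ erefl) h2; apply/andP; split; lra.
Qed.

Section Letters.
Variables (m n : nat) (eps : 'I_m -> bool).
Implicit Types (i : {ffun 'I_m -> 'I_n}) (k r s : 'I_m).

Definition letter i k (t : T) : R :=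
  if eps k then a (i (ordS k)) (i k) t else a (i k) (i (ordS k)) t.

Lemma letter_has_moments i k : has_moments P (letter i k).
Proof. by rewrite /letter; case: (eps k); exact: entry_has_moments. Qed.

Definition path_moment i : R := Ex P (fun t => \prod_k letter i k t).

Lemma path_moment_le (M : R) i : (0 < m)%N ->
  (forall u v : nat, Ex P (fun t => `|a u v t| ^+ m) <= M) ->
  `|path_moment i| <= m%:R * M.
Proof.
move=> m0 hM.
have hp : has_moments P (fun t => \prod_k letter i k t).
  exact: has_moments_prod (letter_has_moments i).
have hn k : has_moments P (fun t => `|letter i k t| ^+ m).
  split=> [|q]; first exact/measurable_funX/measurableT_comp/(letter_has_moments i k).1.
  rewrite (_ : _ \o _ = EFin \o (fun t => `|letter i k t| ^+ (m * q))).
    exact: (letter_has_moments i k).2.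
  by apply/funext => t /=; rewrite exprM [in LHS]ger0_norm ?exprn_ge0.
apply: le_trans (le_norm_Ex hp) _.
apply: le_trans (_ : Ex P (fun t => \sum_k `|letter i k t| ^+ m) <= _).
  apply: le_Ex => [||t].
  - apply: (has_moments_le _ hp) => [|t]; last by rewrite normr_id.
    exact/measurableT_comp/hp.1.
  - exact: has_moments_sum hn.
  - by rewrite normr_prod prod_le_sum_exp.
rewrite Ex_sum //.
have -> : m%:R * M = \sum_(k < m) M by rewrite sumr_const card_ord mulr_natl.
by apply: ler_sum => k _; rewrite /letter; case: (eps k); exact: hM.
Qed.

(** The factor of a path moment that lives on one edge; it is a function of the
    random vector attached to this edge, hence measurable for its sigma-algebra. *)
Definition edge_product i (e : nat * nat) (t : T) : R :=
  \prod_(k < m | (val (edge i k).1, val (edge i k).2) == e) letter i k t.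

Lemma edge_le i k : ((edge i k).1 <= (edge i k).2)%N.
Proof. by rewrite /edge; case: ifP => //= /negbT; rewrite -ltnNge => /ltnW. Qed.

Lemma edge_product_has_moments i e : has_moments P (edge_product i e).
Proof. exact: has_moments_prod (letter_has_moments i). Qed.

Lemma edge_product_sigma i e (B : set R) : (e.1 <= e.2)%N -> measurable B ->
  entry_sigma a e (edge_product i e @^-1` B).
Proof.
case: e => p q /= pq mB; rewrite /entry_sigma /=.
have lE k : (val (edge i k).1, val (edge i k).2) == (p, q) ->
  letter i k = a p q \/ letter i k = a q p.
  rewrite /edge /letter; case: ifP => _ /eqP[<- <-];
  case: (eps k); first [by left|by right].
have [e|pq'] := eqVneq p q.
  subst q; pose g (x : R) := \prod_(k < m | (val (edge i k).1, val (edge i k).2) == (p, p)) x.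
  exists (g @^-1` B).
    rewrite -[_ @^-1` _]setTI; have mg : measurable_fun setT g.
      rewrite /g; under boolp.eq_fun do rewrite big_mkcond.
      by apply: measurable_prod => k _; case: (_ == _).
    exact: mg.
  rewrite setTI; apply/funext => t /=; congr (B _).
  by apply: eq_bigr => k /lE[]->.
pose g (x : R * R) := \prod_(k < m | (val (edge i k).1, val (edge i k).2) == (p, q))
  (if `[< letter i k = a p q >] then x.1 else x.2).
exists (g @^-1` B).
  rewrite -[_ @^-1` _]setTI; have mg : measurable_fun setT g.
    rewrite /g; under boolp.eq_fun do rewrite big_mkcond.
    apply: measurable_prod => k _; case: (_ == _) => //.
    by case: `[< _ >]; [exact: measurable_fst|exact: measurable_snd].
  exact: mg.
rewrite setTI; apply/funext => t /=; congr (B _).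
by apply: eq_bigr => k /lE; case: asboolP => [->//|ne [/ne//|->//]].
Qed.

Lemma entry_sigma_measurable e A : entry_sigma a e A -> measurable A.
Proof.
rewrite /entry_sigma; case: ifP => _ [B mB <-].
  exact: measurable_funPT.
by apply: measurable_fun_pair => //; exact: measurable_funPT.
Qed.

Lemma path_moment_factor i : path_moment i =
  \prod_(e : 'I_n * 'I_n | (e.1 <= e.2)%N)
    Ex P (fun t => \prod_(k < m | edge i k == e) letter i k t).
Proof.
pose s := [seq (val e.1, val e.2) | e : 'I_n * 'I_n <-
  enum [pred e : 'I_n * 'I_n | (e.1 <= e.2)%N]].
have us : uniq (s ++ [::]).
  rewrite cats0 map_inj_uniq ?enum_uniq // => -[x y] [x' y'] /= [e1 e2].
  by congr (_, _); apply/val_inj.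
have sD e : e \in s ++ [::] -> (e.1 <= e.2)%N.
  by rewrite cats0 => /mapP[f]; rewrite mem_enum inE => h ->.
have := Ex_prod_independent (X := edge_product i) (E := fun=> setT) indep
  (edge_product_has_moments i) (fun e B => @edge_product_sigma i e B)
  entry_sigma_measurable us sD (fun e => _).
have sE (F : nat * nat -> R) : \prod_(e <- s) F e =
    \prod_(e : 'I_n * 'I_n | (e.1 <= e.2)%N) F (val e.1, val e.2).
  by rewrite big_map big_enum; apply: eq_bigl => e; rewrite inE.
have eE (e : 'I_n * 'I_n) t : edge_product i (val e.1, val e.2) t =
    \prod_(k < m | edge i k == e) letter i k t.
  apply: eq_bigl => k; apply/eqP/eqP => [|->//].
  by case: e (edge i k) => [x y] [x' y'] [] /val_inj-> /val_inj->.
rewrite big_nil mulr1 sE => H.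
rewrite /path_moment.
have -> : (fun t => \prod_k letter i k t) =
    (fun t => \prod_(e <- s) edge_product i e t *
       \prod_(e <- [::] : seq (nat * nat)) \1_[set: T] t).
  apply/funext => t; rewrite big_nil mulr1 sE.
  rewrite (partition_big (edge i) (fun e => (e.1 <= e.2)%N)) /=; last first.
    by move=> k _; exact: edge_le.
  by apply: eq_bigr => e _; rewrite eE.
rewrite H //; apply: eq_bigr => e _; congr (Ex P _); exact/funext.
Qed.

(** A letter alone on its edge is centred and independent of all others. *)
Lemma path_moment_undoubled i : ~~ doubled i -> path_moment i = 0.
Proof.
move=> /forallPn[/= k /existsPn/= nk]; rewrite path_moment_factor.
rewrite (bigD1 (edge i k)) ?edge_le //= (_ : (fun t => _) = letter i k).
  by rewrite /letter; case: (eps k); rewrite Ex_entry mul0r.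
apply/funext => t; rewrite (big_pred1 k) // => j /=.
by have := nk j; have [->|] := eqVneq j k; rewrite ?eqxx //= => _ /negPf.
Qed.

Section TreeMoment.
Variable i : {ffun 'I_m -> 'I_n}.
Hypotheses (di : doubled i) (tree : (nb_vertices i).*2 = m.+2).

(** The two passages through an edge uv are opposite, so equal exponents pick the
    entries a_uv and a_vu, of covariance rho_|u-v|, whereas different exponents
    pick the same entry twice, of variance 1. *)
Lemma Ex_letter_pair r s : (r < s)%N -> edge i r = edge i s ->
  Ex P (fun t => letter i r t * letter i s t) = pair_cov rho eps i r s.
Proof.
move=> rs e; have [ir is' ne] := tree_backtrack di tree rs e.
have nu : i r != i (ordS r) :> nat by apply/eqP => /val_inj.
rewrite /letter /pair_cov -ir -is'; rewrite -is' in nu.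
case: (eps r); case: (eps s) => //=; rewrite ?expr0 ?expr1 ?Ex_entry_sqr //.
  by rewrite Ex_entry_transpose 1?eq_sym // distnC.
by rewrite Ex_entry_transpose.
Qed.

Lemma path_moment_tree :
  path_moment i = pairing_weight rho eps (edge_pairing i) i.
Proof.
rewrite pairing_weight_compatible; last exact: edge_pairing_compatible.
rewrite pair_big_dep /= path_moment_factor.
rewrite [RHS](partition_big (fun p : 'I_m * 'I_m => edge i p.1)
   (fun e => (e.1 <= e.2)%N)) /=; last by move=> p _; exact: edge_le.
apply: eq_bigr => e _.
have pE (p : 'I_m * 'I_m) : (p.1 < p.2)%N && ([set p.1; p.2]%SET \in edge_pairing i) =
    (p.1 < p.2)%N && (edge i p.1 == edge i p.2).
  case lt: (_ < _)%N => //=; rewrite edge_pairingE // => h.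
  by rewrite h ltnn in lt.
under eq_bigl do rewrite pE.
have [/existsP[k /eqP ek]|nk] := boolP [exists k, edge i k == e]; last first.
  have {}nk k : edge i k == e = false.
    by apply/negbTE; move/existsPn: nk; apply.
  rewrite [RHS]big_pred0 => [|p]; last by rewrite nk andbF.
  under boolp.eq_fun => t do rewrite big_pred0 //; exact: Ex_cst.
have [l [nl el]] : exists l, l <> k /\ edge i l = edge i k.
  by exists (partner i k); exact: partnerP.
have [r [s [rs er es]]] : exists r s, [/\ (r < s)%N, edge i r = e & edge i s = e].
  case: (ltngtP k l) => [kl|lk|/val_inj h]; last by case: nl.
    by exists k, l; split; rewrite ?el.
  by exists l, k; split; rewrite ?el.
have nrs : s != r by apply: contraTneq rs => ->; rewrite ltnn.
have only j : edge i j == e -> j = r \/ j = s.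
  move=> /eqP ej; have [|/eqP jr] := eqVneq j r; first by left.
  right; apply: (tree_edge_twice di tree _ _ jr); rewrite ?ej ?er ?es //.
  exact/eqP.
rewrite [RHS](big_pred1 (r, s)) => [|[x y] /=]; last first.
  rewrite xpair_eqE; apply/idP/andP => [|[/eqP-> /eqP->]]; last by rewrite rs er es !eqxx.
  move=> /andP[/andP[xy exy] ex]; have ey : edge i y == e by rewrite -(eqP exy).
  case: (only _ ex) xy => ->; case: (only _ ey) => ->; rewrite ?ltnn ?eqxx //.
  by move=> sr; move: (ltn_trans sr rs); rewrite ltnn.
rewrite -Ex_letter_pair ?er ?es //=; congr (Ex P _); apply/funext => t.
rewrite (bigD1 r) ?er //= (bigD1 s) /=; last by rewrite es nrs eqxx.
rewrite big1 ?mulr1 // => j.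
by rewrite -andbA => /and3P[/only[]-> ]; rewrite eqxx.
Qed.

End TreeMoment.

End Letters.

Definition NC2s m := [pred sigma : {set {set 'I_m}} | `[< NC2 sigma >]].

(** With so many vertices, either some edge is used once, and then no pairing is
    compatible, or the walk is a tree walk with a single compatible pairing. *)
Lemma path_moment_many_vertices (m n : nat) (eps : 'I_m -> bool)
    (i : {ffun 'I_m -> 'I_n}) : (m < (nb_vertices i).*2)%N -> ~~ odd m ->
  path_moment eps i = \sum_(sigma in @NC2s m) pairing_weight rho eps sigma i.
Proof.
move=> big ev; have [di|ndi] := boolP (doubled i); last first.
  rewrite path_moment_undoubled // big1 // => sigma /asboolP nc.
  apply: pairing_weight_incompatible; apply: contraNN ndi.
  exact: compatible_doubled.
have tree : (nb_vertices i).*2 = m.+2.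
  have := nb_vertices_doubled di; have := odd_double_half m.
  by rewrite (negPf ev); lia.
have nc := edge_pairing_NC2 di tree.
rewrite (bigD1 (edge_pairing i)) /=; last exact/asboolP.
rewrite path_moment_tree // big1 ?addr0 // => sigma /andP[/asboolP ns ne].
apply: pairing_weight_incompatible; apply: contraNN ne => ci.
by rewrite (compatible_tree di tree ns ci).
Qed.

(** The two sums agree on walks with more than [k] vertices; there are O(n^k)
    other walks, and their terms are bounded uniformly. *)
Lemma path_moments_even k : (0 < k)%N -> forall eps : 'I_k.*2 -> bool,
  exists C : R, forall n,
  `|\sum_(i : {ffun 'I_k.*2 -> 'I_n}) path_moment eps i -
    \sum_(sigma in @NC2s k.*2) \sum_(i : {ffun 'I_k.*2 -> 'I_n})
       pairing_weight rho eps sigma i| <= C * n%:R ^+ k.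
Proof.
move=> k0 eps; have m0 : (0 < k.*2)%N by lia.
have [M hM] := entry_moment_bound k.*2.
pose C := k.*2%:R * M; pose N : R := \sum_(sigma in @NC2s k.*2) 1.
exists ((k ^ k.*2)%:R * (C + N)) => n.
rewrite exchange_big -sumrB /=.
apply: le_trans (ler_norm_sum _ _ _) _.
rewrite (bigID (fun i : {ffun 'I_k.*2 -> 'I_n} => (nb_vertices i <= k)%N)) /=.
rewrite [X in _ + X]big1 ?addr0 => [|i]; last first.
  rewrite -ltnNge => big; rewrite path_moment_many_vertices ?subrr ?normr0 //; last by rewrite odd_double.
  by rewrite ltn_double.
apply: le_trans (_ : \sum_(i : {ffun 'I_k.*2 -> 'I_n} | (nb_vertices i <= k)%N) (C + N) <= _).
  apply: ler_sum => i _; rewrite (le_trans (ler_normB _ _)) // lerD //.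
    exact: path_moment_le.
  apply: le_trans (ler_norm_sum _ _ _) _; apply: ler_sum => sigma _.
  exact: norm_pairing_weight norm_rho_le1.
rewrite sumr_const -[leLHS]mulr_natr -mulrA mulrCA -natrX -natrM ler_wpM2l //.
  rewrite addr_ge0 ?sumr_ge0 // mulr_ge0 // (le_trans _ (hM 0%N 0%N)) //.
  by apply: Rintegral_ge0 => t _; rewrite exprn_ge0.
rewrite ler_nat; have := @card_few_vertices _ n k m0.
by rewrite cardsE.
Qed.

(** A nonzero term needs doubled edges, hence at most [k.+1] vertices. *)
Lemma path_moments_odd k : forall eps : 'I_k.*2.+1 -> bool,
  exists C : R, forall n,
  `|\sum_(i : {ffun 'I_k.*2.+1 -> 'I_n}) path_moment eps i| <= C * n%:R ^+ k.+1.
Proof.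
move=> eps; have [M hM] := entry_moment_bound k.*2.+1.
pose C := k.*2.+1%:R * M.
exists ((k.+1 ^ k.*2.+1)%:R * C) => n.
apply: le_trans (ler_norm_sum _ _ _) _.
rewrite (bigID (fun i : {ffun 'I_k.*2.+1 -> 'I_n} => (nb_vertices i <= k.+1)%N)) /=.
rewrite [X in _ + X]big1 ?addr0 => [|i]; last first.
  rewrite -ltnNge => big; rewrite path_moment_undoubled ?normr0 //.
  by apply: contraL big => /nb_vertices_doubled; rewrite -leqNgt; lia.
apply: le_trans (_ : \sum_(i : {ffun 'I_k.*2.+1 -> 'I_n} | (nb_vertices i <= k.+1)%N) C <= _).
  by apply: ler_sum => i _; apply: path_moment_le.
rewrite sumr_const -[leLHS]mulr_natr -mulrA mulrCA -natrX -natrM ler_wpM2l //.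
  rewrite mulr_ge0 // (le_trans _ (hM 0%N 0%N)) //.
  by apply: Rintegral_ge0 => t _; rewrite exprn_ge0.
rewrite ler_nat; have := @card_few_vertices k.*2.+1 n k.+1 isT.
by rewrite cardsE.
Qed.

End RandomEntries.

(** * Trace moments *)

Section CyclicPaths.
Variables (K : comPzRingType) (n : nat).

Definition ffun_cons m (x : 'I_n) (g : {ffun 'I_m -> 'I_n}) : {ffun 'I_m.+1 -> 'I_n} :=
  [ffun k => if unlift ord0 k is Some k' then g k' else x].

Lemma sum_ffun_cons m (G : {ffun 'I_m.+1 -> 'I_n} -> K) :
  \sum_i G i = \sum_x \sum_g G (ffun_cons x g).
Proof.
rewrite pair_big /=.
rewrite (reindex (fun p : 'I_n * {ffun 'I_m -> 'I_n} => ffun_cons p.1 p.2)) //=.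
exists (fun i : {ffun 'I_m.+1 -> 'I_n} => (i ord0, [ffun k => i (lift ord0 k)])).
  move=> [x g] _ /=; rewrite ffunE unlift_none; congr (_, _).
  by apply/ffunP => k; rewrite !ffunE liftK.
by move=> i _; apply/ffunP => k; rewrite ffunE /=; case: unliftP => [j|] -> //; rewrite ffunE.
Qed.

Definition ffun_rcons m (g : {ffun 'I_m -> 'I_n}) (y : 'I_n) : {ffun 'I_m.+1 -> 'I_n} :=
  [ffun k => if unlift ord_max k is Some k' then g k' else y].

Lemma ffun_rcons_cons m z (g : {ffun 'I_m -> 'I_n}) y k :
  ffun_rcons (ffun_cons z g) y (lift ord0 k) = ffun_rcons g y k.
Proof.
rewrite [RHS]ffunE; case: unliftP => [k'|] ->; rewrite ffunE.
  have -> : lift ord0 (lift ord_max k') = lift ord_max (lift ord0 k').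
    by apply/val_inj; rewrite /= /bump /=; case: leqP; case: leqP; have := ltn_ord k'; lia.
  by rewrite liftK ffunE liftK.
case: unliftP => // j /(congr1 val) /=; rewrite /bump leq0n /=.
by have := ltn_ord j; case: (leqP m.+1 j) => /=; lia.
Qed.

Lemma ffun_rcons0 m z (g : {ffun 'I_m -> 'I_n}) y :
  ffun_rcons (ffun_cons z g) y ord0 = z.
Proof.
rewrite ffunE; case: unliftP => [j e|/(congr1 val)//].
have -> : j = ord0.
  by apply/val_inj; move/(congr1 val): e; rewrite /= /bump; case: (leqP m.+1 j) => /=; lia.
by rewrite ffunE unlift_none.
Qed.

(** Here [g] lists the intermediate vertices of a path from [x] to [y]. *)
Lemma prod_mx_entry m (F : nat -> 'M[K]_n) x y :
  (\prod_(k < m.+1) F k) x y =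
  \sum_(g : {ffun 'I_m -> 'I_n}) \prod_(k < m.+1)
     F k (ffun_cons x g k) (ffun_rcons g y k).
Proof.
elim: m F x y => [|m IH] F x y.
  rewrite big_ord1 (big_pred1 [ffun k => x]) => [|g]; last first.
    by apply/esym/eqP/ffunP => -[].
  rewrite big_ord1 !ffunE; case: unliftP => [[]//|_].
  by case: unliftP => [[]//|_].
rewrite big_ord_recl /= mxE sum_ffun_cons; apply: eq_bigr => z _.
rewrite (IH (fun k => F k.+1)) mulr_sumr; apply: eq_bigr => g _.
rewrite [RHS]big_ord_recl ffun_rcons0 /= {1}/ffun_cons ffunE unlift_none.
congr (_ * _); apply: eq_bigr => k _.
by rewrite ffun_rcons_cons; congr (F _ _ _); rewrite [RHS]ffunE liftK.
Qed.

Lemma mxtrace_prod m (F : nat -> 'M[K]_n) : (0 < m)%N ->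
  \tr (\prod_(k < m) F k) =
  \sum_(i : {ffun 'I_m -> 'I_n}) \prod_(k < m) F k (i k) (i (ordS k)).
Proof.
case: m => // m _; rewrite sum_ffun_cons; apply: eq_bigr => x _.
rewrite prod_mx_entry; apply: eq_bigr => g _; apply: eq_bigr => k _.
congr (F _ _ _); rewrite ffunE; case: unliftP => [k'|] -> .
  have -> : ordS (lift ord_max k') = lift ord0 k'.
    apply/val_inj; rewrite /= /bump; have := ltn_ord k' => h.
    by rewrite leqNgt h /= modn_small.
  by rewrite ffunE liftK.
have -> : ordS ord_max = ord0 :> 'I_m.+1 by apply/val_inj; rewrite /= modnn.
by rewrite ffunE unlift_none.
Qed.

End CyclicPaths.

Section TraceMoments.
Context (R : realType) (d : measure_display) (T : measurableType d).
Variables (P : probability T R) (rho : nat -> R) (a : nat -> nat -> {RV P >-> R}).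
Hypothesis rho0 : rho 0%N = 1.
Hypothesis indep : mutually_independent P
  [set ij : nat * nat | (ij.1 <= ij.2)%N] (entry_sigma a).
Hypothesis mean0 : forall i j, ('E_P[a i j] = 0)%E.
Hypothesis var1 : forall i j, ('E_P[(fun t => a i j t ^+ 2)%R] = 1)%E.
Hypothesis moments : forall q : nat, exists M : R, forall i j,
  ('E_P[(fun t => `|a i j t| ^+ q)%R] <= M%:E)%E.
Hypothesis covar : forall i j, i != j ->
  ('E_P[(fun t => a i j t * a j i t)%R] = (rho `|i%:Z - j%:Z|%N)%:E)%E.

Definition word_eps (w : seq bool) m : 'I_m -> bool := fun k => nth false w k.

Definition real_mx n (t : T) : 'M[R]_n := \matrix_(i, j) (a i j t / Num.sqrt n%:R).

Definition real_mx_word w n (t : T) : 'M[R]_n :=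
  \prod_(e <- w) (if e then (real_mx n t)^T else real_mx n t).

Lemma mx_word_real w n t :
  mx_word w (scaled_mx a n t) = map_mx (real_complex R) (real_mx_word w n t).
Proof.
rewrite /mx_word /real_mx_word; elim: w => [|e w IH].
  by rewrite !big_nil; apply/matrixP => x y; rewrite !mxE rmorph_nat.
rewrite !big_cons [_ * _]/(_ *m _) [X in map_mx _ X]/(_ *m _) map_mxM -IH.
congr (_ *m _); apply/matrixP => x y; case: e; rewrite !mxE //.
by rewrite [Num.conj _]conjc_real.
Qed.

Definition word_moment w n : R := n%:R^-1 * Ex P (fun t => \tr (real_mx_word w n t)).

Lemma mx_state_word w n :
  mx_state P (fun t => mx_word w (scaled_mx a n t)) = (word_moment w n)%:C%C.
Proof.
rewrite /mx_state /word_moment rmorphM /= fmorphV rmorph_nat; congr (_ * _).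
rewrite /expectationC.
have trE t : \tr (mx_word w (scaled_mx a n t)) = (\tr (real_mx_word w n t))%:C%C.
  by rewrite mx_word_real [LHS]trace_map_mx.
rewrite (_ : (fun t => complex.Im _) = cst 0); last first.
  by apply/funext => t; rewrite trE.
rewrite (_ : (fun t => complex.Re _) = (fun t => \tr (real_mx_word w n t))); last first.
  by apply/funext => t; rewrite trE.
by rewrite expectation_cst -Ex_expectation.
Qed.

Lemma tr_real_mx_word w m n t : size w = m -> (0 < m)%N ->
  \tr (real_mx_word w n t) = (Num.sqrt n%:R ^+ m)^-1 *
    \sum_(i : {ffun 'I_m -> 'I_n}) \prod_k letter a (@word_eps w m) i k t.
Proof.
move=> <- m0; rewrite /real_mx_word (big_nth false) big_mkord.
rewrite (mxtrace_prod (fun k => if nth false w k then (real_mx n t)^T else real_mx n t)) //.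
rewrite mulr_sumr; apply: eq_bigr => i _.
rewrite -[X in _ ^+ X]card_ord -prodr_const -prodfV -big_split /=.
apply: eq_bigr => k _; rewrite /letter /word_eps.
by case: (nth false w k); rewrite !mxE mulrC.
Qed.

Lemma word_momentE w m n : size w = m -> (0 < m)%N ->
  word_moment w n = (n%:R * Num.sqrt n%:R ^+ m)^-1 *
    \sum_(i : {ffun 'I_m -> 'I_n}) path_moment a (@word_eps w m) i.
Proof.
move=> wm m0; rewrite /word_moment.
under [X in Ex P X]boolp.eq_fun do rewrite (tr_real_mx_word _ _ wm m0).
have h (i : {ffun 'I_m -> 'I_n}) : has_moments P (fun t => \prod_k letter a (@word_eps w m) i k t).
  by apply: has_moments_prod; apply: letter_has_moments.
rewrite ExZ; last exact: has_moments_sum.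
by rewrite Ex_sum // mulrA invfM.
Qed.

Lemma word_moment_nil n : (0 < n)%N -> word_moment [::] n = 1.
Proof.
move=> n0; rewrite /word_moment /real_mx_word.
under [X in Ex P X]boolp.eq_fun do rewrite big_nil mxtrace1.
by rewrite Ex_cst mulVf // pnatr_eq0 -lt0n.
Qed.

Lemma cvg_div_nat (C : R) : (fun n : nat => C / n%:R) @ \oo --> 0.
Proof.
rewrite -(mulr0 C); apply: cvgM; first exact: cvg_cst.
apply/gtr0_cvgV0; last exact: cvgr_idn.
by near=> n; rewrite ltr0n; near: n; exact: nbhs_infty_gt.
Unshelve. all: by end_near. Qed.

Lemma cvg0_le (f : nat -> R) (g : nat -> R) : g @ \oo --> 0 ->
  (forall n, (0 < n)%N -> `|f n| <= g n) -> f @ \oo --> 0.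
Proof.
move=> g0 fg; apply/cvgr0Pnorm_lt => e e0.
move/cvgr0Pnorm_lt : g0 => /(_ e e0) g0.
near=> n; apply: le_lt_trans (_ : `|g n| < e); last by near: n.
rewrite (le_trans (fg n _)) ?ler_norm //.
by near: n; exact: nbhs_infty_gt.
Unshelve. all: by end_near. Qed.

(** With the normalisation n^(-k-1), the error O(n^k) of [path_moments_even]
    becomes O(1/n). *)
Lemma word_moment_even w k : size w = k.*2 -> (0 < k)%N ->
  (fun n => word_moment w n - \sum_(sigma in @NC2s k.*2)
     pairing_sum rho (@word_eps w k.*2) sigma n) @ \oo --> 0.
Proof.
move=> wk k0; have m0 : (0 < k.*2)%N by lia.
have [C hC] := path_moments_even rho0 indep mean0 var1 moments covar k0 (@word_eps w k.*2).
apply: cvg0_le (cvg_div_nat C) _ => n n0.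
rewrite (word_momentE _ wk m0).
have n0R : n%:R != 0 :> R by rewrite pnatr_eq0 -lt0n.
have -> : n%:R * Num.sqrt n%:R ^+ k.*2 = n%:R ^+ k.+1 :> R.
  by rewrite -mul2n exprM sqr_sqrtr // -exprS.
have -> : \sum_(sigma in @NC2s k.*2) pairing_sum rho (@word_eps w k.*2) sigma n =
    (n%:R ^+ k.+1)^-1 * \sum_(sigma in @NC2s k.*2) \sum_(i : {ffun 'I_k.*2 -> 'I_n})
       pairing_weight rho (@word_eps w k.*2) sigma i.
  by rewrite mulr_sumr.
rewrite -mulrBr normrM [leLHS]mulrC normfV normrX normr_nat.
rewrite ler_pdivrMr ?exprn_gt0 ?ltr0n // (le_trans (hC n)) //.
by rewrite exprS mulrA divfK.
Qed.

Lemma word_moment_odd w k : size w = k.*2.+1 -> word_moment w @ \oo --> 0.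
Proof.
move=> wk.
have [C hC] := path_moments_odd indep mean0 moments (@word_eps w k.*2.+1).
apply: (@cvg0_le _ (fun n => C / Num.sqrt n%:R)) => [|n n0]; last first.
  rewrite (word_momentE _ wk) // normrM.
  have n0R : Num.sqrt n%:R != 0 :> R by rewrite sqrtr_eq0 -ltNge ltr0n.
  have -> : n%:R * Num.sqrt n%:R ^+ k.*2.+1 = n%:R ^+ k.+1 * Num.sqrt n%:R :> R.
    by rewrite exprS -mul2n exprM sqr_sqrtr // mulrCA mulrC -exprS.
  rewrite [leLHS]mulrC normfV normrM normrX normr_nat (ger0_norm (sqrtr_ge0 _)).
  rewrite ler_pdivrMr ?mulr_gt0 ?exprn_gt0 ?ltr0n ?sqrtr_gt0 ?ltr0n //.
  by rewrite (le_trans (hC n)) // mulrCA mulfVK // mulrC.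
rewrite -(mulr0 C); apply: cvgM; first exact: cvg_cst.
apply/gtr0_cvgV0; first by near=> n; rewrite sqrtr_gt0 ltr0n; near: n; exact: nbhs_infty_gt.
apply/cvgryPge => A; near=> n.
rewrite (le_trans (ler_norm A)) // -[leLHS]sqrtr_sqr.
rewrite ler_sqrt //; near: n; exact: nbhs_infty_ger.
Unshelve. all: by end_near. Qed.

End TraceMoments.

(** * Constant correlation *)

Section Mate.
Variables (m : nat) (sigma : {set {set 'I_m}}).
Hypothesis nc : NC2 sigma.
Implicit Types (r s : 'I_m).

Definition mate r : 'I_m := odflt r [pick s | [set r; s]%SET \in sigma].

Lemma mateP r : [set r; mate r]%SET \in sigma.
Proof.
rewrite /mate; case: pickP => //= h.
by have [l _ hl] := NC2_partner r nc; move: (h l); rewrite hl.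
Qed.

Lemma mate_unique r s : [set r; s]%SET \in sigma -> mate r = s.
Proof. exact: NC2_unique nc (mateP r). Qed.

Lemma mateK : involutive mate.
Proof. by move=> r; apply: mate_unique; rewrite finset.setUC mateP. Qed.

Lemma mate_neq r : mate r <> r.
Proof. exact/nesym/(NC2_neq nc (mateP r)). Qed.

Lemma mate_noncrossing (r x : 'I_m) :
  ~ [/\ (r < x)%N, (x < mate r)%N & (mate r < mate x)%N].
Proof. by case=> h1 h2 h3; apply: (NC2_noncrossing nc (mateP r) (mateP x)). Qed.

Definition opener := {r : 'I_m | (r < mate r)%N}.

Lemma card_opener : (#|{: opener}|.*2 = m)%N.
Proof.
have e1 : #|[set r : 'I_m | (r < mate r)%N]%SET| = #|[set r : 'I_m | (mate r < r)%N]%SET|.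
  rewrite -(card_imset _ (can_inj mateK)); apply: eq_card => r.
  rewrite inE; apply/imsetP/idP => [[s + ->]|h]; first by rewrite inE mateK.
  by exists (mate r); rewrite ?inE mateK.
have e2 : #|{: opener}| = #|[set r : 'I_m | (r < mate r)%N]%SET|.
  by rewrite card_sig cardsE.
have e3 : (~: [set r : 'I_m | (r < mate r)%N])%SET = [set r : 'I_m | (mate r < r)%N]%SET.
  apply/setP => r; rewrite !inE -leqNgt leq_eqVlt orb_idl // => /eqP/val_inj.
  by move/mate_neq.
have := cardsC [set r : 'I_m | (r < mate r)%N]%SET.
by rewrite e3 -e1 addnn card_ord e2.
Qed.

Lemma opener_mate_cases (r x : 'I_m) : (r < mate r)%N -> (x < mate x)%N ->
  [/\ r = x :> nat -> mate r = mate x :> nat, mate r = mate x :> nat -> r = x :> nat,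
     r <> mate x :> nat & mate r <> x :> nat].
Proof.
move=> hr hx; split=> [/val_inj->//|/val_inj/(can_inj mateK)->//|/val_inj|/val_inj] e.
  by rewrite e mateK in hr; have := ltn_trans hr hx; rewrite ltnn.
by rewrite -e mateK in hx; have := ltn_trans hr hx; rewrite ltnn.
Qed.

(** The vertices of the universal walk compatible with the pairing: at time [t] it
    sits at the set of blocks that have been opened and not yet closed. *)
Definition enclosing (t : 'I_m) : {set opener} :=
  [set u : opener | (val u < t)%N && (t <= mate (val u))%N]%SET.

Lemma enclosing_ordS (t : 'I_m) (u : opener) :
  (u \in enclosing (ordS t)) = (val u <= t)%N && (t < mate (val u))%N.
Proof.
rewrite inE; have [tm|mt] := ltnP t.+1 m; first by rewrite ordS_val // ltnS.
have -> : ordS t = 0%N :> nat.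
  by rewrite /= (_ : t.+1 = m) ?modnn //; have := ltn_ord t; lia.
by have := ltn_ord (mate (val u)); have := ltn_ord t; lia.
Qed.

(** By non-crossing, every other block is either open on the whole range from [x]
    to its mate or opened and closed within it, so a block is opened and closed in
    the same configuration. *)
Lemma enclosing_block (x : 'I_m) : (x < mate x)%N ->
  enclosing x = enclosing (ordS (mate x)) /\ enclosing (mate x) = enclosing (ordS x).
Proof.
move=> hx; split; apply/setP => u; rewrite enclosing_ordS inE;
  have [h1 h2 h3 h4] := opener_mate_cases (valP u) hx;
  have := @mate_noncrossing (val u) x; have := @mate_noncrossing x (val u);
  have := valP u; move: (val u) (mate (val u)) h1 h2 h3 h4 => r s h1 h2 h3 h4 rs n1 n2.
  apply/idP/idP => /andP[a b].
    have ? : ~ (s < mate x)%N by move=> ?; apply: n2; split=> //; lia.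
    by lia.
  have ? : ~ (x < r)%N by move=> ?; apply: n1; split=> //; lia.
  by lia.
apply/idP/idP => /andP[a b].
  have ? : ~ (x < r)%N by move=> ?; apply: n1; split=> //; lia.
  by lia.
have ? : ~ ((r < x)%N /\ (s < mate x)%N) by move=> [? ?]; apply: n2; split=> //; lia.
by lia.
Qed.

(** The blocks open right after the opener [u] have [u] as their last one; this
    tells apart the configurations after the k openers and the initial one. *)
Definition innermost (S : {set opener}) : option opener :=
  [pick u in S | [forall v in S, (val v <= val u)%N]].

Lemma innermost_ordS (u : opener) : innermost (enclosing (ordS (val u))) = Some u.
Proof.
rewrite /innermost; case: pickP => [v /andP[vS /forall_inP vmax]|/(_ u)].
  have uS : u \in enclosing (ordS (val u)) by rewrite enclosing_ordS leqnn (valP u).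
  move: vS; rewrite enclosing_ordS => /andP[vu _].
  by congr Some; apply/val_inj/val_inj/eqP; rewrite /= eqn_leq vu vmax.
rewrite enclosing_ordS leqnn (valP u) /= => /negbT/forall_inPn[v].
by rewrite enclosing_ordS => /andP[->].
Qed.

Lemma innermost_first (z : 'I_m) : z = 0%N :> nat -> innermost (enclosing z) = None.
Proof.
move=> z0; rewrite /innermost; case: pickP => // u /andP[].
by rewrite inE z0 ltn0.
Qed.

(** A compatible walk is determined by its starting vertex and the vertices that
    follow the openers, because a closer leads back to where its opener started;
    this is the upper bound.  For the lower bound, every labelling of the
    configurations of open blocks by vertices gives a compatible walk. *)
Lemma card_compatible n : (0 < m)%N ->
  #|[set i : {ffun 'I_m -> 'I_n} | compatible sigma i]%SET| = (n ^ (m./2).+1)%N.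
Proof.
move=> m0; pose z : 'I_m := Ordinal m0.
have cardE : (n ^ (m./2).+1 = #|{: {ffun option opener -> 'I_n}}|)%N.
  rewrite card_ffun card_ord card_option; congr (_ ^ _.+1)%N.
  by rewrite -[in LHS]card_opener doubleK.
rewrite cardE; apply/eqP; rewrite eqn_leq; apply/andP; split.
  pose f (i : {ffun 'I_m -> 'I_n}) := [ffun u : option opener =>
    if u is Some r then i (ordS (val r)) else i z] : {ffun option opener -> 'I_n}.
  rewrite -(@card_in_imset _ _ f) ?max_card // => i i'.
  rewrite !inE => /compatibleP ci /compatibleP ci' /ffunP e; apply/ffunP => t.
  have [N] := ubnP (val t); elim: N t => // N IH t; rewrite ltnS => tN.
  have [t0|t0] := posnP t.
    by have := e None; rewrite !ffunE (_ : z = t) //; apply/val_inj.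
  have t1 : (t.-1 < m)%N := leq_ltn_trans (leq_pred t) (ltn_ord t).
  pose r := Ordinal t1; have tE : t = ordS r.
    by apply/val_inj; rewrite /= prednK // modn_small.
  rewrite tE; have [h|h] := ltnP r (mate r).
    by have := e (Some (exist _ r h)); rewrite !ffunE.
  have {}h : (mate r < r)%N.
    by rewrite ltn_neqAle h andbT; apply/eqP => /val_inj/mate_neq.
  have hs : [set mate r; r]%SET \in sigma by rewrite finset.setUC mateP.
  have [<- _] := ci _ _ h hs; have [<- _] := ci' _ _ h hs.
  by apply: IH; rewrite (leq_trans h) //= -ltnS prednK // ltnW.
pose f (g : {ffun option opener -> 'I_n}) :=
  [ffun t => g (innermost (enclosing t))] : {ffun 'I_m -> 'I_n}.
have fI : injective f.
  move=> g g' /ffunP e; apply/ffunP => -[u|].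
    by have := e (ordS (val u)); rewrite !ffunE innermost_ordS.
  by have := e z; rewrite !ffunE innermost_first.
rewrite -(card_imset _ fI); apply: subset_leq_card.
apply/fintype.subsetP => _ /imsetP[g _ ->]; rewrite inE.
apply/compatibleP => r s rs h; have sE := mate_unique h; rewrite -sE in rs *.
by rewrite !ffunE; have [-> ->] := enclosing_block rs.
Qed.

End Mate.

Section ConstantCorrelation.
Variables (R : realType) (rho : nat -> R) (r0 : R) (k : nat).
Hypotheses (rho_le1 : forall j, `|rho j| <= 1)
  (rhoE : forall j, (0 < j)%N -> rho j = r0) (k0 : (0 < k)%N).
Variables (eps : 'I_k.*2 -> bool) (sigma : {set {set 'I_k.*2}}).
Hypothesis nc : NC2 sigma.

Definition pairing_value : R :=
  \prod_(r < k.*2) \prod_(s < k.*2 | (r < s)%N && ([set r; s]%SET \in sigma))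
    r0 ^+ (eps r == eps s).

(** On a tree walk paired steps start from distinct vertices, so the exceptional
    value rho_0 never occurs. *)
Lemma pairing_weight_tree n (i : {ffun 'I_k.*2 -> 'I_n}) :
  (k < nb_vertices i)%N ->
  pairing_weight rho eps sigma i = (compatible sigma i)%:R * pairing_value.
Proof.
move=> big; have [ci|nci] := boolP (compatible sigma i); last first.
  by rewrite pairing_weight_incompatible // mul0r.
rewrite mul1r pairing_weight_compatible //.
have di := compatible_doubled nc ci.
have tree : (nb_vertices i).*2 = k.*2.+2 by have := nb_vertices_doubled di; lia.
apply: eq_bigr => r _; apply: eq_bigr => s /andP[rs h].
have [_ is' ne] := tree_backtrack di tree rs (compatible_edge ci h).
rewrite /pair_cov rhoE // absz_gt0 subr_eq0 is'; apply/eqP => -[] /val_inj //.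
Qed.

Lemma cvg_pairing_sum : pairing_sum rho eps sigma @ \oo --> pairing_value.
Proof.
apply/subr_cvg0; have m0 : (0 < k.*2)%N by lia.
pose C := (k ^ k.*2)%:R * (1 + `|pairing_value|).
apply: cvg0_le (cvg_div_nat C) _ => n n0.
have n0R : n%:R != 0 :> R by rewrite pnatr_eq0 -lt0n.
have -> : pairing_sum rho eps sigma n - pairing_value = (n%:R ^+ k.+1)^-1 *
    \sum_(i : {ffun 'I_k.*2 -> 'I_n})
      (pairing_weight rho eps sigma i - (compatible sigma i)%:R * pairing_value).
  rewrite sumrB mulrBr; congr (_ - _); rewrite -mulr_suml -natr_sum.
  have -> : (\sum_(i : {ffun 'I_k.*2 -> 'I_n}) compatible sigma i = n ^ k.+1)%N.
    rewrite -[in RHS](doubleK k) -(card_compatible nc) // -sum1dep_card.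
    by rewrite [RHS]big_mkcond; apply: eq_bigr => i _; case: compatible.
  by rewrite natrX mulrA mulVf ?mul1r // expf_neq0.
rewrite normrM [leLHS]mulrC normfV normrX normr_nat.
rewrite ler_pdivrMr ?exprn_gt0 ?ltr0n //.
have -> : C / n%:R * n%:R ^+ k.+1 = C * n%:R ^+ k by rewrite exprS mulrA divfK.
apply: le_trans (ler_norm_sum _ _ _) _.
rewrite (bigID (fun i : {ffun 'I_k.*2 -> 'I_n} => (nb_vertices i <= k)%N)) /=.
rewrite [X in _ + X]big1 ?addr0 => [|i]; last first.
  by rewrite -ltnNge => big; rewrite pairing_weight_tree // subrr normr0.
apply: le_trans (_ : \sum_(i : {ffun 'I_k.*2 -> 'I_n} | (nb_vertices i <= k)%N)
    (1 + `|pairing_value|) <= _).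
  apply: ler_sum => i _; rewrite (le_trans (ler_normB _ _)) // lerD //.
    exact: norm_pairing_weight.
  by rewrite normrM normr_nat; case: compatible; rewrite ?mul1r ?mul0r.
rewrite /C sumr_const -[leLHS]mulr_natr -mulrA mulrCA -natrX -natrM ler_wpM2l ?addr_ge0 //.
by rewrite ler_nat; have := @card_few_vertices _ n k m0; rewrite cardsE.
Qed.

End ConstantCorrelation.

(** * States on the free star-algebra *)

Section FreeAlgebra.
Variable R : realType.
Implicit Types (c : R[i]) (u v w : seq bool) (mu : seq bool -> R).

(** Non-commutative polynomials in two letters, as the algebra of the free
    monoid; the letters are booleans so that they can be the exponents 1 and star
    as well as the colours of two semicircular elements. *)
Definition free_algebra := monalg.malg (monalg.fmonom bool) R[i].

HB.instance Definition _ := GRing.Lalgebra.on free_algebra.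

Definition mono c w : free_algebra := monalg.mkmalgU (monalg.FMonom w) c.

Definition coef w (g : free_algebra) : R[i] := monalg.mcoeff (monalg.FMonom w) g.

Lemma coefP (g h : free_algebra) : (forall w, coef w g = coef w h) -> g = h.
Proof. by move=> e; apply/monalg.malgP => -[w]; exact: e. Qed.

Lemma coefD w (g h : free_algebra) : coef w (g + h) = coef w g + coef w h.
Proof. exact: monalg.mcoeffD. Qed.

Lemma coefZ w c (g : free_algebra) : coef w (c *: g) = c * coef w g.
Proof. exact: monalg.mcoeffZ. Qed.

Lemma coef_mono w c u : coef w (mono c u) = c *+ (u == w).
Proof. exact: monalg.mcoeffU. Qed.

Lemma coef_sum w (I : Type) (s : seq I) (F : I -> free_algebra) :
  coef w (\sum_(x <- s) F x) = \sum_(x <- s) coef w (F x).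
Proof. exact: (raddf_sum (monalg.mcoeff (monalg.FMonom w))). Qed.

Definition supp (g : free_algebra) : seq (seq bool) :=
  [seq monalg.fmonom_val k | k <- finmap.enum_fset (monalg.msupp g)].

Lemma supp_uniq g : uniq (supp g).
Proof. by rewrite map_inj_uniq ?finmap.fset_uniq // => -[u] [v] /= ->. Qed.

Lemma coef_notin w g : w \notin supp g -> coef w g = 0.
Proof.
move=> h; apply: monalg.mcoeff_outdom; apply: contraNN h => h.
by apply/mapP; exists (monalg.FMonom w).
Qed.

Lemma free_algebraE g : g = \sum_(w <- supp g) mono (coef w g) w.
Proof.
rewrite big_map [LHS]monalg.monalgE; apply: eq_bigr => -[w] _ //.
Qed.

Lemma mono_mul c1 c2 u v : mono c1 u * mono c2 v = mono (c1 * c2) (u ++ v).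
Proof.
rewrite [LHS]monalg.fgmulUU /mono; congr (monalg.mkmalgU _ _).
by apply/val_inj; exact: monalg.fmM.
Qed.

Lemma mono1 : mono 1 [::] = 1.
Proof.
rewrite /mono [RHS]/(monalg.fgone _ _); congr (monalg.mkmalgU _ _).
by apply/val_inj; rewrite /= monalg.fm1.
Qed.

Lemma mono_scale c d w : c *: mono d w = mono (c * d) w.
Proof. by apply: coefP => u; rewrite coefZ !coef_mono mulrnAr. Qed.

Lemma mul_sum_mono (s r : seq (seq bool)) (a b : seq bool -> R[i])
    (f h : seq bool -> seq bool) :
  (\sum_(u <- s) mono (a u) (f u)) * (\sum_(v <- r) mono (b v) (h v)) =
  \sum_(u <- s) \sum_(v <- r) mono (a u * b v) (f u ++ h v).
Proof.
rewrite mulr_suml; apply: eq_bigr => u _; rewrite mulr_sumr.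
by apply: eq_bigr => v _; rewrite mono_mul.
Qed.

Lemma free_algebra_scaleAr c (g h : free_algebra) : c *: (g * h) = g * (c *: h).
Proof.
rewrite [g]free_algebraE [h]free_algebraE !mulr_suml !scaler_sumr.
apply: eq_bigr => u _; rewrite !mulr_sumr scaler_sumr; apply: eq_bigr => v _.
by rewrite mono_scale !mono_mul mono_scale mulrCA.
Qed.

HB.instance Definition _ := GRing.Lalgebra_isAlgebra.Build R[i] free_algebra
  free_algebra_scaleAr.

Definition word_functional mu (g : free_algebra) : R[i] :=
  \sum_(w <- supp g) coef w g * (mu w)%:C%C.

Lemma word_functionalE mu (s : seq (seq bool)) g : uniq s -> {subset supp g <= s} ->
  word_functional mu g = \sum_(w <- s) coef w g * (mu w)%:C%C.
Proof.
move=> us sub; rewrite /word_functional [RHS](bigID (mem (supp g))) /=.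
rewrite [X in _ = _ + X]big1 ?addr0 => [|w /coef_notin ->]; last by rewrite mul0r.
rewrite -[RHS]big_filter; apply: perm_big; apply: uniq_perm; rewrite ?filter_uniq ?supp_uniq //.
by move=> w; rewrite mem_filter /=; apply/idP/andP => [h|[]//]; split=> //; exact: sub.
Qed.

Lemma word_functional_is_linear mu c :
  forall g h, word_functional mu (c *: g + h) =
    c * word_functional mu g + word_functional mu h.
Proof.
move=> g h; pose s := undup (supp (c *: g + h) ++ supp g ++ supp h).
rewrite !(@word_functionalE mu s) ?undup_uniq //; last 3 first.
- by move=> w; rewrite mem_undup !mem_cat => ->; rewrite ?orbT.
- by move=> w; rewrite mem_undup !mem_cat => ->; rewrite ?orbT.
- by move=> w; rewrite mem_undup !mem_cat => ->; rewrite ?orbT.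
rewrite mulr_sumr -big_split; apply: eq_bigr => w _ /=.
by rewrite coefD coefZ mulrDl mulrA.
Qed.

HB.instance Definition _ mu := GRing.isLinear.Build R[i] free_algebra R[i] *%R
  (word_functional mu) (fun c => word_functional_is_linear mu c).

Lemma word_functional_mono mu c w : word_functional mu (mono c w) = c * (mu w)%:C%C.
Proof.
rewrite (@word_functionalE mu (undup (w :: supp (mono c w)))) ?undup_uniq //; last first.
  by move=> u; rewrite mem_undup inE => ->; rewrite orbT.
rewrite (bigD1_seq w) ?undup_uniq ?mem_undup ?mem_head //= coef_mono eqxx mulr1n.
rewrite big1 ?addr0 // => u ne; rewrite coef_mono eq_sym (negPf ne) mul0r //.
Qed.

(** The involution [inv] prescribes the adjoint of each letter. *)
Section Star.
Variable inv : bool -> bool.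
Hypothesis invK : involutive inv.

Definition word_star w := rev (map inv w).

Lemma word_starK : involutive word_star.
Proof. by move=> w; rewrite /word_star map_rev revK -map_comp map_id_in // => b _ /=; rewrite invK. Qed.

Lemma word_star_cat u v : word_star (u ++ v) = word_star v ++ word_star u.
Proof. by rewrite /word_star map_cat rev_cat. Qed.

Definition algebra_star (g : free_algebra) : free_algebra :=
  \sum_(w <- supp g) mono (coef w g)^*%C (word_star w).

Lemma coef_star w g : coef w (algebra_star g) = (coef (word_star w) g)^*%C.
Proof.
rewrite coef_sum; have [ws|ws] := boolP (word_star w \in supp g).
  rewrite (bigD1_seq (word_star w)) ?supp_uniq //= coef_mono word_starK eqxx mulr1n.
  rewrite big1 ?addr0 // => u ne; rewrite coef_mono; case: eqP => // e.
  by rewrite -e word_starK eqxx in ne.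
rewrite (coef_notin ws) rmorph0 big1_seq // => u /= us.
rewrite coef_mono; case: eqP => // e; by rewrite -e word_starK us in ws.
Qed.

Lemma algebra_starK : involutive algebra_star.
Proof. by move=> g; apply: coefP => w; rewrite !coef_star word_starK conjcK. Qed.

Lemma algebra_starD g h : algebra_star (g + h) = algebra_star g + algebra_star h.
Proof. by apply: coefP => w; rewrite coefD !coef_star coefD rmorphD. Qed.

Lemma algebra_starZ c g : algebra_star (c *: g) = c^*%C *: algebra_star g.
Proof. by apply: coefP => w; rewrite coefZ !coef_star coefZ rmorphM. Qed.

Lemma algebra_star_mono c w : algebra_star (mono c w) = mono c^*%C (word_star w).
Proof.
apply: coefP => u; rewrite coef_star !coef_mono rmorphMn.
by rewrite -(can_eq word_starK) word_starK.
Qed.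

Lemma algebra_star_sum (I : Type) (s : seq I) (F : I -> free_algebra) :
  algebra_star (\sum_(x <- s) F x) = \sum_(x <- s) algebra_star (F x).
Proof.
apply: coefP => w; rewrite coef_star !coef_sum rmorph_sum.
by apply: eq_bigr => x _; rewrite coef_star.
Qed.

Lemma algebra_starM g h : algebra_star (g * h) = algebra_star h * algebra_star g.
Proof.
rewrite [in LHS](free_algebraE g) [in LHS](free_algebraE h) mul_sum_mono.
rewrite /algebra_star -/(algebra_star _) mul_sum_mono exchange_big algebra_star_sum.
apply: eq_bigr => v _; rewrite algebra_star_sum; apply: eq_bigr => u _.
by rewrite algebra_star_mono word_star_cat rmorphM mulrC.
Qed.

Section State.
Variable mu : seq bool -> R.
Hypotheses (mu1 : mu [::] = 1) (mu_star : forall w, mu (word_star w) = mu w).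
Hypothesis mu_ge0 : forall (s : seq (seq bool)) (c : seq bool -> R),
  0 <= \sum_(u <- s) \sum_(v <- s) c u * c v * mu (word_star u ++ v).

Lemma word_functional1 : word_functional mu 1 = 1.
Proof. by rewrite -mono1 word_functional_mono mu1 mulr1. Qed.

(** Positivity is assumed for real coefficients only.  For complex ones the mixed
    terms between real and imaginary parts cancel, the form being symmetric. *)
Lemma word_functional_ge0 g : 0 <= word_functional mu (algebra_star g * g).
Proof.
pose p w : R := complex.Re (coef w g); pose q w : R := complex.Im (coef w g).
pose M u v := mu (word_star u ++ v).
have MC u v : M u v = M v u by rewrite /M -mu_star word_star_cat word_starK.
pose Q (c : seq bool -> R) := \sum_(u <- supp g) \sum_(v <- supp g) c u * c v * M u v.
have -> : word_functional mu (algebra_star g * g) = (Q p + Q q)%:C%C.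
  rewrite {2}(free_algebraE g) /algebra_star mul_sum_mono raddf_sum /=.
  under eq_bigr do rewrite raddf_sum /=.
  under eq_bigr do under eq_bigr do rewrite word_functional_mono.
  have e (u v : seq bool) : (coef u g)^*%C * coef v g * (M u v)%:C%C =
      (((p u * p v * M u v) + (q u * q v * M u v)) +i*
      ((p u * q v * M u v) - (q u * p v * M u v)))%C.
    rewrite /p /q; case: (coef u g) => a b; case: (coef v g) => a' b'.
    by apply/eqP; rewrite eq_complex /=; apply/andP; split; apply/eqP; ring.
  under eq_bigr do under eq_bigr do rewrite e.
  have ri (x y : R) : (x +i* y)%C = x%:C%C + 'i%C * y%:C%C.
    by apply/eqP; rewrite eq_complex /= !(mul0r, mulr0, mul1r, addr0, add0r, subr0, oppr0) !eqxx.
  under eq_bigr do under eq_bigr do rewrite ri.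
  under eq_bigr do rewrite big_split /=.
  rewrite big_split /=.
  have -> : \sum_(u <- supp g) \sum_(v <- supp g)
     'i%C * (p u * q v * M u v - q u * p v * M u v)%:C%C = 0.
    under eq_bigr do rewrite -mulr_sumr -rmorph_sum sumrB.
    rewrite -mulr_sumr -rmorph_sum sumrB [X in X - _]exchange_big /=.
    rewrite (_ : _ - _ = 0) ?rmorph0 ?mulr0 //; apply/eqP; rewrite subr_eq0; apply/eqP.
    apply: eq_bigr => u _; apply: eq_bigr => v _; rewrite MC; ring.
  rewrite addr0 /Q -big_split rmorph_sum; apply: eq_bigr => u _ /=.
  by rewrite -big_split rmorph_sum.
by rewrite lecR addr_ge0 //; exact: mu_ge0.
Qed.

Definition word_ncps : ncps R := @NCPS R free_algebra algebra_star algebra_starK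
  algebra_starD algebra_starM algebra_starZ (word_functional mu : {scalar free_algebra})
  word_functional1 word_functional_ge0.

Definition word_gen (b : bool) : word_ncps := mono 1 [:: b].

Lemma star_word_gen b : star (word_gen b) = word_gen (inv b).
Proof. by rewrite /star /= /word_gen algebra_star_mono rmorph1. Qed.

Lemma state_word_gen w : state (\prod_(b <- w) word_gen b) = (mu w)%:C%C.
Proof.
have -> : \prod_(b <- w) word_gen b = mono 1 w.
  elim: w => [|b w IH]; first by rewrite big_nil -mono1.
  by rewrite big_cons IH [LHS]mono_mul mulr1.
by rewrite [LHS]word_functional_mono mul1r.
Qed.

End State.
End Star.
End FreeAlgebra.

(** * Existence of the limit *)

Section ComplexLimits.
Variable R : realType.

Lemma cvg_real_complex (f : nat -> R) (l : R) : f @ \oo --> l ->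
  (fun n => (f n)%:C%C : R[i]^o) @ \oo --> (l%:C%C : R[i]^o).
Proof.
move=> fl; apply/cvgrPdist_lt => e e0.
have eE : e = (complex.Re e)%:C%C by rewrite RRe_real // ger0_real ?ltW.
have e0' : 0 < complex.Re e by rewrite -ltcR -eE.
move/cvgrPdist_lt : fl => /(_ _ e0'); apply: filterS => n.
by rewrite eE -rmorphB normc_def /= expr0n /= addr0 sqrtr_sqr ltcR.
Qed.

Lemma cvg_sum (I : Type) (s : seq I) (p : pred I) (f : I -> nat -> R) (l : I -> R) :
  (forall x, p x -> f x @ \oo --> l x) ->
  (fun n => \sum_(x <- s | p x) f x n) @ \oo --> \sum_(x <- s | p x) l x.
Proof.
move=> h; elim: s => [|x s IH].
  by under boolp.eq_fun do rewrite big_nil; rewrite big_nil; exact: cvg_cst.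
under boolp.eq_fun do rewrite big_cons.
by rewrite big_cons; case px: (p x) => //; apply: cvgD => //; exact: h.
Qed.

End ComplexLimits.

Section LimitState.
Context (R : realType) (d : measure_display) (T : measurableType d).
Variables (P : probability T R) (rho : nat -> R) (a : nat -> nat -> {RV P >-> R}).
Hypothesis rho0 : rho 0%N = 1.
Hypothesis indep : mutually_independent P
  [set ij : nat * nat | (ij.1 <= ij.2)%N] (entry_sigma a).
Hypothesis mean0 : forall i j, ('E_P[a i j] = 0)%E.
Hypothesis var1 : forall i j, ('E_P[(fun t => a i j t ^+ 2)%R] = 1)%E.
Hypothesis moments : forall q : nat, exists M : R, forall i j,
  ('E_P[(fun t => `|a i j t| ^+ q)%R] <= M%:E)%E.
Hypothesis covar : forall i j, i != j ->
  ('E_P[(fun t => a i j t * a j i t)%R] = (rho `|i%:Z - j%:Z|%N)%:E)%E.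

(** The matrices are real, so taking adjoints is transposing. *)
Lemma real_mx_word_star w n t :
  real_mx_word a (word_star negb w) n t = (real_mx_word a w n t)^T.
Proof.
elim: w => [|b w IH]; first by rewrite /real_mx_word !big_nil trmx1.
rewrite -cat1s word_star_cat {1}/real_mx_word big_cat -/(real_mx_word _ _ _ _) IH.
rewrite big_seq1 /real_mx_word big_cons [X in _ = X^T]/(_ *m _) trmx_mul.
by congr (_ *m _); case: b; rewrite /= ?trmxK.
Qed.

Lemma word_moment_star w n : word_moment a (word_star negb w) n = word_moment a w n.
Proof.
rewrite /word_moment; congr (_ * Ex P _); apply/funext => t.
by rewrite real_mx_word_star mxtrace_tr.
Qed.

Lemma trace_has_moments w n : has_moments P (fun t => \tr (real_mx_word a w n t)).
Proof.
case: w => [|b w].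
  rewrite /real_mx_word; under boolp.eq_fun do rewrite big_nil; exact: has_moments_cst.
rewrite (_ : (fun t => _) = (fun t => (Num.sqrt n%:R ^+ size (b :: w))^-1 *
    \sum_(i : {ffun 'I_(size (b :: w)) -> 'I_n})
      \prod_k letter a (@word_eps (b :: w) (size (b :: w))) i k t)).
  apply: has_momentsZ; apply: has_moments_sum => i.
  by apply: has_moments_prod; apply: letter_has_moments.
by apply/funext => t; exact: tr_real_mx_word.
Qed.

(** The sum is the normalised expected trace of M^T M, where M is the combination
    of the words with coefficients [c]. *)
Lemma word_moment_ge0 n (s : seq (seq bool)) (c : seq bool -> R) :
  0 <= \sum_(u <- s) \sum_(v <- s) c u * c v * word_moment a (word_star negb u ++ v) n.
Proof.
pose M t := \sum_(u <- s) c u *: real_mx_word a u n t.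
have -> : \sum_(u <- s) \sum_(v <- s) c u * c v * word_moment a (word_star negb u ++ v) n =
    n%:R^-1 * Ex P (fun t => \tr ((M t)^T *m M t)).
  have -> : (fun t => \tr ((M t)^T *m M t)) = (fun t => \sum_(u <- s) \sum_(v <- s)
      c u * c v * \tr (real_mx_word a (word_star negb u ++ v) n t)).
    apply/funext => t; rewrite /M [(\sum_(u <- s) _)^T]raddf_sum /= mulmx_suml raddf_sum.
    apply: eq_bigr => u _; rewrite mulmx_sumr raddf_sum; apply: eq_bigr => v _ /=.
    have -> : (c u *: real_mx_word a u n t)^T = c u *: (real_mx_word a u n t)^T.
      exact: linearZ.
    rewrite -scalemxAl -scalemxAr !mxtraceZ mulrA; congr (_ * \tr _).
    by rewrite -real_mx_word_star /real_mx_word big_cat.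
  have h c' w := has_momentsZ c' (trace_has_moments w n).
  rewrite Ex_sum; last by move=> u; apply: has_moments_sum => v; exact: h.
  rewrite mulr_sumr; apply: eq_bigr => u _.
  rewrite Ex_sum ?mulr_sumr; last by move=> v; exact: h.
  apply: eq_bigr => v _; rewrite ExZ; last exact: trace_has_moments.
  by rewrite mulrCA.
rewrite mulr_ge0 ?invr_ge0 //; apply: Rintegral_ge0 => t _.
rewrite /mxtrace sumr_ge0 // => x _; rewrite mxE sumr_ge0 // => y _.
by rewrite mxE -expr2 sqr_ge0.
Qed.

Lemma word_moment_nil_cvg : word_moment a [::] @ \oo --> (1 : R).
Proof.
apply/cvgrPdist_lt => e e0; near=> n; rewrite word_moment_nil ?subrr ?normr0 //.
by near: n; exact: nbhs_infty_gt.
Unshelve. all: by end_near. Qed.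

Lemma word_moment_even_cvg w k (l : {set {set 'I_k.*2}} -> R) :
  size w = k.*2 -> (0 < k)%N ->
  (forall sigma, NC2 sigma -> pairing_sum rho (@word_eps w k.*2) sigma @ \oo --> l sigma) ->
  word_moment a w @ \oo --> \sum_(sigma in @NC2s k.*2) l sigma.
Proof.
move=> wk k0 hl.
have := word_moment_even rho0 indep mean0 var1 moments covar wk k0.
have c2 : (fun n => \sum_(sigma in @NC2s k.*2) pairing_sum rho (@word_eps w k.*2) sigma n)
    @ \oo --> \sum_(sigma in @NC2s k.*2) l sigma.
  by apply: cvg_sum => sigma /asboolP; exact: hl.
move=> c1; have c3 := cvgD c1 c2; rewrite add0r in c3.
have <- : (fun n => word_moment a w n - \sum_(sigma in @NC2s k.*2)
     pairing_sum rho (@word_eps w k.*2) sigma n + \sum_(sigma in @NC2s k.*2)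
     pairing_sum rho (@word_eps w k.*2) sigma n) = word_moment a w.
  by apply/funext => n; rewrite subrK.
exact: c3.
Qed.

Lemma word_moment_cvg : pairing_limits_exist rho ->
  forall w, exists l : R, word_moment a w @ \oo --> l.
Proof.
move=> hl w; case: w => [|b w]; first by exists 1; exact: word_moment_nil_cvg.
have := odd_double_half (size (b :: w)); case: odd => /esym wk.
  by exists 0; exact: (word_moment_odd indep mean0 moments wk).
have k0 : (0 < (size (b :: w))./2)%N by case: w wk.
have hc (sigma : {set {set 'I_(size (b :: w))./2.*2}}) : exists l : R, NC2 sigma ->
    pairing_sum rho (@word_eps (b :: w) _) sigma @ \oo --> l.
  have [nc|nnc] := pselect (NC2 sigma); last by exists 0.
  by have [l ?] := hl _ k0 (@word_eps (b :: w) _) sigma nc; exists l.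
exists (\sum_(sigma in @NC2s (size (b :: w))./2.*2) projT1 (cid (hc sigma))).
apply: (word_moment_even_cvg wk k0) => sigma nc.
exact: (projT2 (cid (hc sigma)) nc).
Qed.

Lemma cvg_stardist_of_moments (A : ncps R) (x : A) :
  (forall w, exists2 l : R, word_moment a w @ \oo --> l & state (star_word w x) = l%:C%C) ->
  cvg_stardist_to P (scaled_mx a) x.
Proof.
move=> h w; have [l cl ->] := h w.
under boolp.eq_fun do rewrite mx_state_word; exact: cvg_real_complex.
Qed.

Lemma cvg_stardist_limits : pairing_limits_exist rho -> cvg_stardist P (scaled_mx a).
Proof.
move=> hl; have hc := word_moment_cvg hl.
pose mu w := projT1 (cid (hc w)); have muP w : word_moment a w @ \oo --> mu w.
  exact: projT2 (cid (hc w)).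
have mu1 : mu [::] = 1 by apply: cvg_unique (muP [::]) word_moment_nil_cvg.
have mus w : mu (word_star negb w) = mu w.
  have := muP (word_star negb w).
  have -> : word_moment a (word_star negb w) = word_moment a w.
    by apply/funext => n; exact: word_moment_star.
  by move=> h; apply: cvg_unique h (muP w).
have mu0 (s : seq (seq bool)) (c : seq bool -> R) :
    0 <= \sum_(u <- s) \sum_(v <- s) c u * c v * mu (word_star negb u ++ v).
  have c1 : (fun n => \sum_(u <- s) \sum_(v <- s) c u * c v *
      word_moment a (word_star negb u ++ v) n) @ \oo -->
      \sum_(u <- s) \sum_(v <- s) c u * c v * mu (word_star negb u ++ v).
    apply: cvg_sum => u _; apply: cvg_sum => v _.
    by apply: cvgM; [exact: cvg_cst|exact: muP].
  by apply: (cvgr_to_ge c1); apply: nearW => n; exact: word_moment_ge0.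
pose A := word_ncps negbK mu1 mus mu0.
pose x : A := word_gen negbK mu1 mus mu0 false.
exists A, x; apply: cvg_stardist_of_moments => w; exists (mu w); first exact: muP.
rewrite -(state_word_gen negbK mu1 mus mu0 w); congr (state _).
apply: eq_bigr => -[] _ //; exact: star_word_gen.
Qed.

End LimitState.

(** * Field operators and the Wick formula *)

Section FieldOperators.
Variable K : comPzRingType.
Implicit Types (f : seq bool -> K) (h : bool -> K).

(** The full Fock space over K^2 has the words in two letters as a basis; vectors
    are given by their coordinates.  Finite support is not required, since the
    coordinates of the images below involve finitely many coordinates each. *)
Definition vacuum : seq bool -> K := fun x => (x == [::])%:R.

Definition creation h f : seq bool -> K :=
  fun x => if x is b :: y then h b * f y else 0.

Definition annihilation h f : seq bool -> K := fun x => \sum_b h b * f (b :: x).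

Definition field_op h f : seq bool -> K := fun x => creation h f x + annihilation h f x.

Definition fields (hs : seq (bool -> K)) f := foldr field_op f hs.

Section Wick.
Variable h : nat -> bool -> K.

Definition cov (r s : nat) : K := \sum_b h r b * h s b.

Definition tensor (st : seq nat) : seq bool -> K :=
  foldr (fun s => creation (h s)) vacuum st.

(** A field operator either adds a tensor factor or contracts with the first
    one. *)
Lemma field_tensor t st x : field_op (h t) (tensor st) x = tensor (t :: st) x +
  (if st is s :: st' then cov t s * tensor st' x else 0).
Proof.
rewrite /field_op; congr (_ + _); rewrite /annihilation.
case: st => [|s st] /=; first by rewrite big1 // => b _; rewrite /vacuum mulr0.
by rewrite /cov mulr_suml; apply: eq_bigr => b _; rewrite mulrA.
Qed.

(** Expanding the product of the fields t, t+1, ... from right to left, a field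
    is either pushed on a stack of pending creations or, as an annihilation,
    contracted with the top of the stack.  A state of this process is the list of
    contractions already made together with the stack. *)
Definition run_step t (c : seq (nat * nat) * seq nat) : seq (seq (nat * nat) * seq nat) :=
  (c.1, t :: c.2) :: (if c.2 is s :: st then [:: ((t, s) :: c.1, st)] else [::]).

Fixpoint runs k t : seq (seq (nat * nat) * seq nat) :=
  if k is k'.+1 then flatten [seq run_step t c | c <- runs k' t.+1]
  else [:: ([::], [::])].

Lemma fields_runs k t x : fields [seq h s | s <- iota t k] vacuum x =
  \sum_(c <- runs k t) (\prod_(p <- c.1) cov p.1 p.2) * tensor c.2 x.
Proof.
elim: k t x => [|k IH] t x; first by rewrite /= big_seq1 big_nil mul1r.
rewrite /= big_flatten big_map.
have -> : fields [seq h s | s <- iota t.+1 k] vacuum = fun y =>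
    \sum_(c <- runs k t.+1) (\prod_(p <- c.1) cov p.1 p.2) * tensor c.2 y.
  by apply/funext => y; exact: IH.
rewrite {IH}; elim: (runs k t.+1) x => [|c cs IH] x.
  rewrite big_nil /field_op /annihilation /creation; under eq_bigr do rewrite big_nil mulr0.
  by rewrite big1 // addr0; case: x => // b y; rewrite big_nil mulr0.
rewrite big_cons -IH.
have -> : \sum_(c' <- run_step t c) (\prod_(p <- c'.1) cov p.1 p.2) * tensor c'.2 x =
   (\prod_(p <- c.1) cov p.1 p.2) * field_op (h t) (tensor c.2) x.
  rewrite field_tensor /run_step big_cons /= mulrDr; congr (_ + _).
  case: (c.2) => [|s st]; first by rewrite big_nil mulr0.
  by rewrite big_seq1 /= big_cons mulrCA mulrA.
rewrite /field_op mulrDr /= addrACA; congr (_ + _).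
  by rewrite /creation; case: x => [|b y]; rewrite ?mulr0 ?addr0 // big_cons mulrDr mulrCA.
rewrite /annihilation mulr_sumr -big_split; apply: eq_bigr => b _ /=.
by rewrite big_cons mulrDr mulrCA.
Qed.

Lemma fields_vacuum_state m : fields [seq h s | s <- iota 0 m] vacuum [::] =
  \sum_(c <- runs m 0 | c.2 == [::]) \prod_(p <- c.1) cov p.1 p.2.
Proof.
rewrite fields_runs [RHS]big_mkcond; apply: eq_bigr => c _.
by case: (c.2) => [|s st] /=; rewrite /vacuum ?eqxx ?mulr1 ?mulr0.
Qed.

End Wick.
End FieldOperators.

Section Runs.
Implicit Types (P : seq (nat * nat)) (st : seq nat).

(** Characterises the outcomes of the process by their shape alone: a partial
    non-crossing pairing of t, ..., t+k-1 in which no pair encloses a pending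
    position.  The first components and the stack are increasing, which makes the
    encoding by lists unique. *)
Record valid_run k t P st : Prop := ValidRun {
  run_perm : perm_eq (unzip1 P ++ unzip2 P ++ st) (iota t k);
  run_lt : forall p : nat * nat, p \in P -> (p.1 < p.2)%N;
  run_sorted1 : sorted ltn (unzip1 P);
  run_sorted2 : sorted ltn st;
  run_nc : forall p q : nat * nat, p \in P -> q \in P -> ~ [/\ p.1 < q.1, q.1 < p.2 & p.2 < q.2]%N;
  run_uncovered : forall (p : nat * nat) (q : nat), p \in P -> q \in st -> ~ (p.1 < q < p.2)%N }.

(** Both directions follow the position [t]: if it is pending it is the top of the
    stack, being the smallest position; otherwise it opens a pair, whose closer was
    on top of the stack because the pair encloses no pending position. *)
Lemma runsP k t P st : reflect (valid_run k t P st) ((P, st) \in runs k t).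
Proof.
apply: (iffP idP).
  elim: k t P st => [|k IH] t P st /=.
    by rewrite inE => /eqP[-> ->]; split.
  case/flatten_mapP => -[P' st'] /IH[pe lt s1 s2 nc un].
  have ge (x : nat) : x \in unzip1 P' ++ unzip2 P' ++ st' -> (t < x)%N.
    by rewrite (perm_mem pe) mem_iota => /andP[].
  have geP (p : nat * nat) : p \in P' -> (t < p.1)%N.
    by move=> h; apply: ge; rewrite mem_cat map_f.
  have gest (q : nat) : q \in st' -> (t < q)%N.
    by move=> h; apply: ge; rewrite !mem_cat h !orbT.
  rewrite /run_step /= inE => /orP[/eqP[-> ->]|].
    split=> //.
    - by rewrite catA -[t :: st']cat1s perm_catCA /= perm_cons -catA.
    - by rewrite /= path_min_sorted // ; apply/allP => q /gest.
    - move=> p q pP; rewrite inE => /predU1P[->|/(un _ _ pP)//].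
      by have := geP _ pP; lia.
  case: st' pe s2 un ge gest => [//|s st'] pe s2 un ge gest.
  rewrite inE => /eqP[-> ->]; have ts : (t < s)%N by apply: gest; rewrite mem_head.
  have sst (q : nat) : q \in st' -> (s < q)%N.
    by move: s2; rewrite /= path_sortedE => [/andP[/allP h _] /h//|]; exact: ltn_trans.
  split=> [|p||||].
  - rewrite /= perm_cons; apply: perm_trans pe; rewrite perm_cat2l.
    by rewrite perm_sym -[s :: st']cat1s perm_catCA perm_refl.
  - by rewrite inE => /predU1P[->//|/lt].
  - by rewrite /= path_min_sorted //; apply/allP => _ /mapP[p pP ->]; exact: geP.
  - by move: s2 => /= /path_sorted.
  - move=> p q; rewrite !inE => /predU1P[->|pP] /predU1P[->|qP] /= [a b c].
    + by lia.
    + by apply: (un q s) => //; rewrite ?mem_head // b c.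
    + by have := geP _ pP; lia.
    + exact: (nc p q).
  - move=> p q; rewrite inE => /predU1P[-> /sst /=|pP qst]; first by lia.
    by apply: un => //; rewrite inE qst orbT.
elim: k t P st => [|k IH] t P st [pe lt s1 s2 nc un].
  have /eqP : size (unzip1 P ++ unzip2 P ++ st) = 0%N by rewrite (perm_size pe).
  rewrite !size_cat !addn_eq0 !size_map size_eq0 => /and3P[/eqP-> _].
  by rewrite size_eq0 => /eqP->.
have ge (x : nat) : x \in unzip1 P ++ unzip2 P ++ st -> (t <= x)%N.
  by rewrite (perm_mem pe) mem_iota => /andP[].
have geP (p : nat * nat) : p \in P -> (t <= p.1)%N.
  by move=> h; apply: ge; rewrite mem_cat map_f.
have gest (q : nat) : q \in st -> (t <= q)%N.
  by move=> h; apply: ge; rewrite !mem_cat h !orbT.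
have un0 : uniq (unzip1 P ++ unzip2 P ++ st) by rewrite (perm_uniq pe) iota_uniq.
have : t \in unzip1 P ++ unzip2 P ++ st by rewrite (perm_mem pe) mem_iota leqnn /= -addSnnS leq_addr.
rewrite !mem_cat => /or3P[t1|t2|t3].
- case: P pe lt s1 nc un ge geP un0 t1 => [//|[r s] P] pe lt s1 nc un ge geP un0 t1.
  have rt : r = t.
    have rr : (t <= r)%N by apply: (geP (r, s)); rewrite mem_head.
    move: t1; rewrite inE => /predU1P[//|tP].
    have := s1; rewrite /= path_sortedE; last exact: ltn_trans.
    by case/andP => /allP/(_ _ tP); lia.
  subst r; have ts : (t < s)%N by apply: (lt (t, s)); rewrite mem_head.
  apply/flatten_mapP; exists (P, s :: st); last by rewrite /run_step /= !inE eqxx orbT.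
  have gtP (p : nat * nat) : p \in P -> (t < p.1)%N.
    move=> pP; have := s1; rewrite /= path_sortedE; last exact: ltn_trans.
    by case/andP => /allP/(_ _ (map_f _ pP)).
  apply: IH; split.
  + have := pe; rewrite /= perm_cons; apply: perm_trans.
    rewrite perm_cat2l -[s :: st]cat1s perm_catCA perm_refl //.
  + by move=> p pP; apply: lt; rewrite inE pP orbT.
  + by move: s1 => /= /path_sorted.
  + rewrite /= path_min_sorted //; apply/allP => q qst /=.
    have := gest _ qst; have := un (t, s) q (mem_head _ _) qst => /= h1 h2.
    have tq : q <> t.
      by move=> e; move: un0; rewrite /= !(mem_cat, inE) -e qst !orbT.
    have sq : q <> s.
      move=> e; move: un0 => /= /andP[_]; rewrite cat_uniq => /and3P[_ _] /=.
      by rewrite -e mem_cat qst orbT.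
    by lia.
  + by move=> p q pP qP; apply: nc; rewrite inE ?pP ?qP orbT.
  + move=> p q pP; rewrite inE => /predU1P[->|qst] /andP[a b].
      apply: (nc (t, s) p); rewrite ?mem_head //; first by rewrite inE pP orbT.
      by split=> //=; exact: gtP.
    by apply: (un p q) => //; [rewrite inE pP orbT|rewrite a b].
- case/mapP: t2 => p pP tE; have := geP p pP; have := lt p pP; rewrite -tE; lia.
- case: st pe s2 un ge gest un0 t3 => [//|q st] pe s2 un ge gest un0 t3.
  have qt : q = t.
    have qq : (t <= q)%N by apply: gest; rewrite mem_head.
    move: t3; rewrite inE => /predU1P[//|tP].
    have := s2; rewrite /= path_sortedE; last exact: ltn_trans.
    by case/andP => /allP/(_ _ tP); lia.
  subst q; apply/flatten_mapP; exists (P, st); last by rewrite /run_step /= inE eqxx.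
  apply: IH; split=> //.
  + by have := pe; rewrite catA -[t :: st]cat1s perm_catCA /= perm_cons -catA.
  + by move: s2 => /= /path_sorted.
  + by move=> p q pP qst; apply: un => //; rewrite inE qst orbT.
Qed.

(** A left inverse of [run_step] on the outcomes of later positions: the last move
    was a push if and only if [t] is on top of the stack. *)
Definition run_undo t (c : seq (nat * nat) * seq nat) : seq (nat * nat) * seq nat :=
  if head t.+1 c.2 == t then (c.1, behead c.2)
  else (behead c.1, (head (0, 0) c.1).2 :: c.2)%N.

Lemma runs_uniq k t : uniq (runs k t).
Proof.
elim: k t => //= k IH t; have := IH t.+1.
have undo c c' : c \in runs k t.+1 -> c' \in run_step t c -> run_undo t c' = c.
  case: c => P st /runsP[pe _ _ s2 _ _].
  have ge (x : nat) : x \in unzip1 P ++ unzip2 P ++ st -> (t < x)%N.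
    by rewrite (perm_mem pe) mem_iota => /andP[].
  rewrite /run_step /= inE => /predU1P[->|]; first by rewrite /run_undo /= eqxx.
  case: st pe s2 ge => // s st pe s2 ge; rewrite inE => /eqP->; rewrite /run_undo /=.
  case: st pe s2 ge => [|s' st] pe s2 ge /=; first by rewrite gtn_eqF.
  have := ge s'; rewrite !mem_cat !inE eqxx !orbT => /(_ isT) h.
  by rewrite gtn_eqF.
elim: (runs k t.+1) undo => [//|c cs IHc] undo; rewrite cons_uniq => /andP[nc ucs].
have -> : flatten [seq run_step t c' | c' <- c :: cs] =
    run_step t c ++ flatten [seq run_step t c' | c' <- cs] by [].
rewrite cat_uniq IHc ?andbT //; last by move=> c1 c2 h; apply: undo; rewrite inE h orbT.
apply/andP; split.
  case: c {undo nc} => P [|s st]; first by [].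
  rewrite /run_step cons_uniq mem_seq1 andbT.
  by apply/eqP => -[_ /(congr1 size)] /=; lia.
apply/hasPn => c' /flatten_mapP[c1 hc1 h1]; apply/negP => h2.
have e1 := undo c1 c' ltac:(by rewrite inE hc1 orbT) h1.
have e2 := undo c c' (mem_head _ _) h2.
by rewrite -e2 e1 hc1 in nc.
Qed.

Lemma uniq_map_inj_in (T1 T2 : eqType) (f : T1 -> T2) (s : seq T1) :
  uniq (map f s) -> {in s &, injective f}.
Proof.
elim: s => //= x s IH /andP[nx us] y z; rewrite !inE.
move=> /predU1P[->|ys] /predU1P[->|zs] e //; last exact: IH.
  by rewrite e map_f in nx.
by rewrite -e map_f in nx.
Qed.

Section RunsOfPairings.
Variable m : nat.
Implicit Types (sigma : {set {set 'I_m}}) (r s : 'I_m).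

Definition opening_seq sigma : seq 'I_m := [seq r : 'I_m <- enum 'I_m | (r < mate sigma r)%N].

Definition pairs_of sigma : seq (nat * nat) :=
  [seq (val r, val (mate sigma r)) | r <- opening_seq sigma].

Lemma pairs_of_run sigma : NC2 sigma -> (pairs_of sigma, [::]) \in runs m 0.
Proof.
move=> nc; apply/runsP.
have u1 : unzip1 (pairs_of sigma) = map val (opening_seq sigma).
  by rewrite /unzip1 -map_comp.
have u2 : unzip2 (pairs_of sigma) = map val (map (mate sigma) (opening_seq sigma)).
  by rewrite /unzip2 -!map_comp.
split=> //.
- rewrite cats0 u1 u2 -map_cat -val_enum_ord; apply: perm_map.
  apply: perm_trans (permEl (perm_filterC (fun r : 'I_m => (r < mate sigma r)%N) (enum 'I_m))).
  rewrite perm_cat2l; apply: uniq_perm.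
  + by rewrite (map_inj_uniq (can_inj (mateK nc))) filter_uniq ?enum_uniq.
  + by rewrite filter_uniq ?enum_uniq.
  move=> r; rewrite mem_filter mem_enum andbT /= -leqNgt.
  apply/mapP/idP => [[s]|h].
    by rewrite mem_filter => /andP[h _] ->; rewrite mateK // ltnW.
  exists (mate sigma r); last by rewrite mateK.
  rewrite mem_filter mem_enum andbT mateK // ltn_neqAle h andbT.
  by apply/eqP => /val_inj/(mate_neq nc).
- by move=> p /mapP[r]; rewrite mem_filter => /andP[h _] ->.
- rewrite u1; have : subseq (map val (opening_seq sigma)) (iota 0 m).
    by rewrite -val_enum_ord map_subseq ?filter_subseq.
  by move/subseq_sorted; apply; [exact: ltn_trans|exact: iota_ltn_sorted].
- move=> p q /mapP[r _ ->] /mapP[s _ ->] /=; exact: mate_noncrossing.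
Qed.

Lemma pairs_of_inj sigma tau : NC2 sigma -> NC2 tau ->
  pairs_of sigma = pairs_of tau -> sigma = tau.
Proof.
move=> ns nt e; apply: (NC2_sub_eq ns nt) => r s h.
have half (x y : 'I_m) : (x < y)%N -> [set x; y]%SET \in sigma -> [set x; y]%SET \in tau.
  move=> xy hxy; have : (val x, val y) \in pairs_of tau.
    rewrite -e; apply/mapP; exists x; last by rewrite (mate_unique ns hxy).
    by rewrite mem_filter mem_enum andbT (mate_unique ns hxy).
  by case/mapP => z _ [/val_inj-> /val_inj->]; exact: mateP.
case: (ltngtP r s) => [rs|sr|/val_inj rs]; first exact: half.
  by rewrite finset.setUC; apply: half => //; rewrite finset.setUC.
by case: (NC2_neq ns h).
Qed.

Lemma run_pairs_of P : (P, [::]) \in runs m 0 ->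
  exists2 sigma, NC2 sigma & pairs_of sigma = P.
Proof.
case/runsP; rewrite cats0 => pe lt s1 _ nc _.
have un : uniq (unzip1 P ++ unzip2 P) by rewrite (perm_uniq pe) iota_uniq.
have [un1 dj un2] : [/\ uniq (unzip1 P), forall x, x \in unzip1 P -> x \in unzip2 P -> False
    & uniq (unzip2 P)].
  move: un; rewrite cat_uniq => /and3P[? /hasPn h ?]; split=> // x hx /h /negP; exact.
have memP x : (x < m)%N -> (x \in unzip1 P) || (x \in unzip2 P).
  by move=> h; rewrite -mem_cat (perm_mem pe) mem_iota.
have link (x : 'I_m) : exists y : 'I_m, ((val x, val y) \in P) || ((val y, val x) \in P).
  have lt_m y : y \in unzip1 P ++ unzip2 P -> (y < m)%N.
    by rewrite (perm_mem pe) mem_iota.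
  case/orP: (memP x (ltn_ord x)) => /mapP[[u v] uvP /= xE].
    have vm : (v < m)%N by apply: lt_m; rewrite mem_cat (map_f snd uvP) orbT.
    by exists (Ordinal vm); rewrite xE uvP.
  have um : (u < m)%N by apply: lt_m; rewrite mem_cat (map_f fst uvP).
  by exists (Ordinal um); rewrite xE /= uvP orbT.
pose f x := projT1 (cid (link x)).
have fP x : ((val x, val (f x)) \in P) || ((val (f x), val x) \in P).
  exact: projT2 (cid (link x)).
have inj1 := uniq_map_inj_in un1; have inj2 := uniq_map_inj_in un2.
have fst_snd u v v' : (u, v) \in P -> (v', u) \in P -> False.
  by move=> h1 h2; apply: (dj u); [exact: (map_f fst h1)|exact: (map_f snd h2)].
have fE x y : ((val x, val y) \in P) || ((val y, val x) \in P) -> y = f x.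
  move=> hy; apply/val_inj; have := fP x.
  move=> /orP[h1|h1]; case/orP: hy => h2.
  - by case: (inj1 _ _ h2 h1 erefl).
  - by case: (fst_snd _ _ _ h1 h2).
  - by case: (fst_snd _ _ _ h2 h1).
  - by case: (inj2 _ _ h2 h1 erefl).
have fK : involutive f by move=> x; apply/esym/fE; rewrite orbC.
have fne x : f x <> x.
  by move=> e; have := fP x; rewrite e orbb => /lt; rewrite ltnn.
have fopen (x : 'I_m) : (x < f x)%N = ((val x, val (f x)) \in P).
  have := fP x; case: (boolP (_ \in P)) => [/lt->//|_ /= /lt /= h].
  by rewrite ltnNge ltnW.
exists (involution_blocks f).
  apply: NC2_involution => // q r qr rq fqr.
  have hq : (val q, val (f q)) \in P by rewrite -fopen (ltn_trans qr rq).
  have hr : (val r, val (f r)) \in P by rewrite -fopen (ltn_trans rq fqr).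
  exact: (nc _ _ hq hr).
have nf : NC2 (involution_blocks f).
  apply: NC2_involution => // q r qr rq fqr.
  have hq : (val q, val (f q)) \in P by rewrite -fopen (ltn_trans qr rq).
  have hr : (val r, val (f r)) \in P by rewrite -fopen (ltn_trans rq fqr).
  exact: (nc _ _ hq hr).
have mE x : mate (involution_blocks f) x = f x.
  by apply: (mate_unique nf); rewrite involution_blocksE.
have memE p : (p \in pairs_of (involution_blocks f)) = (p \in P).
  apply/mapP/idP => [[x]|hp].
    by rewrite mem_filter mE => /andP[h _] ->; rewrite -fopen.
  have lt_m y : y \in unzip1 P ++ unzip2 P -> (y < m)%N.
    by rewrite (perm_mem pe) mem_iota.
  case: p hp => u v uvP.
  have um : (u < m)%N by apply: lt_m; rewrite mem_cat (map_f fst uvP).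
  have vm : (v < m)%N by apply: lt_m; rewrite mem_cat (map_f snd uvP) orbT.
  have e : Ordinal vm = f (Ordinal um) by apply: fE; rewrite /= uvP.
  exists (Ordinal um); last by rewrite mE -e.
  by rewrite mem_filter mem_enum andbT mE -e /=; exact: (lt _ uvP).
have s2 : sorted ltn (unzip1 (pairs_of (involution_blocks f))).
  by have /runsP[] := pairs_of_run nf.
have sort_pairs (Q : seq (nat * nat)) : sorted ltn (unzip1 Q) -> sorted (relpre fst ltn) Q.
  by rewrite sorted_map.
have tr : transitive (relpre (@fst nat nat) ltn) by move=> x y z; exact: ltn_trans.
have ir : irreflexive (relpre (@fst nat nat) ltn) by move=> x; exact: ltnn.
exact: (irr_sorted_eq tr ir (sort_pairs _ s2) (sort_pairs _ s1) memE).
Qed.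

(** An empty stack means that all positions are paired, so that [valid_run]
    becomes the description of a non-crossing pair partition. *)
Lemma sum_runs (K : comPzRingType) (F : seq (nat * nat) -> K) :
  \sum_(c <- runs m 0 | c.2 == [::]) F c.1 = \sum_(sigma in @NC2s m) F (pairs_of sigma).
Proof.
rewrite -big_filter.
have pe : perm_eq [seq c <- runs m 0 | c.2 == [::]]
    [seq (pairs_of sigma, [::]) | sigma <- enum (@NC2s m)].
  apply: uniq_perm; first by rewrite filter_uniq ?runs_uniq.
    rewrite map_inj_in_uniq ?enum_uniq // => s t.
    by rewrite !mem_enum => /asboolP ns /asboolP nt [] /(pairs_of_inj ns nt).
  move=> [P st]; rewrite mem_filter /=; apply/andP/mapP => [[/eqP-> /run_pairs_of[s ns <-]]|].
    by exists s => //; rewrite mem_enum; apply/asboolP.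
  by case=> s; rewrite mem_enum => /asboolP ns [-> ->]; split=> //; exact: pairs_of_run.
by rewrite (perm_big _ pe) big_map big_enum.
Qed.

Lemma prod_pairs_of (K : comPzRingType) sigma (F : nat -> nat -> K) : NC2 sigma ->
  \prod_(p <- pairs_of sigma) F p.1 p.2 =
  \prod_(r < m) \prod_(s < m | (r < s)%N && ([set r; s]%SET \in sigma)) F r s.
Proof.
move=> nc; rewrite big_map big_filter big_enum_cond big_mkcond /=.
apply: eq_bigr => r _; case: ifP => h.
  rewrite (big_pred1 (mate sigma r)) // => s.
  apply/andP/eqP => [[_ /(mate_unique nc)->//]|->]; split=> //; exact: mateP.
rewrite big_pred0 // => s; apply/negP => /andP[rs /(mate_unique nc) e].
by rewrite e rs in h.
Qed.

End RunsOfPairings.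
End Runs.

(** Only the runs with an empty stack have a component on the vacuum. *)
Lemma wick (K : comPzRingType) (h : nat -> bool -> K) m :
  fields [seq h s | s <- iota 0 m] (@vacuum K) [::] =
  \sum_(sigma in @NC2s m) \prod_(r < m)
    \prod_(s < m | (r < s)%N && ([set r; s]%SET \in sigma)) cov h r s.
Proof.
rewrite fields_vacuum_state.
rewrite (sum_runs m (fun P => \prod_(p <- P) cov h p.1 p.2)).
by apply: eq_bigr => sigma /asboolP nc; rewrite (prod_pairs_of (cov h)).
Qed.

(** * Moments of the semicircle law *)

Section Ballot.

(** Counts the nonnegative lattice paths from 0 to [j] with [p] steps up or
    down. *)
Fixpoint ballot p j : nat :=
  if p is p'.+1 then ((if j is j'.+1 then ballot p' j' else 0) + ballot p' j.+1)%N
  else (j == 0)%N.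

Lemma ballot_gt p j : (p < j)%N -> ballot p j = 0%N.
Proof.
elim: p j => [|p IH] [|j] //= pj; by rewrite !IH //; lia.
Qed.

Lemma ballot_odd p j : odd (p + j) -> ballot p j = 0%N.
Proof.
elim: p j => [|p IH] [|j] //= h; rewrite !IH //; move: h; rewrite ?addnS ?addSn ?addn0 /= ?negbK //.
Qed.

(** The closed form given by the reflection principle, written without
    subtraction. *)
Lemma ballot_bin q j : (ballot (q.*2 + j) j +
  (if q is q'.+1 then 'C(q.*2 + j, q') else 0) = 'C(q.*2 + j, q))%N.
Proof.
have [n e] : exists n, n = (q.*2 + j)%N by eexists.
elim: n q j e => [|n IH] q j e; first by case: q e => [|q]; case: j.
case: q e => [|q] e.
  case: j e => // j e; have nj : n = j by lia.
  subst n; rewrite double0 add0n addn0 bin0 /= (@ballot_gt j j.+2) // addn0.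
  by have := IH 0%N j; rewrite bin0 addn0 double0 add0n; apply.
rewrite -e; have IH2 : (ballot n j.+1 + (if q is q'.+1 then 'C(n, q') else 0) = 'C(n, q))%N.
  by have := IH q j.+1; rewrite (_ : (q.*2 + j.+1)%N = n) //; [apply|]; lia.
case: j e IH2 => [|j] e IH2 /=.
  have sym : 'C(n, q.+1) = 'C(n, q).
    rewrite -(@bin_sub n q.+1); last by lia.
    by rewrite (_ : (n - q.+1)%N = q) //; lia.
  by rewrite add0n binS sym; case: q {sym e} IH2 => [|q] IH2; rewrite ?bin0 ?binS; move: IH2; rewrite ?bin0; lia.
have IH1 : (ballot n j + 'C(n, q) = 'C(n, q.+1))%N by have := IH q.+1 j; rewrite (_ : (q.+1.*2 + j)%N = n) //; [apply|]; lia.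
by rewrite !binS; case: q {e} IH1 IH2 => [|q]; rewrite ?bin0 ?binS; lia.
Qed.

Lemma ballot_central q : (q.+1 * ballot q.*2 0 = 'C(q.*2, q))%N.
Proof.
have := ballot_bin q 0; rewrite addn0; case: q => [|q]; first by rewrite bin0 addn0 mul1n.
have := mul_bin_left (q.+1.*2) q; rewrite (_ : (q.+1.*2 - q = q.+2)%N); last by lia.
by move: ('C(_, _)) ('C(_, _)) (ballot _ _) => x y z; nia.
Qed.

(** The recursion of the Catalan numbers, in the shape in which integration by
    parts produces it for the semicircle law. *)
Lemma ballot_rec p : ((p + 4) * ballot p.+2 0 = 4 * p.+1 * ballot p 0)%N.
Proof.
have [op|ep] := boolP (odd p).
  by rewrite !(@ballot_odd _ 0) ?muln0 // addn0 /= ?negbK.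
have [q ->] : exists q, p = q.*2 by exists p./2; rewrite -[LHS]odd_double_half (negPf ep).
have h1 := ballot_central q; have := ballot_central q.+1; rewrite doubleS => h2.
have c1 : 'C(q.*2.+2, q.+1) = (2 * 'C(q.*2.+1, q))%N.
  rewrite binS; have -> : 'C(q.*2.+1, q.+1) = 'C(q.*2.+1, q).
    rewrite -(@bin_sub q.*2.+1 q.+1); last by lia.
    by have -> : (q.*2.+1 - q.+1)%N = q by lia.
  by lia.
have c2 : (q.+1 * 'C(q.*2.+1, q) = q.*2.+1 * 'C(q.*2, q))%N.
  have := mul_bin_diag q.*2.+1 q; rewrite -pred_Sn => ->.
  rewrite -(@bin_sub q.*2.+1 q.+1); last by lia.
  by have -> : (q.*2.+1 - q.+1)%N = q by lia.
have c3 : (q.+1 * (q.+2 * ballot q.*2.+2 0) = q.+1 * (q.*2.+1 * 2 * ballot q.*2 0))%N.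
  by rewrite h2 c1 mulnCA c2 -h1; nia.
by move/eqP: c3; rewrite eqn_pmul2l // => /eqP; nia.
Qed.

End Ballot.

Section Semicircle.
Variable R : realType.
Local Notation mu := (@lebesgue_measure R).
Local Notation w := (fun t : R => Num.sqrt (4 - t ^+ 2)).

Lemma Rintegral_FTC (f F : R -> R) (a b : R) : a < b -> continuous f -> continuous F ->
  (forall x : R, a < x < b -> is_derive x (1 : R) F (f x)) ->
  \int[mu]_(x in `[a, b]) f x = F b - F a.
Proof.
move=> ab cf cF dF; rewrite /Rintegral (@continuous_FTC2 _ f F) //.
- exact: continuous_subspaceT.
- split.
  + by move=> x; rewrite in_itv => /= /dF [].
  + exact/cvg_at_right_filter/cF.
  + exact/cvg_at_left_filter/cF.
- by move=> x; rewrite in_itv => /= /dF dFx; rewrite derive1E derive_val.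
Qed.

Lemma semicircle_continuous : continuous w.
Proof.
move=> x; apply: (@continuous_comp _ _ _ (fun t : R => 4 - t ^+ 2) Num.sqrt).
  by apply: cvgB; [exact: cvg_cst|exact: exprn_continuous].
exact: sqrt_continuous.
Qed.

Lemma semicircle_moment_continuous p : continuous (fun t : R => t ^+ p * w t).
Proof.
by move=> x; apply: cvgM; [exact: exprn_continuous|exact: semicircle_continuous].
Qed.

Lemma semicircle_integrable p : mu.-integrable `[-2, 2] (EFin \o (fun t : R => t ^+ p * w t)).
Proof.
apply: continuous_compact_integrable; first exact: segment_compact.
exact/continuous_subspaceT/semicircle_moment_continuous.
Qed.

Lemma semicircle_derive (x : R) : -2 < x < 2 ->
  is_derive x (1 : R) (fun t => (4 - t ^+ 2) * w t) (- 3 * (x * w x)).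
Proof.
move=> /andP[x1 x2]; have p0 : 0 < 4 - x ^+ 2 by nra.
have dq : is_derive x (1 : R) (fun t : R => 4 - t ^+ 2) (- (2 * x)).
  by apply: is_derive_eq; rewrite /GRing.scale /=; ring.
have w0 : w x != 0 by rewrite sqrtr_eq0 -ltNge.
have dw : is_derive x (1 : R) w (- x / w x).
  have h := @is_derive1_comp _ Num.sqrt (fun t => 4 - t ^+ 2) x _ _ (is_derive1_sqrt p0) dq.
  by apply: (@is_derive_eq _ _ _ w _ _ _ _ h); field; rewrite w0.
have ww : 4 - x ^+ 2 = w x * w x by rewrite -expr2 sqr_sqrtr // ltW.
apply: is_derive_eq; rewrite /GRing.scale /= {1}ww.
by field; rewrite w0.
Qed.

(** The function t^(p+1) (4 - t^2)^(3/2) vanishes at both ends of the interval,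
    so the integral of its derivative relates the moments p and p+2. *)
Lemma semicircle_moment_derive p (x : R) : -2 < x < 2 ->
  is_derive x (1 : R) (fun t => t ^+ p.+1 * ((4 - t ^+ 2) * w t))
    (4 * p.+1%:R * (x ^+ p * w x) - (p + 4)%:R * (x ^+ p.+2 * w x)).
Proof.
move=> x2; have d := semicircle_derive x2.
have dX : is_derive x (1 : R) (fun t : R => t ^+ p.+1) (p.+1%:R * x ^+ p).
  have h := @is_deriveX _ _ id p.+1 x 1 1 (is_derive_id x 1).
  have -> : (fun t : R => t ^+ p.+1) = id ^+ p.+1 by apply/funext => t; rewrite exprfctE.
  by apply: (is_derive_eq h); rewrite /GRing.scale /= mulr1.
have h := @is_deriveM _ _ (fun t : R => t ^+ p.+1) (fun t : R => (4 - t ^+ 2) * w t) x 1 _ _ dX d.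
apply: (is_derive_eq h); rewrite /GRing.scale /= natrD -natr1 !exprS.
by ring.
Qed.

Definition semicircle_moment p : R :=
  (2 * pi)^-1 * \int[mu]_(t in `[(-2 : R), 2]) (t ^+ p * w t).

Lemma pow2_sub4 (x : R) : x = 2 \/ x = -2 -> 4 - x ^+ 2 = 0.
Proof. by case=> ->; ring. Qed.

Lemma semicircle_moment_rec p :
  (p + 4)%:R * semicircle_moment p.+2 = 4 * p.+1%:R * semicircle_moment p.
Proof.
have lt : -2 < 2 :> R by lra.
have cw := semicircle_moment_continuous.
have cF : continuous (fun t : R => t ^+ p.+1 * ((4 - t ^+ 2) * w t)).
  move=> x; apply: cvgM; first exact: exprn_continuous.
  apply: cvgM; last exact: semicircle_continuous.
  by apply: cvgB; [exact: cvg_cst|exact: exprn_continuous].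
have cf : continuous (fun t : R => 4 * p.+1%:R * (t ^+ p * w t) - (p + 4)%:R * (t ^+ p.+2 * w t)).
  by move=> x; apply: cvgB; apply: cvgM; [exact: cvg_cst|exact: cw|exact: cvg_cst|exact: cw].
have := Rintegral_FTC lt cf cF (fun x h => semicircle_moment_derive p h).
rewrite (pow2_sub4 (or_introl erefl)) (pow2_sub4 (or_intror erefl)) !mul0r !mulr0 subrr.
have iw q := semicircle_integrable q.
have iZ c q : mu.-integrable `[-2, 2] (EFin \o (fun t : R => c * (t ^+ q * w t))).
  apply: (@integrableZl _ _ _ mu `[-2, 2] _ c (EFin \o (fun t : R => t ^+ q * w t))) => //;
    first [exact: iw|exact: measurable_itv].
have mI : measurable (`[-2, 2] : set (measurableTypeR R)) by exact: measurable_itv.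
rewrite RintegralB ?RintegralZl // => e.
by rewrite /semicircle_moment mulrCA [RHS]mulrCA; congr (_ * _); apply/eqP; rewrite eq_sym -subr_eq0 e.
Qed.

Lemma semicircle_moment1 : semicircle_moment 1 = 0.
Proof.
have lt : -2 < 2 :> R by lra.
have cF : continuous (fun t : R => (4 - t ^+ 2) * w t).
  move=> x; apply: cvgM; last exact: semicircle_continuous.
  by apply: cvgB; [exact: cvg_cst|exact: exprn_continuous].
have cf : continuous (fun t : R => - 3 * (t * w t)).
  move=> x; apply: cvgM; first exact: cvg_cst.
  by apply: cvgM; [exact: cvg_id|exact: semicircle_continuous].
have := Rintegral_FTC lt cf cF semicircle_derive.
rewrite (pow2_sub4 (or_introl erefl)) (pow2_sub4 (or_intror erefl)) !mul0r subrr.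
rewrite RintegralZl //; last by have := semicircle_integrable 1.
rewrite /semicircle_moment => /eqP; rewrite mulf_eq0 oppr_eq0 pnatr_eq0 /= => /eqP e.
by under eq_Rintegral do rewrite expr1; rewrite e mulr0.
Qed.

(** The substitution t = 2 sin x turns the integrand into 4 (cos x)^2. *)
Lemma semicircle_moment0 : semicircle_moment 0 = 1.
Proof.
have pi0 : 0 < pi :> R := pi_gt0 R.
have lt : - (pi / 2) < pi / 2 :> R by lra.
pose F (x : R) := 2 * sin x.
have Fd x : is_derive x (1 : R) F (2 * cos x).
  by apply: is_derive_eq; rewrite /GRing.scale /=; ring.
have F' : derive1 F = (fun x => 2 * cos x).
  by apply/funext => x; rewrite derive1E; exact: (@derive_val _ _ _ _ _ _ _ (Fd x)).
have cF' : continuous (derive1 F).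
  by rewrite F' => x; apply: cvgM; [exact: cvg_cst|exact: continuous_cos].
have cF : continuous F by move=> x; apply: cvgM; [exact: cvg_cst|exact: continuous_sin].
have Fa : F (- (pi / 2)) = -2 by rewrite /F sinN sin_pihalf; ring.
have Fb : F (pi / 2) = 2 by rewrite /F sin_pihalf mulr1.
have sub : (\int[mu]_(x in `[F (- (pi / 2))%R, F (pi / 2)%R]) (w x)%:E =
    \int[mu]_(x in `[(- (pi / 2) : R)%R, (pi / 2)%R]) (((w \o F) * derive1 F)%R x)%:E)%E.
  apply: integration_by_substitution_increasing.
  - exact: ltW.
  - by move=> x y xI yI xy; rewrite ltr_pM2l // ltr_sin.
  - by move=> x _; exact: cF'.
  - by apply/cvg_ex; exists (derive1 F (- (pi / 2))); exact/cvg_at_right_filter/cF'.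
  - by apply/cvg_ex; exists (derive1 F (pi / 2)); exact/cvg_at_left_filter/cF'.
  - split.
    + by move=> x _; have [] := Fd x.
    + exact/cvg_at_right_filter/cF.
    + exact/cvg_at_left_filter/cF.
  - exact/continuous_subspaceT/semicircle_continuous.
rewrite Fa Fb in sub.
have cc : continuous (fun x : R => 4 * cos x ^+ 2).
  move=> x; apply: cvgM; first exact: cvg_cst.
  by apply: cvgM; exact: continuous_cos.
pose G (x : R) := 2 * x + 2 * (sin x * cos x).
have cG : continuous G.
  move=> x; apply: cvgD; first by apply: cvgM; [exact: cvg_cst|exact: cvg_id].
  apply: cvgM; first exact: cvg_cst.
  by apply: cvgM; [exact: continuous_sin|exact: continuous_cos].
have dG (x : R) : - (pi / 2) < x < pi / 2 -> is_derive x (1 : R) G (4 * cos x ^+ 2).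
  move=> _; apply: is_derive_eq; rewrite /GRing.scale /=.
  by have := cos2Dsin2 x; nra.
have := Rintegral_FTC lt cc cG dG.
rewrite {1 2}/G sinN !sin_pihalf cosN cos_pihalf !mulr0 !addr0 => e.
rewrite /semicircle_moment; under eq_Rintegral do rewrite expr0 mul1r.
rewrite /Rintegral sub.
have key (x : R) : 0 <= cos x ->
    Num.sqrt (4 - (2 * sin x) ^+ 2) * (2 * cos x) = 4 * cos x ^+ 2.
  move=> c0; have -> : 4 - (2 * sin x) ^+ 2 = (2 * cos x) ^+ 2.
    by rewrite !exprMn sin2cos2; ring.
  by rewrite sqrtr_sqr ger0_norm ?mulr_ge0 //; ring.
rewrite (@eq_integral _ _ _ mu _ (fun x : R => (4 * cos x ^+ 2)%:E)); last first.
  move=> x; rewrite inE /= in_itv /= => /andP[x1 x2]; congr EFin.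
  by rewrite F'; apply: key; apply: cos_ge0_pihalf; rewrite x1 x2.
rewrite -[fine _]/(\int[mu]_(x in `[(- (pi / 2) : R), pi / 2]) (4 * cos x ^+ 2)) e.
have pin : pi != 0 :> R by rewrite gt_eqF.
have -> : 2 * (pi / 2) - 2 * - (pi / 2) = 2 * pi :> R by field.
by rewrite mulVf // mulf_neq0.
Qed.

Lemma semicircle_moment_ballot p : semicircle_moment p = (ballot p 0)%:R.
Proof.
have [N] := ubnP p; elim: N p => // N IH [|[|p]] pN.
- by rewrite semicircle_moment0.
- by rewrite semicircle_moment1.
have p4 : (p + 4)%:R != 0 :> R by rewrite pnatr_eq0 addn4.
apply: (mulfI p4); rewrite semicircle_moment_rec IH; last by lia.
by rewrite -!natrM ballot_rec.
Qed.

End Semicircle.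

(** * Vacuum moments on the full Fock space *)

Section Fock.
Variable K : comPzRingType.
Implicit Types (f g : seq bool -> K) (h : bool -> K) (b : bool).

Definition unit_vec b : bool -> K := fun b' => (b == b')%:R.

Lemma field_op_unit b f x : field_op (unit_vec b) f x =
  (if x is b' :: y then (b == b')%:R * f y else 0) + f (b :: x).
Proof.
rewrite /field_op /creation; congr (_ + _).
rewrite /annihilation (bigD1 b) //= /unit_vec eqxx mul1r big1 ?addr0 // => b' /negPf.
by rewrite eq_sym => ->; rewrite mul0r.
Qed.

Lemma field_op_lin h c f g x :
  field_op h (fun y => c * f y + g y) x = c * field_op h f x + field_op h g x.
Proof.
rewrite /field_op mulrDr addrACA; congr (_ + _).
  by rewrite /creation; case: x => [|b x]; rewrite ?mulr0 ?addr0 // mulrDr mulrCA.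
rewrite /annihilation mulr_sumr -big_split; apply: eq_bigr => b _ /=.
by rewrite mulrDr mulrCA.
Qed.

Lemma fields_lin hs c f g x :
  fields hs (fun y => c * f y + g y) x = c * fields hs f x + fields hs g x.
Proof.
elim: hs x => //= h hs IH x.
by rewrite -field_op_lin; congr (field_op h _ x); apply/funext.
Qed.

Lemma fields0 hs x : fields hs (fun=> 0 : K) x = 0.
Proof.
have e : (fun=> 0) = (fun _ : seq bool => -1 * 0 + 0 : K).
  by apply/funext => y; rewrite mulr0 addr0.
by rewrite [in LHS]e fields_lin mulN1r addNr.
Qed.

Lemma field_op_sum h f x : field_op h f x = \sum_b h b * field_op (unit_vec b) f x.
Proof.
under eq_bigr do rewrite field_op_unit mulrDr.
rewrite big_split /=; congr (_ + _); case: x => [|b x] /=.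
  by rewrite big1 // => b _; rewrite mulr0.
rewrite (bigD1 b) //= eqxx mul1r big1 ?addr0 // => b' /negPf ->.
by rewrite mul0r mulr0.
Qed.

(** The inner product of the components of tensor degree at most [N]; the
    recursion on the first letter avoids enumerating words. *)
Fixpoint inner N f g : K :=
  f [::] * g [::] + (if N is N'.+1 then
    \sum_b inner N' (fun x => f (b :: x)) (fun x => g (b :: x)) else 0).

Definition short N f := forall x, (N < size x)%N -> f x = 0.

Lemma innerC N f g : inner N f g = inner N g f.
Proof.
elim: N f g => [|N IH] f g /=; first by rewrite mulrC.
by rewrite mulrC; congr (_ + _); apply: eq_bigr => b _; exact: IH.
Qed.

Lemma inner_lin N c f g f' :
  inner N (fun x => c * f x + g x) f' = c * inner N f f' + inner N g f'.
Proof.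
elim: N f g f' => [|N IH] f g f' /=; first by rewrite !addr0 mulrDl mulrA.
under eq_bigr do rewrite IH.
rewrite big_split -mulr_sumr /= mulrDl mulrDr -mulrA.
by rewrite addrACA.
Qed.

Lemma inner0 N g : inner N (fun=> 0) g = 0.
Proof.
elim: N g => [|N IH] g /=; first by rewrite mul0r addr0.
by rewrite mul0r add0r big1.
Qed.

Lemma inner_short0 N f g : (forall x, f x = 0) -> inner N f g = 0.
Proof. by move=> f0; rewrite (_ : f = fun=> 0) ?inner0 //; apply/funext. Qed.

Lemma inner_shortS N f g : short N f -> inner N.+1 f g = inner N f g.
Proof.
elim: N f g => [|N IH] f g sf.
  by rewrite /= big1 // => b _; rewrite sf // mul0r addr0.
transitivity (f [::] * g [::] +
   \sum_b inner N.+1 (fun x => f (b :: x)) (fun x => g (b :: x))) => //.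
congr (_ + _); apply: eq_bigr => b _; apply: IH => x xN; exact: sf.
Qed.

(** Field operators are symmetric because creation and annihilation are adjoint
    to each other.  Truncation at degree [N.+1] is harmless: a field operator raises
    the degree by at most one. *)
Lemma inner_field N b f g : short N f -> short N g ->
  inner N.+1 (field_op (unit_vec b) f) g = inner N.+1 f (field_op (unit_vec b) g).
Proof.
have half f' g' : short N f' -> inner N.+1 (field_op (unit_vec b) f') g' =
    inner N f' (fun x => g' (b :: x)) + inner N (fun x => f' (b :: x)) g'.
  move=> sf; rewrite -(@inner_shortS N (fun x => f' (b :: x))); last first.
    by move=> x xN; apply: sf; rewrite /= ltnW.
  rewrite /= field_op_unit add0r addrCA; congr (_ + _).
  have e b' : (fun x => field_op (unit_vec b) f' (b' :: x)) =
      (fun x => (b == b')%:R * f' x + f' (b :: b' :: x)).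
    by apply/funext => x; rewrite field_op_unit.
  under eq_bigr do rewrite e inner_lin.
  rewrite big_split /=; congr (_ + _).
  rewrite (bigD1 b) //= eqxx mul1r big1 ?addr0 // => b' /negPf.
  by rewrite eq_sym => ->; rewrite mul0r.
move=> sf sg; rewrite half // innerC [RHS]innerC half // addrC.
by rewrite [X in X + _]innerC [X in _ + X]innerC.
Qed.

Definition fock_vec (u : seq bool) : seq bool -> K := fields (map unit_vec u) (@vacuum K).

Lemma fock_vec_short u : short (size u) (fock_vec u).
Proof.
elim: u => [|b u IH] x; first by case: x.
move=> xu; rewrite [LHS](field_op_unit b (fock_vec u)) [fock_vec u (b :: x)]IH; last first.
  by move: xu => /=; lia.
by case: x xu => [|b' x] xu; rewrite ?addr0 // IH ?mulr0 //; move: xu => /=; lia.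
Qed.

Lemma short_le N M f : (N <= M)%N -> short N f -> short M f.
Proof. by move=> NM sf x xM; apply: sf; exact: leq_ltn_trans NM xM. Qed.

Lemma inner_vacuum N g : inner N (@vacuum K) g = g [::].
Proof.
case: N => [|N] /=; rewrite /vacuum eqxx mul1r ?addr0 // big1 ?addr0 // => b _.
exact: inner_short0.
Qed.

Definition fock_moment u : K := fock_vec u [::].

Lemma fock_vec_inner N u v : (size u + size v < N)%N ->
  inner N (fock_vec u) (fock_vec v) = fock_moment (rev u ++ v).
Proof.
case: N => // N; elim: u v => [|b u IH] v uvN; first exact: inner_vacuum.
rewrite [LHS](@inner_field N b (fock_vec u) (fock_vec v)); last 2 first.
- by apply: short_le (@fock_vec_short u); move: uvN => /=; lia.
- by apply: short_le (@fock_vec_short v); move: uvN => /=; lia.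
by rewrite (IH (b :: v)) ?rev_cons ?cat_rcons //; move: uvN => /=; lia.
Qed.

Lemma fock_moment_rev u : fock_moment (rev u) = fock_moment u.
Proof.
have e := @fock_vec_inner (size u).+1 u [::]; rewrite cats0 in e.
rewrite -e ?addn0 // innerC (@fock_vec_inner _ [::] u) //.
Qed.

End Fock.

Lemma inner_ge0 (R : realDomainType) N (f : seq bool -> R) : 0 <= inner N f f.
Proof.
elim: N f => [|N IH] f /=; first by rewrite addr0 -expr2 sqr_ge0.
by rewrite addr_ge0 ?sumr_ge0 // -expr2 sqr_ge0.
Qed.

(** By [fock_vec_inner] the matrix of the vacuum moments is a Gram matrix. *)
Lemma fock_moment_ge0 (R : realDomainType) (s : seq (seq bool)) (c : seq bool -> R) :
  0 <= \sum_(u <- s) \sum_(v <- s) c u * c v * fock_moment R (rev u ++ v).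
Proof.
pose N := (\max_(u <- s) size u).*2.+1.
pose F (x : seq bool) : R := \sum_(u <- s) c u * fock_vec R u x.
have sumE (r : seq (seq bool)) g :
    inner N (fun x => \sum_(u <- r) c u * fock_vec R u x) g =
    \sum_(u <- r) c u * inner N (fock_vec R u) g.
  elim: r => [|u r IH].
    by rewrite big_nil; apply: inner_short0 => x; rewrite big_nil.
  rewrite big_cons -IH -inner_lin; congr (inner N _ g).
  by apply/funext => x; rewrite big_cons.
have -> : \sum_(u <- s) \sum_(v <- s) c u * c v * fock_moment R (rev u ++ v) =
    inner N F F; last exact: inner_ge0.
rewrite sumE big_seq [RHS]big_seq; apply: eq_bigr => u us.
rewrite innerC sumE mulr_sumr big_seq [RHS]big_seq; apply: eq_bigr => v vs.
rewrite -mulrA; congr (_ * (_ * _)); rewrite innerC fock_vec_inner //.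
have mx (x : seq bool) : x \in s -> (size x <= \max_(u <- s) size u)%N.
  by move=> xs; apply: leq_bigmax_seq.
by have := mx _ us; have := mx _ vs; rewrite /N; lia.
Qed.

(** * Free semicircular elements *)
Section FockState.
Variable R : realType.
Local Notation C := R[i].

Lemma fock_vec_complex u x : fock_vec C u x = (fock_vec R u x)%:C%C.
Proof.
elim: u x => [|b u IH] x; first by rewrite /fock_vec /= /vacuum rmorph_nat.
rewrite [LHS](field_op_unit b (fock_vec C u)) [fock_vec R (b :: u) x](field_op_unit b (fock_vec R u)).
rewrite rmorphD /= IH; congr (_ + _).
by case: x => // b' y; rewrite IH rmorphM rmorph_nat.
Qed.

Variables (A : ncps R) (s : bool -> A).
Hypothesis s_star : forall b, star (s b) = s b.
Hypothesis s_state : forall u, state (\prod_(b <- u) s b) = (fock_moment R u)%:C%C.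

(** Seen from the state, the element [a] acts on the vacuum as the vector [f].
    This transports computations in an abstract algebra to the Fock space without
    requiring a representation of the algebra. *)
Definition represents (a : A) (f : seq bool -> C) :=
  forall u, state (\prod_(b <- u) s b * a) = fields (map (@unit_vec C) u) f [::].

Lemma represents1 : represents 1 (@vacuum C).
Proof. by move=> u; rewrite mulr1 s_state -fock_vec_complex. Qed.

Lemma represents_gen b a f : represents a f ->
  represents (s b * a) (field_op (unit_vec C b) f).
Proof.
move=> h u; have := h (u ++ [:: b]); rewrite big_cat big_seq1 /= mulrA => ->.
by rewrite map_cat /fields foldr_cat.
Qed.

Lemma represents_lin c a a' f f' : represents a f -> represents a' f' ->
  represents (c *: a + a') (fun x => c * f x + f' x).
Proof.
move=> h h' u; rewrite mulrDr -scalerAr linearP /= h h'.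
by rewrite fields_lin.
Qed.

Lemma represents0 : represents 0 (fun=> 0).
Proof. by move=> u; rewrite mulr0 linear0 fields0. Qed.

Lemma represents_ext a f g : represents a f -> f =1 g -> represents a g.
Proof. by move=> h /funext <-. Qed.

Lemma represents_field (g : bool -> C) a f : represents a f ->
  represents ((\sum_b g b *: s b) * a) (field_op g f).
Proof.
move=> h; have -> : (\sum_b g b *: s b) * a =
    g true *: (s true * a) + (g false *: (s false * a) + 0).
  by rewrite big_bool addr0 mulrDl !scalerAl.
apply: (represents_ext (represents_lin (g true) (represents_gen true h)
  (represents_lin (g false) (represents_gen false h) represents0))) => x.
by rewrite addr0 [RHS]field_op_sum [RHS]big_bool.
Qed.

(** The vector sum_k c_k b^k f, where b^k f is [f] with k letters [b] added in
    front of each word, provided that [f] has no component on words that begin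
    with [b]. *)
Fixpoint peel b (c : nat -> C) (f : seq bool -> C) (x : seq bool) : C :=
  if x is b' :: y then
    if b' == b then peel b (fun k => c k.+1) f y else c 0%N * f x
  else c 0%N * f x.

(** The effect on the coefficients of one more field operator: creation moves c
    up by one place and annihilation moves it down. *)
Definition shift (c : nat -> C) (k : nat) : C :=
  (if k is k'.+1 then c k' else 0) + c k.+1.

Definition avoids b (f : seq bool -> C) := forall y, f (b :: y) = 0.

Lemma peelD b c c' f x : peel b (fun k => c k + c' k) f x = peel b c f x + peel b c' f x.
Proof.
elim: x c c' => [|b' y IH] c c' /=; first by rewrite mulrDl.
by case: eqP => _; rewrite ?IH // mulrDl.
Qed.

Lemma peelZ b z c f x : peel b (fun k => z * c k) f x = z * peel b c f x.
Proof.
elim: x c => [|b' y IH] c /=; first by rewrite mulrA.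
by case: eqP => _; rewrite ?IH // mulrA.
Qed.

Lemma peel_delta b f : avoids b f -> peel b (fun k => (k == 0%N)%:R) f =1 f.
Proof.
move=> av [|b' y] /=; first by rewrite mul1r.
case: eqP => [->|_]; last by rewrite mul1r.
rewrite av; move: y; suff H c y : (forall k, c k = 0) -> peel b c f y = 0 by move=> y; apply: H.
by elim: y c => [|b'' y IH] c c0 /=; rewrite ?c0 ?mul0r //; case: eqP => _ //; apply: IH.
Qed.

Lemma field_peel b c f : avoids b f ->
  field_op (unit_vec C b) (peel b c f) =1 peel b (shift c) f.
Proof.
move=> av x; rewrite field_op_unit /shift peelD /= eqxx; congr (_ + _).
case: x => [|b' y] /=; first by rewrite mul0r.
by rewrite eq_sym; case: (b' == b); rewrite ?mul1r ?mul0r.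
Qed.

Lemma horner_alg_comm (a : A) (p : {poly C}) :
  horner_alg a p * a = a * horner_alg a p.
Proof.
by have := congr1 (horner_alg a) (mulrC p 'X); rewrite !rmorphM /= horner_algX.
Qed.

(** The coefficients depend on [p] only, not on [f]; evaluating at the vacuum
    then identifies [c 0] with the state of p(s_b). *)
Lemma represents_poly b (p : {poly C}) : exists c, forall a f, represents a f ->
  avoids b f -> represents (horner_alg (s b) p * a) (peel b c f).
Proof.
elim/poly_ind: p => [|p z [c hc]].
  exists (fun=> 0) => a f h av; rewrite rmorph0 mul0r.
  apply: (represents_ext represents0) => x.
  by have := @peelZ b 0 (fun=> 0) f x; rewrite !mul0r.
exists (fun k => z * (k == 0%N)%:R + shift c k) => a f h av.
have -> : horner_alg (s b) (p * 'X + z%:P) * a =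
    z *: a + s b * (horner_alg (s b) p * a).
  rewrite rmorphD rmorphM /= horner_algX horner_algC mulrDl addrC; congr (_ + _).
    by rewrite -scalerAl mul1r.
  by rewrite mulrA horner_alg_comm.
apply: (represents_ext (represents_lin z h (represents_gen b (hc _ _ h av)))) => x.
by rewrite peelD peelZ peel_delta // field_peel.
Qed.

Lemma generated_poly b u : generated_subalgebra (s b) u ->
  exists p : {poly C}, u = horner_alg (s b) p.
Proof.
move=> h; apply: (h [set v | exists p : {poly C}, v = horner_alg (s b) p]); split.
  split=> /=.
  - by exists 1; rewrite rmorph1.
  - by move=> _ _ [p ->] [q ->]; exists (p + q); rewrite rmorphD.
  - by move=> _ _ [p ->] [q ->]; exists (p * q); rewrite rmorphM.
  - by move=> c _ [p ->]; exists (c *: p); rewrite -mul_polyC rmorphM /= horner_algC mulr_algl.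
  move=> _ [p ->]; elim/poly_ind: p => [|p z [q hq]].
    exists 0; rewrite !rmorph0; have := starZ 0 (0 : A).
    by rewrite !scale0r => ->; rewrite rmorph0 scale0r.
  exists (q * 'X + (z^*%C)%:P); rewrite !rmorphD !rmorphM /= !horner_algX !horner_algC.
  have s1 : star (1 : A) = 1.
    by have := starM (star 1) (1 : A); rewrite mulr1 starK mulr1.
  rewrite starD starM starZ s1 s_star hq; congr (_ + _).
  by rewrite horner_alg_comm.
by move=> _ ->; exists 'X; rewrite /= horner_algX.
Qed.

Lemma state_represents a f : represents a f -> state a = f [::].
Proof. by move=> h; have := h [::]; rewrite big_nil mul1r. Qed.

Lemma avoids_vacuum b : avoids b (@vacuum C).
Proof. by []. Qed.

(** Applying the factors from right to left, each centred polynomial in s_b meets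
    a vector without components on words beginning with [b].  Its coefficient
    sequence starts with 0, so the result only has components on words beginning
    with [b], and the next factor has another colour.  The final vector has no
    component on the vacuum. *)
Lemma generators_free (x : bool -> A) : x =1 s -> free_elements x.
Proof.
move=> /funext ->; move=> l ln0 hl sl.
suff [f [rf f0 fh]] : exists f, [/\ represents (\prod_(u <- l) u.2) f, f [::] = 0 &
    forall b y, b != (head (true, 0) l).1 -> f (b :: y) = 0].
  by rewrite (state_represents rf).
elim: l ln0 hl sl => // -[b v] l IH _ hl sl.
have [hv v0] := hl (b, v) (mem_head _ _).
have [p vE] := generated_poly hv; have [c hc] := represents_poly b p.
have c0 : c 0%N = 0.
  have := state_represents (hc _ _ represents1 (@avoids_vacuum b)).
  by rewrite mulr1 -vE /= /vacuum eqxx mulr1 v0.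
have [f rf av] : exists2 f, represents (\prod_(u <- l) u.2) f & avoids b f.
  case: l IH hl sl => [|[b' v'] l] IH hl sl.
    by exists (@vacuum C) => //; rewrite big_nil; exact: represents1.
  have hl' u : u \in (b', v') :: l -> generated_subalgebra (s u.1) u.2 /\ state u.2 = 0.
    by move=> ul; apply: hl; rewrite inE ul orbT.
  have [f [rf f0 fh]] := IH isT hl' (path_sorted sl).
  by exists f => // y; apply: fh; case/andP: sl.
exists (peel b c f); split=> /=.
- by rewrite big_cons vE; exact: hc.
- by rewrite c0 mul0r.
- by move=> b' y /negPf ->; rewrite c0 mul0r.
Qed.

(** The coefficients of s_b^p on the vectors b^j obey the recursion defining
    [ballot]. *)
Lemma generator_semicircular b : semicircular (s b).
Proof.
split; first exact: s_star.
move=> p; rewrite -[X in _ = X%:C%C]/(semicircle_moment R p) semicircle_moment_ballot.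
have h : represents (s b ^+ p) (peel b (fun j => (ballot p j)%:R) (@vacuum C)).
  elim: p => [|p IH].
    apply: (represents_ext represents1) => x.
    by rewrite -(peel_delta (@avoids_vacuum b)).
  rewrite exprS; apply: (represents_ext (represents_gen b IH)) => x.
  rewrite field_peel //; congr (peel b _ _ x); apply/funext => -[|j].
    by rewrite /shift /= add0r add0n.
  by rewrite /shift /= natrD.
by rewrite (state_represents h) /= /vacuum eqxx mulr1 rmorph_nat.
Qed.

End FockState.

(** * The elliptic element *)

Section EllipticMoments.
Variables (R : realType) (r : R).
Hypothesis r_le1 : -1 <= r <= 1.
Local Open Scope complex_scope.

Let alpha : R := Num.sqrt ((1 + r) / 2).
Let beta : R := Num.sqrt ((1 - r) / 2).

(** The elliptic element and its adjoint are the field operators of these two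
    vectors; the covariance is bilinear, without conjugation. *)
Definition elliptic_vec (eps : bool) (b : bool) : R[i] :=
  if b then (if eps then - ('i * beta%:C) else 'i * beta%:C) else alpha%:C.

Lemma elliptic_vec_cov eps eps' :
  \sum_b elliptic_vec eps b * elliptic_vec eps' b = (r ^+ (eps == eps'))%:C.
Proof.
have a2 : alpha ^+ 2 = (1 + r) / 2 by rewrite sqr_sqrtr //; move: r_le1 => /andP[]; lra.
have b2 : beta ^+ 2 = (1 - r) / 2 by rewrite sqr_sqrtr //; move: r_le1 => /andP[]; lra.
have aa : alpha%:C * alpha%:C = ((1 + r) / 2)%:C by rewrite -rmorphM -expr2 a2.
have bb : ('i * beta%:C) * ('i * beta%:C) = (- ((1 - r) / 2))%:C.
  by rewrite mulrACA -expr2 sqr_i -rmorphM -expr2 b2 mulN1r rmorphN.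
rewrite big_bool /elliptic_vec /=; case: eps; case: eps' => /=;
  rewrite ?mulrNN ?mulrN ?mulNr aa bb -?rmorphN -rmorphD /= ?expr1 ?expr0; congr (_%:C); lra.
Qed.

Section Element.
Variables (A : ncps R) (s : bool -> A).
Hypothesis s_star : forall b, star (s b) = s b.
Hypothesis s_state : forall u, state (\prod_(b <- u) s b) = (fock_moment R u)%:C.

Definition elliptic_element : A := alpha%:C *: s false + ('i * beta%:C) *: s true.

Lemma elliptic_elementP : elliptic r elliptic_element.
Proof.
split=> //; exists (s false), (s true); split=> //.
- exact: generator_semicircular.
- exact: generator_semicircular.
- by apply: (generators_free s_star s_state) => -[].
Qed.

Lemma elliptic_star_word w :
  star_word w elliptic_element = \prod_(eps <- w) \sum_b elliptic_vec eps b *: s b.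
Proof.
apply: eq_bigr => eps _; rewrite big_bool /elliptic_vec /= addrC /elliptic_element.
case: eps => //; rewrite starD !starZ !s_star; congr (_ *: _ + _ *: _).
  exact: conjc_real.
rewrite [LHS]/(conjc _); apply/eqP; rewrite eq_complex /=.
by apply/andP; split; apply/eqP; ring.
Qed.

Lemma elliptic_moment w : state (star_word w elliptic_element) =
  (\sum_(sigma in @NC2s (size w)) \prod_(p < size w)
    \prod_(q < size w | (p < q)%N && ([set p; q]%SET \in sigma))
      r ^+ (nth false w p == nth false w q))%:C.
Proof.
have h : represents s (star_word w elliptic_element)
    (fields (map elliptic_vec w) (@vacuum R[i])).
  rewrite elliptic_star_word; elim: w => [|eps w IH].
    by rewrite big_nil; exact: represents1.
  by rewrite big_cons; exact: represents_field.
rewrite (state_represents h).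
have -> : map elliptic_vec w = [seq elliptic_vec (nth false w j) | j <- iota 0 (size w)].
  by rewrite -[in LHS](mkseq_nth false w) /mkseq -map_comp.
rewrite (wick (fun j => elliptic_vec (nth false w j))) rmorph_sum.
apply: eq_bigr => sigma _; rewrite rmorph_prod; apply: eq_bigr => p _.
by rewrite rmorph_prod; apply: eq_bigr => q _; exact: elliptic_vec_cov.
Qed.

End Element.
End EllipticMoments.

Lemma NC2_even m (sigma : {set {set 'I_m}}) : NC2 sigma -> ~~ odd m.
Proof. by move=> nc; rewrite -(card_opener nc) odd_double. Qed.

Lemma free_semicirculars (R : realType) : exists (A : ncps R) (s : bool -> A),
  (forall b, star (s b) = s b) /\
  (forall u, state (\prod_(b <- u) s b) = (fock_moment R u)%:C%C).
Proof.
have idK : involutive (fun b : bool => b) by [].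
have mu_star u : fock_moment R (word_star (fun b => b) u) = fock_moment R u.
  by rewrite /word_star map_id fock_moment_rev.
have mu_ge0 (s : seq (seq bool)) (c : seq bool -> R) :
  0 <= \sum_(u <- s) \sum_(v <- s) c u * c v * fock_moment R (word_star (fun b => b) u ++ v).
  rewrite /word_star; under eq_bigr do under eq_bigr do rewrite map_id.
  exact: fock_moment_ge0.
have mu1 : fock_moment R [::] = 1 by [].
exists (word_ncps idK mu1 mu_star mu_ge0), (word_gen idK mu1 mu_star mu_ge0); split.
  by move=> b; rewrite star_word_gen.
by move=> u; rewrite state_word_gen.
Qed.

Theorem theorem1 (R : realType) (d : measure_display) (T : measurableType d)
    (P : probability T R) (rho : nat -> R) (a : nat -> nat -> {RV P >-> R})
    (rho0 : rho 0%N = 1)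
    (indep : mutually_independent P
       [set ij : nat * nat | (ij.1 <= ij.2)%N] (entry_sigma a))
    (mean0 : forall i j, ('E_P[a i j] = 0)%E)
    (var1 : forall i j, ('E_P[(fun t => a i j t ^+ 2)%R] = 1)%E)
    (moments : forall q : nat, exists M : R, forall i j,
       ('E_P[(fun t => `|a i j t| ^+ q)%R] <= M%:E)%E)
    (covar : forall i j, i != j ->
       ('E_P[(fun t => a i j t * a j i t)%R] = (rho `|i%:Z - j%:Z|%N)%:E)%E) :
  (pairing_limits_exist rho -> cvg_stardist P (scaled_mx a)) /\
  (forall r : R, (forall i, (0 < i)%N -> rho i = r) ->
     pairing_limits_exist rho /\
     exists (A : ncps R) (e : A),
       elliptic r e /\ cvg_stardist_to P (scaled_mx a) e).
Proof.
split; first exact: cvg_stardist_limits.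
move=> r rhoE; have rho_le1 := norm_rho_le1 rho0 var1 moments covar.
have cvg_pairing k (eps : 'I_k.*2 -> bool) sigma : (0 < k)%N -> NC2 sigma ->
    pairing_sum rho eps sigma @ \oo --> pairing_value r eps sigma.
  by move=> k0; exact: cvg_pairing_sum.
split; first by move=> k k0 eps sigma nc; exists (pairing_value r eps sigma); exact: cvg_pairing.
have r_le1 : -1 <= r <= 1 by rewrite -ler_norml -(rhoE 1%N).
have [A [s [s_star s_state]]] := free_semicirculars R.
exists A, (elliptic_element r s); split; first exact: elliptic_elementP.
apply: cvg_stardist_of_moments => w.
have em := elliptic_moment r_le1 s_star s_state w.
case: w em => [|b w] em.
  by exists 1; [exact: word_moment_nil_cvg|rewrite /star_word big_nil state1 rmorph1].
have := odd_double_half (size (b :: w)); case eo: (odd _) => /esym wk.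
  exists 0; first exact: (word_moment_odd indep mean0 moments wk).
  rewrite em big_pred0 ?rmorph0 // => sigma; apply/negP => /asboolP/NC2_even.
  by rewrite eo.
have k0 : (0 < (size (b :: w))./2)%N by case: w wk {em eo}.
rewrite add0n in wk; rewrite wk in em.
exists (\sum_(sigma in @NC2s (size (b :: w))./2.*2)
    pairing_value r (@word_eps (b :: w) _) sigma); last exact: em.
by apply: (word_moment_even_cvg rho0 indep mean0 var1 moments covar wk k0) => sigma; exact: cvg_pairing.
Qed.
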